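(* Let $n\ge 2$. The mapping $\mathcal{R}:(\phi,\psi)\mapsto \mathcal{R}_{\psi}\phi$ (linear in $\phi$, conjugate-linear in $\psi$), where $\mathcal{R}_{\psi}\phi(\mathbf{u},b,a)=\int_{\mathbb{R}^n}\phi(\mathbf{x})\,\frac1a\overline{\psi}\left(\frac{\mathbf{x}\cdot\mathbf{u}-b}{a}\right)d\mathbf{x}$ is the ridgelet transform, is a well-defined continuous mapping $\mathcal{R}:\mathcal{S}_0(\mathbb{R}^n)\times\mathcal{S}_0(\mathbb{R})\to\mathcal{S}(\mathbb{Y}^{n+1})$.
   Context: $\mathbb{S}^{n-1}$ is the unit sphere of $\mathbb{R}^n$, $\mathbb{Y}^{n+1}=\mathbb{S}^{n-1}\times\mathbb{R}\times\mathbb{R}_+$ with points $(\mathbf{u},b,a)$, where $\mathbb{R}_+=(0,\infty)$. For $d\geq 1$, $\mathcal{S}_0(\mathbb{R}^d)$ is the closed subspace (with the subspace topology) of the Schwartz space $\mathcal{S}(\mathbb{R}^d)$ of those $\phi$ with $\int_{\mathbb{R}^d}\mathbf{x}^m\phi(\mathbf{x})d\mathbf{x}=0$ for all multi-indices $m\in\mathbb{N}_0^d$. $\mathcal{S}(\mathbb{Y}^{n+1})$ is the space of $\Phi\in C^\infty(\mathbb{Y}^{n+1})$ such that for all $l,m,k,s,r\in\mathbb{N}_0$ $$\rho^{l,m,k}_{s,r}(\Phi)=\sup_{(\mathbf{u},b,a)\in\mathbb{Y}^{n+1}}\left(a^s+\frac1{a^s}\right)(1+b^2)^{r/2}\left|\frac{\partial^l}{\partial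 a^l}\frac{\partial^m}{\partial b^m}\triangle_{\mathbf{u}}^k\Phi(\mathbf{u},b,a)\right|<\infty,$$ with the topology defined by these seminorms; $\triangle_{\mathbf{u}}$ is the Laplace–Beltrami operator on $\mathbb{S}^{n-1}$. *)

(* Defs.v *)
From HB Require Import structures.
From mathcomp Require Import all_boot all_order all_algebra.
From mathcomp.real_closed Require Import complex.
From mathcomp Require Import all_classical all_reals all_analysis.

Set Implicit Arguments.
Unset Strict Implicit.
Unset Printing Implicit Defensive.

Import Order.TTheory GRing.Theory Num.Theory.
Import numFieldNormedType.Exports.

Local Open Scope classical_set_scope.
Local Open Scope ring_scope.

Definition cons_pair (R : realType) (n : nat)
    (p : measurableTypeR R * n.-tuple (measurableTypeR R)) :
    n.+1.-tuple (measurableTypeR R) :=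
  [tuple of p.1 :: p.2].

Lemma measurable_cons_pair (R : realType) (n : nat) :
  measurable_fun setT (@cons_pair R n).
Proof. exact: measurable_cons. Qed.

Definition lebesgue_step (R : realType) (n : nat)
    (m : {sigma_finite_measure set (n.-tuple (measurableTypeR R)) -> \bar R}) :
    set (n.+1.-tuple (measurableTypeR R)) -> \bar R :=
  pushforward (@lebesgue_measure R \x m)%E (@cons_pair R n).

Section lebesgue_step_measure.
Context (R : realType) (n : nat)
  (m : {sigma_finite_measure set (n.-tuple (measurableTypeR R)) -> \bar R}).

Let step_measure : {measure set (n.+1.-tuple (measurableTypeR R)) -> \bar R} :=
  @measure_function_pushforward__canonical__measure_function_Measure
    _ _ _ _ _ (@lebesgue_measure R \x m)%E _ (@measurable_cons_pair R n).

HB.instance Definition _ := isMeasure.Build _ _ _ (lebesgue_step m)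
  (measure0 step_measure) (measure_ge0 step_measure)
  (@measure_semi_sigma_additive _ _ _ step_measure).

Let step_sigma_finite : sigma_finite setT (lebesgue_step m).
Proof.
pose uncons (t : n.+1.-tuple (measurableTypeR R)) :=
  (thead t, [tuple of behead t]).
have consK : cancel (@cons_pair R n) uncons.
  by case=> x t; congr (_, _); apply/val_inj.
have unconsK : cancel uncons (@cons_pair R n).
  by move=> t; rewrite /cons_pair /uncons /= -tuple_eta.
have muncons : measurable_fun setT uncons.
  apply/measurable_fun_pairP; split.
    exact: measurable_tnth.
  exact: measurable_behead.
have /sigma_finiteP[F [TF ndF Foo]] := sigma_finiteT (@lebesgue_measure R).
have /sigma_finiteP[G [TG ndG Goo]] := sigma_finiteT m.
exists (fun k => uncons @^-1` (F k `*` G k)) => [|k].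
  rewrite -preimage_bigcup (_ : \bigcup_k _ = setT) ?preimage_setT//.
  apply/seteqP; split=> // -[x y] _.
  have [i _ Fx] : (\bigcup_i F i) x by rewrite -TF.
  have [j _ Gy] : (\bigcup_i G i) y by rewrite -TG.
  exists (maxn i j) => //; split => /=.
    by move: x Fx; exact/subsetPset/ndF/leq_maxl.
  by move: y Gy; exact/subsetPset/ndG/leq_maxr.
have [mF ltF] := Foo k; have [mG ltG] := Goo k; split.
  by rewrite -[X in measurable X]setTI; apply: muncons => //; exact: measurableX.
rewrite /lebesgue_step /pushforward -comp_preimage.
rewrite (_ : uncons \o _ = id); last exact/funext.
rewrite preimage_id product_measure1E//.
by rewrite lte_mul_pinfty// ge0_fin_numE.
Qed.

HB.instance Definition _ := Measure_isSigmaFinite.Build _ _ _ (lebesgue_step m)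
  step_sigma_finite.

End lebesgue_step_measure.

(* The library puts the product sigma-algebra on tuples, and the norm and the
   differential calculus on ['rV_n]; [row_of] mediates between the two. *)
Fixpoint lebesgue_rn (R : realType) (n : nat) :
    {sigma_finite_measure set (n.-tuple (measurableTypeR R)) -> \bar R} :=
  if n is k.+1 then lebesgue_step (lebesgue_rn R k) else \d_ [tuple].

Definition row_of (R : realType) (n : nat)
    (t : n.-tuple (measurableTypeR R)) : 'rV[R]_n :=
  \row_i tnth t i.

Definition rn_integrable (R : realType) (n : nat) (f : 'rV[R]_n -> R[i]) : Prop :=
  (lebesgue_rn R n).-integrable setT (fun t => (complex.Re (f (row_of t)))%:E) /\
  (lebesgue_rn R n).-integrable setT (fun t => (complex.Im (f (row_of t)))%:E).

Definition rn_integral (R : realType) (n : nat) (f : 'rV[R]_n -> R[i]) : R[i] :=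
  Complex (\int[lebesgue_rn R n]_t complex.Re (f (row_of t)))
          (\int[lebesgue_rn R n]_t complex.Im (f (row_of t))).

Definition edot (R : realType) (n : nat) (x y : 'rV[R]_n) : R :=
  \sum_i x 0 i * y 0 i.

(* The library norm on ['rV_n] is the sup norm. *)
Definition enorm (R : realType) (n : nat) (x : 'rV[R]_n) : R :=
  Num.sqrt (edot x x).

(* [C^oo] on an open set [U] of a finite-dimensional space [V]: all iterated
   directional derivatives exist and are continuous on [U]. *)
Definition iter_derive (R : realType) (V : normedModType R) (vs : seq V)
    (g : V -> R) : V -> R :=
  foldr (fun v h => 'D_v h) g vs.

Definition smooth_on (R : realType) (V : normedModType R) (U : set V)
    (g : V -> R) : Prop :=
  forall (vs : seq V) (x : V), U x ->
    {for x, continuous (iter_derive vs g)} /\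
    forall v : V, derivable (iter_derive vs g) x v.

Definition csmooth_on (R : realType) (V : normedModType R) (U : set V)
    (f : V -> R[i]) : Prop :=
  smooth_on U (fun x => complex.Re (f x)) /\
  smooth_on U (fun x => complex.Im (f x)).

Definition cderive (R : realType) (V : normedModType R) (v : V)
    (f : V -> R[i]) (x : V) : R[i] :=
  Complex ('D_v (fun y => complex.Re (f y)) x)
          ('D_v (fun y => complex.Im (f y)) x).

(* Subbase of the topology defined by a family of seminorms; the seminorms are
   given through the induced pseudodistances [p j f g], i.e. the value of the
   j-th seminorm at [g - f]. *)
Definition seminorm_subbase (R : realType) (T J : Type)
    (p : J -> T -> T -> \bar R) : set (set T) :=
  [set B | exists (j : J) (f : T) (e : R),
     0 < e /\ B = [set g | (p j f g < e%:E)%E]].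

Definition multi_index (n : nat) := 'I_n -> nat.

Definition monomial (R : realType) (n : nat) (m : multi_index n)
    (x : 'rV[R]_n) : R :=
  \prod_i x 0 i ^+ m i.

Definition multi_derive (R : realType) (n : nat) (m : multi_index n)
    (f : 'rV[R]_n -> R[i]) : 'rV[R]_n -> R[i] :=
  foldr (fun i g => iter (m i) (cderive (delta_mx 0 i : 'rV[R]_n)) g) f
    (enum 'I_n).

Definition schwartz_seminorm (R : realType) (n : nat)
    (ab : multi_index n * multi_index n) (f : 'rV[R]_n -> R[i]) : \bar R :=
  ereal_sup [set (`|monomial ab.1 x| * Normc.normc (multi_derive ab.2 f x))%:E
            | x in [set: 'rV[R]_n]].

Definition schwartz (R : realType) (n : nat) : set ('rV[R]_n -> R[i]) :=
  [set f | csmooth_on setT f /\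
           forall ab, (schwartz_seminorm ab f < +oo)%E].
Arguments schwartz : clear implicits.

Definition schwartz_space (R : realType) (n : nat) : Type :=
  set_type (schwartz R n).

HB.instance Definition _ (R : realType) (n : nat) :=
  Choice.copy (schwartz_space R n) (set_type (schwartz R n)).

Definition schwartz_fun (R : realType) (n : nat) (f : schwartz_space R n) :
    'rV[R]_n -> R[i] :=
  \val f.

Definition schwartz_dist (R : realType) (n : nat)
    (ab : multi_index n * multi_index n) (f g : schwartz_space R n) : \bar R :=
  schwartz_seminorm ab (fun x => schwartz_fun g x - schwartz_fun f x).

HB.instance Definition _ (R : realType) (n : nat) :=
  isSubBaseTopological.Build (schwartz_space R n)
    (seminorm_subbase (@schwartz_dist R n)) id.

(* Schwartz functions with all moments vanishing; as a type, this set carries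
   the subspace topology. *)
Definition S0 (R : realType) (n : nat) : set (schwartz_space R n) :=
  [set f | forall m : multi_index n,
     rn_integral (fun x => (monomial m x)%:C%C * schwartz_fun f x) = 0].
Arguments S0 : clear implicits.

Definition S0_fun (R : realType) (n : nat) (f : S0 R n) : 'rV[R]_n -> R[i] :=
  schwartz_fun (\val f).

Definition Y_pred (R : realType) (n : nat) : pred ('rV[R]_n * R * R) :=
  fun p => (enorm p.1.1 == 1) && (0 < p.2).

Definition Y (R : realType) (n : nat) : Type := {p | @Y_pred R n p}.

Definition Y_u (R : realType) (n : nat) (y : Y R n) : 'rV[R]_n := (sval y).1.1.
Definition Y_b (R : realType) (n : nat) (y : Y R n) : R := (sval y).1.2.
Definition Y_a (R : realType) (n : nat) (y : Y R n) : R := (sval y).2.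

(* Functions on [Y] are differentiated through their extension, homogeneous of
   degree 0 in the first variable, to the open set [Y_open]. In particular the
   Laplace-Beltrami operator is the restriction to the sphere of the Euclidean
   Laplacian of this extension. *)
Definition Y_open (R : realType) (n : nat) : set ('rV[R]_n * R * R) :=
  [set p | p.1.1 != 0 /\ 0 < p.2].
Arguments Y_open : clear implicits.

Definition Y_ext (R : realType) (n : nat) (F : Y R n -> R[i])
    (p : 'rV[R]_n * R * R) : R[i] :=
  if insub ((enorm p.1.1)^-1 *: p.1.1, p.1.2, p.2) is Some y then F y else 0.

Definition Y_smooth (R : realType) (n : nat) (F : Y R n -> R[i]) : Prop :=
  csmooth_on (Y_open R n) (Y_ext F).

Definition Y_derive_a (R : realType) (n : nat) (F : Y R n -> R[i])
    (y : Y R n) : R[i] :=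
  cderive ((0, 0, 1) : 'rV[R]_n * R * R) (Y_ext F) (sval y).

Definition Y_derive_b (R : realType) (n : nat) (F : Y R n -> R[i])
    (y : Y R n) : R[i] :=
  cderive ((0, 1, 0) : 'rV[R]_n * R * R) (Y_ext F) (sval y).

Definition Y_laplace_u (R : realType) (n : nat) (F : Y R n -> R[i])
    (y : Y R n) : R[i] :=
  \sum_(i < n) let e : 'rV[R]_n * R * R := (delta_mx 0 i, 0, 0) in
    cderive e (cderive e (Y_ext F)) (sval y).

(* The exponents, in the order [(l, m, k, s, r)]. *)
Definition Y_index : Type := (nat * nat * nat * nat * nat)%type.

Definition Y_seminorm (R : realType) (n : nat) (j : Y_index)
    (F : Y R n -> R[i]) : \bar R :=
  let: (l, m, k, s, r) := j in
  ereal_sup [set ((Y_a y ^+ s + (Y_a y ^+ s)^-1)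
                  * (1 + Y_b y ^+ 2) `^ (r%:R / 2)
                  * Normc.normc (iter l (@Y_derive_a R n)
                      (iter m (@Y_derive_b R n)
                        (iter k (@Y_laplace_u R n) F)) y))%:E
            | y in [set: Y R n]].

Definition schwartz_Y (R : realType) (n : nat) : set (Y R n -> R[i]) :=
  [set F | Y_smooth F /\ forall j, (Y_seminorm j F < +oo)%E].
Arguments schwartz_Y : clear implicits.

Definition SY (R : realType) (n : nat) : Type := set_type (schwartz_Y R n).

HB.instance Definition _ (R : realType) (n : nat) :=
  Choice.copy (SY R n) (set_type (schwartz_Y R n)).

Definition SY_fun (R : realType) (n : nat) (F : SY R n) : Y R n -> R[i] :=
  \val F.

Definition SY_dist (R : realType) (n : nat) (j : Y_index) (F G : SY R n) :
    \bar R :=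
  Y_seminorm j (fun y => SY_fun G y - SY_fun F y).

HB.instance Definition _ (R : realType) (n : nat) :=
  isSubBaseTopological.Build (SY R n) (seminorm_subbase (@SY_dist R n)) id.

(* Functions of one real variable are encoded as functions on ['rV_1]. *)
Definition ridgelet_integrand (R : realType) (n : nat) (phi : 'rV[R]_n -> R[i])
    (psi : 'rV[R]_1 -> R[i]) (y : Y R n) (x : 'rV[R]_n) : R[i] :=
  phi x * ((Y_a y)^-1)%:C%C *
  ((psi (const_mx ((edot x (Y_u y) - Y_b y) / Y_a y)))^*)%C.

Definition ridgelet (R : realType) (n : nat) (phi : 'rV[R]_n -> R[i])
    (psi : 'rV[R]_1 -> R[i]) (y : Y R n) : R[i] :=
  rn_integral (ridgelet_integrand phi psi y).

(* Main.v *)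
Require Import Defs.
From HB Require Import structures.
From mathcomp Require Import all_boot all_order all_algebra.
From mathcomp.real_closed Require Import complex.
From mathcomp Require Import all_classical all_reals all_analysis.
From mathcomp Require Import measurable_realfun.
From mathcomp Require Import ring lra zify.

Set Implicit Arguments.
Unset Strict Implicit.
Unset Printing Implicit Defensive.

Import Order.TTheory GRing.Theory Num.Theory.
Import numFieldNormedType.Exports.

Local Open Scope classical_set_scope.
Local Open Scope ring_scope.

(* By sesquilinearity it suffices to treat real [f] and [g]; put
   [wave_int f g w b = int f(x) g(x.w - b) dx], so that the transform at [(u,b,a)] is
   [a^-1 wave_int f g (u/a) (b/a)]. The quadratic Taylor bound for [g] makes [wave_int f g]
   differentiable with [d_(w_j) wave_int f g = wave_int (x_j f) g'] and
   [d_b wave_int f g = - wave_int f g'], so every derivative of the transform, including the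
   Laplacian on the sphere, is a combination of the same kind, with coefficients
   that are polynomials in [1/a] and the coordinates of [u], and with [x_j f],
   [g'], [t g] in place of [f], [g]; it remains to estimate [a^-1 wave_int f g].
   For [a >= 1]: the derivatives of [th |-> wave_int f g (th w) b] at [0] are moments of
   [f], hence vanish, and the mean value theorem gains a factor [1/a] at each
   order. For [a <= 1]: [g] is the derivative of a rapidly decreasing function
   whose moments vanish again, and integrating by parts along a coordinate [i]
   with [|u_i| >= 1/n] gains a factor [a] each time. *)

(** * Lebesgue measure on tuples *)

(** Joint continuity dictates the form of the estimates. Each is bilinear, [C * A * B] with [A] and
    [B] bounding finitely many weighted derivatives of [f] and [g], and [C], [N], [K] are fixed
    before [f] and [g]; the increment of the transform splits into three transforms, each with a
    small argument. Derivatives of [f] enter only through integration by parts along one coordinate,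
    so repeated derivatives in a single coordinate suffice. On the target side, each operator on [Y]
    differentiates the degree-0 extension of the previous result. A derivative of an extension is in
    general no longer an extension, so one must restrict to the sphere and extend again between two
    operators. For transforms this is bookkeeping on a syntax of expressions. But the subbasic
    neighbourhoods of [SY] have arbitrary centres, so the triangle inequality for the seminorms is
    required for functions that are not transforms; there it rests on the homogeneity of the
    derivatives. Integrals over [R^n] are dominated by the product weight [prodw], which is
    compatible with slicing off one coordinate at a time. *)

Section TupleMeasure.
Context {R : realType}.
Local Notation mu := (@lebesgue_measure R).

Lemma oneDsqrV_ge0 (x : R) : 0 <= (oneDsqr x)^-1.
Proof. by rewrite invr_ge0 (le_trans ler01 (oneDsqr_ge1 _)). Qed.

Lemma integrable_oneDsqrV : mu.-integrable setT (fun x => ((oneDsqr x)^-1)%:E).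
Proof.
have c : continuous (fun x : R => (oneDsqr x)^-1) by exact: continuous_oneDsqrV.
apply/integrableP; split.
  by apply/measurable_EFinP; exact: continuous_measurable_fun.
rewrite (eq_integral (fun x : measurableTypeR R => ((oneDsqr x)^-1)%:E)); last first.
  by move=> x _; rewrite gee0_abs// lee_fin oneDsqrV_ge0.
rewrite ge0_symfun_integralT//.
- by rewrite -set_itvcy integral0y_oneDsqr ltry.
- by move=> x /=; rewrite /oneDsqr sqrrN.
Qed.

(** The integrable majorant for everything integrated over [R^n]. Its product form makes
    integrability an induction on the dimension and lets a bound by [prodw] survive freezing a
    coordinate. *)
Definition prodw (n : nat) (t : n.-tuple (measurableTypeR R)) : R :=
  \prod_(i < n) (oneDsqr (tnth t i))^-1.

Lemma prodw_ge0 n (t : n.-tuple (measurableTypeR R)) : 0 <= prodw t.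
Proof.
by apply: prodr_ge0 => i _; exact: oneDsqrV_ge0.
Qed.

Lemma prodw_cons n (x : R) (t : n.-tuple (measurableTypeR R)) :
  prodw (cons_pair (x, t)) = (oneDsqr x)^-1 * prodw t.
Proof.
rewrite /prodw big_ord_recl; congr (_ * _).
by apply: eq_bigr => i _; rewrite /cons_pair /= tnthS.
Qed.

Lemma measurable_prodw n :
  measurable_fun setT (@prodw n : n.-tuple (measurableTypeR R) -> R).
Proof.
apply: measurable_prod => i _.
apply: (@measurableT_comp _ _ _ _ _ _ (fun x : R => (oneDsqr x)^-1)).
  by apply: continuous_measurable_fun; exact: continuous_oneDsqrV.
exact: measurable_tnth.
Qed.

Lemma integrable_prodw n :
  (lebesgue_rn R n).-integrable setT (fun t => (prodw t)%:E).
Proof.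
elim: n => [|n IH].
  apply/integrableP; split.
    by apply/measurable_EFinP; exact: measurable_prodw.
  rewrite integral_dirac//; last first.
    by do 2 apply/measurableT_comp => //; exact: measurable_prodw.
  by rewrite diracT mul1e /= ltry.
apply/integrableP; split.
  by apply/measurable_EFinP; exact: measurable_prodw.
have mabs : measurable_fun setT (fun t : n.+1.-tuple (measurableTypeR R) =>
    `|(prodw t)%:E|%E).
  by apply: measurableT_comp => //; apply/measurable_EFinP; exact: measurable_prodw.
(* The measure in dimension [n.+1] is by definition a pushforward of a product; exposing this gives
   access to change of variables and Tonelli. *)
rewrite -[X in (X < _)%E]/(\int[pushforward (mu \x lebesgue_rn R n)%E (@cons_pair R n)]_t
    `|(prodw t)%:E|)%E.
rewrite (ge0_integral_pushforward (@measurable_cons_pair R n))//.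
rewrite preimage_setT fubini_tonelli1//; last 2 first.
  exact: (measurableT_comp mabs (@measurable_cons_pair R n)).
  by move=> x; exact: abse_ge0.
have [I HI] : exists I : R, (\int[lebesgue_rn R n]_t `|(prodw t)%:E|)%E = I%:E.
  move/integrableP: IH => [_ IH].
  exists (fine (\int[lebesgue_rn R n]_t `|(prodw t)%:E|)%E).
  by rewrite fineK// ge0_fin_numE//; exact: integral_ge0.
rewrite (eq_integral (fun x : measurableTypeR R => (I%:E * ((oneDsqr x)^-1)%:E)%E)).
  have /integrableP[_] := integrableZl measurableT I integrable_oneDsqrV.
  apply: le_lt_trans; apply: (le_trans _ (le_abse_integral _ _ _)) => //.
    exact: lee_abs.
  by have /measurable_int := integrableZl measurableT I integrable_oneDsqrV.
move=> x _; rewrite /fubini_F /=.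
rewrite (eq_integral (fun t : n.-tuple (measurableTypeR R) =>
   (((oneDsqr x)^-1)%:E * `|(prodw t)%:E|)%E)); last first.
  by move=> t _; rewrite prodw_cons normrM (ger0_norm (oneDsqrV_ge0 x)) EFinM.
rewrite ge0_integralZl//.
rewrite HI muleC//.
by apply: measurableT_comp => //; apply/measurable_EFinP; exact: measurable_prodw.
Qed.

Lemma integrable_cons n (F : n.+1.-tuple (measurableTypeR R) -> R) :
  (lebesgue_rn R n.+1).-integrable setT (EFin \o F) ->
  (mu \x lebesgue_rn R n)%E.-integrable setT
    (fun p => (F (cons_pair p))%:E).
Proof.
move=> /integrableP[mF iF]; apply/integrableP; split.
  exact: (measurableT_comp mF (@measurable_cons_pair R n)).
move: iF.
rewrite -[X in (X < _)%E]/(\int[pushforward (mu \x lebesgue_rn R n)%E (@cons_pair R n)]_t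
    `|(F t)%:E|)%E.
rewrite (ge0_integral_pushforward (@measurable_cons_pair R n))//.
by apply: measurableT_comp.
Qed.

Lemma integral_cons n (F : n.+1.-tuple (measurableTypeR R) -> R) :
  (lebesgue_rn R n.+1).-integrable setT (EFin \o F) ->
  (\int[lebesgue_rn R n.+1]_t (F t)%:E =
   \int[mu \x lebesgue_rn R n]_p (F (cons_pair p))%:E)%E.
Proof.
move=> iF.
rewrite -[LHS]/(\int[pushforward (mu \x lebesgue_rn R n)%E (@cons_pair R n)]_t
    (F t)%:E)%E.
rewrite (integral_pushforward (@measurable_cons_pair R n))//.
  exact: measurable_int iF.
by rewrite preimage_setT; exact: integrable_cons.
Qed.

(** Both orders of integration serve integration by parts: this one freezes the head coordinate for
    an induction on the tail, the next one integrates the head coordinate innermost. *)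
Lemma Fubini_rn1 n (F : n.+1.-tuple (measurableTypeR R) -> R) :
  (lebesgue_rn R n.+1).-integrable setT (EFin \o F) ->
  (\int[lebesgue_rn R n.+1]_t (F t)%:E =
   \int[mu]_x \int[lebesgue_rn R n]_t (F (cons_pair (x, t)))%:E)%E.
Proof.
move=> iF; rewrite integral_cons//.
by rewrite -integral12_prod_meas1//; exact: integrable_cons.
Qed.

Lemma Fubini_rn2 n (F : n.+1.-tuple (measurableTypeR R) -> R) :
  (lebesgue_rn R n.+1).-integrable setT (EFin \o F) ->
  (\int[lebesgue_rn R n.+1]_t (F t)%:E =
   \int[lebesgue_rn R n]_t \int[mu]_x (F (cons_pair (x, t)))%:E)%E.
Proof.
move=> iF; rewrite integral_cons//.
by rewrite -integral21_prod_meas1//; exact: integrable_cons.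
Qed.

(** The tail factor is the Dirac mass at the empty tuple, of total mass 1. This carries the moments
    of functions on ['rV_1] over to the line. *)
Lemma integral_rn1 (f : R -> R) :
  mu.-integrable setT (EFin \o f) ->
  (lebesgue_rn R 1).-integrable setT (fun t => (f (tnth t ord0))%:E) /\
  (\int[lebesgue_rn R 1]_t (f (tnth t ord0))%:E = \int[mu]_x (f x)%:E)%E.
Proof.
move=> /[dup] /integrableP[mf ltf] fi.
have mF : measurable_fun setT (fun t : 1.-tuple (measurableTypeR R) => (f (tnth t ord0))%:E).
  by apply: (measurableT_comp mf); exact: measurable_tnth.
have mA : measurable_fun setT (fun t : 1.-tuple (measurableTypeR R) => `|(f (tnth t ord0))%:E|%E).
  exact: measurableT_comp.
have iF : (lebesgue_rn R 1).-integrable setT (fun t => (f (tnth t ord0))%:E).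
  apply/integrableP; split => //.
  rewrite -[X in (X < _)%E]/(\int[pushforward (mu \x lebesgue_rn R 0)%E (@cons_pair R 0)]_t
    `|(f (tnth t ord0))%:E|)%E.
  rewrite (ge0_integral_pushforward (@measurable_cons_pair R 0))//.
  rewrite preimage_setT fubini_tonelli1//; last 2 first.
    exact: (measurableT_comp mA (@measurable_cons_pair R 0)).
    by move=> x; exact: abse_ge0.
  rewrite (eq_integral (fun x : measurableTypeR R => `|(f x)%:E|%E))// => x _.
  rewrite /fubini_F /= integral_dirac//; last exact: (measurable_cst (`|f x|%:E)).
  by rewrite diracT mul1e tnth0.
split => //.
rewrite (Fubini_rn1 iF); apply: eq_integral => x _.
rewrite /= integral_dirac//; last exact: (measurable_cst ((f x)%:E)).
by rewrite diracT mul1e tnth0.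
Qed.

End TupleMeasure.

(** * Measurability of continuous functions of a row vector *)

Section RowMeasurable.
Context {R : realType}.

(** The map factors through integer tuples, of which there are countably many: a preimage is the
    union of the sets [G s], each empty or a finite intersection of measurable conditions on single
    coordinates. *)
Lemma measurable_countable_fiber n (r : R -> R) (z : R -> int) (q : int -> R)
    (F : n.-tuple (measurableTypeR R) -> R) :
  measurable_fun setT (fun x : measurableTypeR R => (z x)%:~R : R) ->
  (forall x, r x = q (z x)) ->
  measurable_fun setT (fun t : n.-tuple (measurableTypeR R) =>
     F [tuple r (tnth t i) | i < n]).
Proof.
move=> mz rq _ A mA; rewrite setTI.
pose G (s : n.-tuple int) : set (n.-tuple (measurableTypeR R)) :=
  [set t | F [tuple q (tnth s i) | i < n] \in A /\ forall i, z (tnth t i) = tnth s i].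
rewrite (_ : _ @^-1` A = \bigcup_s G s); last first.
  apply/seteqP; split => [t At|t [s _ [As zs]]].
    exists [tuple z (tnth t i) | i < n] => //; split; last first.
      by move=> i; rewrite tnth_mktuple.
    move: At; rewrite /= inE; congr (A (F _)).
    by apply: eq_from_tnth => i; rewrite !tnth_mktuple rq.
  move: As; rewrite inE; congr (A (F _)).
  by apply: eq_from_tnth => i; rewrite !tnth_mktuple rq zs.
apply: countable_bigcupT_measurable => [|s].
  exact: countableP.
have [As|As] := boolP (F [tuple q (tnth s i) | i < n] \in A); last first.
  rewrite (_ : G s = set0) ?measurable0//.
  by apply/seteqP; split => // t [] h; rewrite h in As.
rewrite (_ : G s = \bigcap_(i in [set: 'I_n])
    ((fun t => (z (tnth t i))%:~R : R) @^-1` [set (tnth s i)%:~R])).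
  apply: fin_bigcap_measurable => // i _.
  rewrite -[X in measurable X]setTI.
  have m : measurable_fun setT (fun t : n.-tuple (measurableTypeR R) => (z (tnth t i))%:~R : R).
    by apply: (measurableT_comp mz); exact: measurable_tnth.
  exact: m.
apply/seteqP; split => [t [_ zs] i _ /=|t zs]; first by rewrite zs.
by split => // i; have /= /eqP := zs i I; rewrite eqr_int => /eqP.
Qed.

Lemma cvg_rV (T : Type) (F : set_system T) {FF : Filter F} n (u : T -> 'rV[R]_n) (l : 'rV[R]_n) :
  (forall i, u x 0 i @[x --> F] --> l 0 i) -> u x @[x --> F] --> l.
Proof.
move=> ul; apply/cvg_ballP => e e0.
have : \forall x \near F, forall i, ball (l 0 i) e (u x 0 i).
  by apply: filter_forall => i; have /cvg_ballP := ul i; exact.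
apply: filterS => x h; split => // i j; rewrite ord1; exact: h.
Qed.

(** Continuity refers to the norm topology of ['rV_n], measurability to the product sigma-algebra on
    tuples. Rounding each coordinate down to a multiple of [1/(k+1)] gives functions with countable
    fibres, hence measurable, that converge pointwise by continuity. *)
Lemma measurable_row_of n (f : 'rV[R]_n -> R) : continuous f ->
  measurable_fun setT (fun t : n.-tuple (measurableTypeR R) => f (row_of t)).
Proof.
move=> cf.
pose r (k : nat) (x : R) : R := (Num.floor (x * k.+1%:R))%:~R / k.+1%:R.
have rx (x : R) : (r k x) @[k --> \oo] --> x.
  apply/cvgrPdist_le => e e0; near=> k.
  have k0 : (0 : R) < k.+1%:R by [].
  have /andP[h1 h2] := floor_itv (x * k.+1%:R).
  rewrite /r -[X in `|X - _|](mulfK (lt0r_neq0 k0)) -mulrBl normrM normfV (gtr0_norm k0).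
  rewrite ler_pdivrMr// ger0_norm ?subr_ge0//.
  apply: (@le_trans _ _ 1); first by rewrite intrD1 in h2; rewrite lerBlDr addrC ltW.
  rewrite -ler_pdivrMl// mulr1; apply: (@le_trans _ _ k%:R); last by rewrite ler_nat.
  near: k; exact: nbhs_infty_ger.
apply: (@measurable_fun_cvg _ _ _ _
  (fun k t => f (row_of [tuple r k (tnth t i) | i < n]))) => [k|t _].
  apply: (@measurable_countable_fiber n (r k) (fun x => Num.floor (x * k.+1%:R))
     (fun z => z%:~R / k.+1%:R) (fun t => f (row_of t))) => //.
  apply: nondecreasing_measurable => // x y xy.
  by rewrite ler_int le_floor// ler_pM2r.
apply: (@cvg_comp _ _ _ (fun k => row_of [tuple r k (tnth t i) | i < n]) f _ (nbhs (row_of t))); last exact: cf.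
apply: cvg_rV => i; rewrite mxE.
by under eq_fun do rewrite mxE tnth_mktuple; exact: rx.
Unshelve. all: by end_near.
Qed.
End RowMeasurable.

(** * Integrals of continuous functions with polynomial decay *)

Section IntegralRn.
Context {R : realType} {n : nat}.
Implicit Types (f g : 'rV[R]_n -> R) (x : 'rV[R]_n).

(** Weight built on the l1 norm, which bounds every coordinate and is dual to the sup norm:
    [edot x u] is at most [wt x] as soon as the coordinates of [u] are at most 1 in absolute
    value. *)
Definition wt x : R := 1 + \sum_i `|x 0 i|.

Lemma wt_ge1 x : 1 <= wt x.
Proof. by rewrite /wt lerDl sumr_ge0. Qed.

Lemma wt_gt0 x : 0 < wt x. Proof. exact: lt_le_trans (wt_ge1 x). Qed.
Lemma wt_ge0 x : 0 <= wt x. Proof. exact: ltW (wt_gt0 x). Qed.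

Lemma coord_le_wt x i : 1 + `|x 0 i| <= wt x.
Proof. by rewrite lerD2l (bigD1 i)//= lerDl sumr_ge0. Qed.

Lemma norm_coord_le_wt x i : `|x 0 i| <= wt x.
Proof. by apply: le_trans (coord_le_wt x i); rewrite lerDr. Qed.

Definition decay (N : nat) f (C : R) := forall x, wt x ^+ N * `|f x| <= C.

Lemma decay_ge0 N f C : decay N f C -> 0 <= C.
Proof. by move=> /(_ 0); apply: le_trans; rewrite mulr_ge0 ?exprn_ge0 ?wt_ge0. Qed.

Lemma decayW N M f C : (N <= M)%N -> decay M f C -> decay N f C.
Proof.
move=> NM h x; apply: le_trans (h x).
by rewrite ler_wpM2r// ler_weXn2l// wt_ge1.
Qed.

Lemma decay_le N f C D : C <= D -> decay N f C -> decay N f D.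
Proof. by move=> CD h x; exact: le_trans CD. Qed.

Lemma decayD N f g C D : decay N f C -> decay N g D -> decay N (fun x => f x + g x) (C + D).
Proof.
move=> hf hg x; apply: (le_trans _ (lerD (hf x) (hg x))).
by rewrite -mulrDr ler_wpM2l ?exprn_ge0 ?wt_ge0// ler_normD.
Qed.

Lemma decayZ N f C c : decay N f C -> decay N (fun x => c * f x) (`|c| * C).
Proof. by move=> hf x; rewrite normrM mulrCA ler_wpM2l. Qed.

Lemma decay_coord N f C i : decay N.+1 f C -> decay N (fun x => x 0 i * f x) C.
Proof.
move=> h x; apply: le_trans (h x).
rewrite exprS normrM mulrA (mulrC (wt x)) ler_wpM2r// ler_wpM2l ?exprn_ge0 ?wt_ge0//.
exact: norm_coord_le_wt.
Qed.

Lemma decayM N f C h B : decay N f C -> (forall x, `|h x| <= B) ->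
  decay N (fun x => f x * h x) (C * B).
Proof.
move=> hf hB x; rewrite normrM mulrA; apply: ler_pM => //.
by rewrite mulr_ge0// exprn_ge0// wt_ge0.
Qed.

Lemma continuous_coord (i : 'I_n) : continuous (fun x : 'rV[R]_n => x 0 i).
Proof. by move=> x; exact: coord_continuous. Qed.

Lemma continuous_coordM i f : continuous f -> continuous (fun x => x 0 i * f x).
Proof. move=> cf x; exact: (cvgM (@continuous_coord i x) (cf x)). Qed.

Lemma continuous_edot (w : 'rV[R]_n) : continuous (fun x => edot x w).
Proof.
move=> x; rewrite /edot; apply: (@cvg_big R^o _ +%R 0 xpredT _ _ (nbhs x)) => [|i _].
  exact: (@add_continuous R^o).
exact: (cvgM (@continuous_coord i x) (cvg_cst _)).
Qed.

Definition rnint f : R := \int[lebesgue_rn R n]_t f (row_of t).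
Definition wint : R := \int[lebesgue_rn R n]_t prodw t.

Lemma wint_ge0 : 0 <= wint.
Proof. by apply: Rintegral_ge0 => t _; exact: prodw_ge0. Qed.

(** A convenient sufficient condition for integrability, stable under linear combinations, that
    keeps measurability and finiteness side conditions out of all later computations. *)
Definition L1 f := continuous f /\ exists C, decay (2 * n) f C.

(** The exponent [2 * n] allots two powers of [wt] to each coordinate, since
    [1 + t_i^2 <= (1 + |t_i|)^2 <= wt^2]. *)
Lemma wt_prodw (t : n.-tuple (measurableTypeR R)) :
  1 <= wt (row_of t) ^+ (2 * n) * prodw t.
Proof.
have -> : wt (row_of t) ^+ (2 * n) = \prod_(i < n) wt (row_of t) ^+ 2.
  by rewrite prodr_const card_ord exprM.
rewrite /prodw -big_split /=; elim/big_ind : _ => // [a b|i _]; first exact: mulr_ege1.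
rewrite ler_pdivlMr ?(lt_le_trans ltr01 (oneDsqr_ge1 _))// mul1r.
have := coord_le_wt (row_of t) i; rewrite mxE => h.
have h1 : 0 <= 1 + `|tnth t i| by rewrite addr_ge0.
apply: (@le_trans _ _ ((1 + `|tnth t i|) ^+ 2)); last by rewrite ler_sqr// nnegrE ?wt_ge0.
by rewrite /oneDsqr sqrrD expr1n -[tnth t i ^+ 2]real_normK ?num_real// lerD2r lerDl mulrn_wge0// mulr_ge0.
Qed.

Lemma decay_prodw f C (t : n.-tuple (measurableTypeR R)) : decay (2 * n) f C ->
  `|f (row_of t)| <= C * prodw t.
Proof.
move=> /(_ (row_of t)) h.
apply: (@le_trans _ _ (wt (row_of t) ^+ (2 * n) * `|f (row_of t)| * prodw t)).
  by rewrite mulrAC -[leLHS]mul1r ler_wpM2r// wt_prodw.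
by rewrite ler_wpM2r// prodw_ge0.
Qed.

Lemma L1_integrable f : L1 f ->
  (lebesgue_rn R n).-integrable setT (fun t => (f (row_of t))%:E).
Proof.
move=> [cf [C hC]].
apply: (@le_integrable _ _ _ _ _ measurableT _ (fun t => (C * prodw t)%:E)).
- by apply/measurable_EFinP; exact: measurable_row_of.
- move=> t _; rewrite lee_fin; apply: (le_trans (decay_prodw t hC)).
  exact: ler_norm.
- by have := integrableZl measurableT C (@integrable_prodw R n).
Qed.

Lemma rnint_le f C : continuous f -> decay (2 * n) f C -> `|rnint f| <= C * wint.
Proof.
move=> cf hC; have iF := L1_integrable (conj cf (ex_intro _ C hC)).
have iP := integrableZl measurableT C (@integrable_prodw R n).
apply: (le_trans (le_normr_Rintegral _ _)) => //.
rewrite /wint -RintegralZl//; last exact: integrable_prodw.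
apply: le_Rintegral => //; first exact: integrable_norm.
by move=> t _; exact: decay_prodw.
Qed.

Lemma L1D f g : L1 f -> L1 g -> L1 (fun x => f x + g x).
Proof.
move=> [cf [C hC]] [cg [D hD]]; split; first by move=> x; exact: (cvgD (cf x) (cg x)).
by exists (C + D); exact: decayD.
Qed.

Lemma L1Z c f : L1 f -> L1 (fun x => c * f x).
Proof.
move=> [cf [C hC]]; split; first by move=> x; exact: (cvgM (cvg_cst c) (cf x)).
by exists (`|c| * C); exact: decayZ.
Qed.

Lemma rnintD f g : L1 f -> L1 g -> rnint (fun x => f x + g x) = rnint f + rnint g.
Proof. by move=> ? ?; rewrite /rnint RintegralD//; exact: L1_integrable. Qed.

Lemma rnintZ c f : L1 f -> rnint (fun x => c * f x) = c * rnint f.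
Proof. by move=> ?; rewrite /rnint RintegralZl//; exact: L1_integrable. Qed.

Lemma rnintB f g : L1 f -> L1 g -> rnint (fun x => f x - g x) = rnint f - rnint g.
Proof. by move=> ? ?; rewrite /rnint RintegralB//; exact: L1_integrable. Qed.

Lemma L10 : L1 (fun=> 0).
Proof. by split; [exact: cst_continuous|exists 0 => x; rewrite normr0 mulr0]. Qed.

Lemma rnint0 : rnint (fun=> 0) = 0.
Proof. by rewrite /rnint /Rintegral integral0. Qed.

Lemma L1_sum (I : Type) (s : seq I) (F : I -> 'rV[R]_n -> R) :
  (forall i, L1 (F i)) -> L1 (fun x => \sum_(i <- s) F i x).
Proof.
move=> hF; elim: s => [|i s IH].
  by under eq_fun do rewrite big_nil; exact: L10.
by under eq_fun do rewrite big_cons; exact: L1D.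
Qed.

Lemma rnint_sum (I : Type) (s : seq I) (F : I -> 'rV[R]_n -> R) :
  (forall i, L1 (F i)) ->
  rnint (fun x => \sum_(i <- s) F i x) = \sum_(i <- s) rnint (F i).
Proof.
move=> hF; elim: s => [|i s IH].
  by rewrite big_nil; under eq_fun do rewrite big_nil; exact: rnint0.
rewrite big_cons -IH -rnintD//; last exact: L1_sum.
by under eq_fun do rewrite big_cons.
Qed.

End IntegralRn.

(** * Primitives of rapidly decreasing functions *)

Section Primitive.
Context {R : realType}.
Local Notation mu := (@lebesgue_measure R).
Implicit Types (g h : R -> R) (s t : R).

Definition decay1 (N : nat) h (B : R) := forall s, (1 + `|s|) ^+ N * `|h s| <= B.

Lemma one_norm_ge1 s : 1 <= 1 + `|s|. Proof. by rewrite lerDl. Qed.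
Lemma one_norm_ge0 s : 0 <= 1 + `|s|. Proof. exact: le_trans (one_norm_ge1 s). Qed.

Lemma decay1_ge0 N h B : decay1 N h B -> 0 <= B.
Proof. by move=> /(_ 0); apply: le_trans; rewrite mulr_ge0 ?exprn_ge0 ?one_norm_ge0. Qed.

Lemma decay1W N M h B : (N <= M)%N -> decay1 M h B -> decay1 N h B.
Proof.
move=> NM hB x; apply: le_trans (hB x).
by rewrite ler_wpM2r// ler_weXn2l// one_norm_ge1.
Qed.

Lemma decay1_oneDsqr h B s : decay1 2 h B -> `|h s| <= B * (oneDsqr s)^-1.
Proof.
move=> /(_ s) hB; rewrite ler_pdivlMr ?(lt_le_trans ltr01 (oneDsqr_ge1 _))// mulrC.
apply: le_trans hB; rewrite ler_wpM2r//.
by rewrite /oneDsqr sqrrD expr1n -[s ^+ 2]real_normK ?num_real// lerD2r lerDl mulrn_wge0// mulr_ge0.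
Qed.

Lemma decay1_integrable h B : continuous h -> decay1 2 h B ->
  mu.-integrable setT (EFin \o h).
Proof.
move=> ch hB.
apply: (@le_integrable _ _ _ _ _ measurableT _ (fun s : measurableTypeR R => (B * (oneDsqr s)^-1)%:E)).
- by apply/measurable_EFinP; exact: continuous_measurable_fun.
- move=> t _; rewrite lee_fin; apply: (le_trans (decay1_oneDsqr t hB)).
  exact: ler_norm.
- by have := integrableZl measurableT B (@integrable_oneDsqrV R).
Qed.

Definition cauchyint : R := \int[mu]_s (oneDsqr s)^-1.

Lemma cauchyint_ge0 : 0 <= cauchyint.
Proof. by apply: Rintegral_ge0 => t _; exact: oneDsqrV_ge0. Qed.

(** On [D] one has [|t| <= |s|], so the weight at [t] can be replaced by the weight at [s] under the
    integral; the two extra powers of decay pay for integrability. *)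
Lemma tail_le (D : set (measurableTypeR R)) h r B t : measurable D -> continuous h -> decay1 r.+2 h B ->
  (forall s, D s -> `|t| <= `|s|) ->
  (1 + `|t|) ^+ r * `|\int[mu]_(s in D) h s| <= B * cauchyint.
Proof.
move=> mD ch hB Ds.
have ih : mu.-integrable D (EFin \o h).
  by apply: integrableS (decay1_integrable ch (decay1W (leq_addl r 2) _)); rewrite ?addn2//; exact: hB.
have ic := integrableZl measurableT B (@integrable_oneDsqrV R).
have icD : mu.-integrable D (EFin \o (fun s => B * (oneDsqr s)^-1)).
  exact: integrableS ic.
have B0 := decay1_ge0 hB.
have c0 : 0 <= (1 + `|t|) ^+ r by rewrite exprn_ge0 ?one_norm_ge0.
have ich := integrableZl mD ((1 + `|t|) ^+ r) ih.
rewrite -{1}(ger0_norm c0) -normrM -RintegralZl//.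
apply: (le_trans (le_normr_Rintegral _ _)) => //.
apply: (@le_trans _ _ (\int[mu]_(s in D) (B * (oneDsqr s)^-1))).
  apply: le_Rintegral => //; first exact: (integrable_norm ich).
  move=> s /Ds ts; rewrite -[X in `|X|]mulr1 mulr1 normrM (ger0_norm c0).
  apply: (@le_trans _ _ `|(1 + `|s|) ^+ r * h s|).
    rewrite normrM (ger0_norm (exprn_ge0 _ (one_norm_ge0 _))) ler_wpM2r// lerXn2r ?nnegrE ?one_norm_ge0//.
    by rewrite lerD2l.
  apply: (@decay1_oneDsqr (fun s => (1 + `|s|) ^+ r * h s)) => u.
  rewrite normrM (ger0_norm (exprn_ge0 _ (one_norm_ge0 _))) mulrA -exprD add2n.
  exact: hB.
rewrite /cauchyint -RintegralZl//; last exact: integrable_oneDsqrV.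
rewrite /Rintegral fine_le//.
- exact: integrable_fin_num icD.
- exact: integrable_fin_num ic.
apply: ge0_subset_integral => //.
  by have /measurable_int := ic.
by move=> s _; rewrite lee_fin mulr_ge0 ?oneDsqrV_ge0.
Qed.

Lemma itv_splitT t : `]-oo, t] `|` `]t, +oo[ = [set: R].
Proof.
apply/seteqP; split => // s _; rewrite /= !in_itv /= andbT.
by have [|] := leP s t; [left|right].
Qed.

Lemma itv_split_disj t : [disjoint `]-oo, t]%classic & (`]t, +oo[%classic : set R)].
Proof.
apply/disj_setPS => s []; rewrite /= !in_itv /= andbT => st ts.
by move: (lt_le_trans ts st); rewrite ltxx.
Qed.

Definition prim h t : R := \int[mu]_(s in `]-oo, t]) h s.

Lemma prim_derive h B t : continuous h -> decay1 2 h B -> is_derive t 1 (prim h) (h t).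
Proof.
move=> ch hB.
have ih := decay1_integrable ch hB.
have [||||d1 d2] := @continuous_FTC1 R h -oo%O t (t + 1).
- by rewrite ltrDl.
- by apply: (integrableS _ _ _ ih).
- exact: ltNyr.
- exact: ch.
by split; [exact: d1|rewrite -derive1E; exact: d2].
Qed.

(** For [t <= 0] this is a tail integral directly. For [t > 0] the vanishing total integral turns
    the primitive into minus the integral over the opposite tail. *)
Lemma prim_decay h r B t : continuous h -> decay1 r.+2 h B ->
  \int[mu]_s h s = 0 ->
  (1 + `|t|) ^+ r * `|prim h t| <= B * cauchyint.
Proof.
move=> ch hB h0; have [t0|t0] := leP t 0.
  apply: tail_le => // s /=; rewrite in_itv /= => st.
  by rewrite !ler0_norm ?lerN2// (le_trans st).
have ih := decay1_integrable ch (decay1W (isT : 2 <= r.+2)%N hB).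
have E : prim h t = - \int[mu]_(s in `]t, +oo[) h s.
  apply/eqP; rewrite -addr_eq0 -h0; apply/eqP.
  rewrite /prim -Rintegral_setU//.
  - by rewrite itv_splitT.
  - by rewrite itv_splitT.
  - exact: itv_split_disj.
rewrite E normrN; apply: tail_le => // s /=; rewrite in_itv /= andbT => ts.
by rewrite !ger0_norm ?ltW// (lt_trans t0).
Qed.

(** Limits at infinity are replaced by quantitative decay. [prim h] and [G] differ by a constant
    [c]; the tail bounds at [-t] force [c = 0], and those at [t] then force the integral to
    vanish. *)
Lemma int_derive0 (G h : R -> R) A B : (forall t, is_derive t 1 G (h t)) ->
  continuous h -> decay1 1 G A -> decay1 3 h B -> \int[mu]_s h s = 0.
Proof.
move=> dG ch GA hB.
have ih := decay1_integrable ch (decay1W (isT : 2 <= 3)%N hB).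
have [c hc] : exists c, forall t, prim h t = G t + c.
  exists (prim h 0 - G 0) => t.
  have : (prim h - G) t = (prim h - G) 0.
    apply: is_derive_0_is_cst => x.
    have dp := prim_derive x ch (decay1W (isT : 2 <= 3)%N hB).
    by apply: is_derive_eq; rewrite subrr.
  rewrite !fctE => e; rewrite -[in RHS]e; ring.
have small (x K : R) : (forall t, 0 <= t -> (1 + t) * `|x| <= K) -> x = 0.
  move=> hx; apply/eqP; rewrite -normr_eq0; apply/negPn/negP => x0.
  have xp : 0 < `|x| by rewrite lt_neqAle eq_sym x0 /=.
  have K0 : 0 <= K by have := hx 0 (lexx _); apply: le_trans; rewrite addr0 mul1r.
  (* At [t = K / |x|] the left side equals [|x| + K], which exceeds [K]. *)
  have := hx (K / `|x|) (divr_ge0 K0 (ltW xp)).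
  by rewrite mulrDl mulfVK ?gt_eqF// mul1r gerDr leNgt xp.
have c0 : c = 0.
  apply: (small _ (B * cauchyint + A)) => t t0.
  have E : c = prim h (- t) - G (- t) by rewrite hc addrAC subrr add0r.
  have nt : `|- t| = t by rewrite normrN ger0_norm.
  have p0 : 0 <= 1 + t by rewrite addr_ge0.
  apply: (@le_trans _ _ ((1 + t) * (`|prim h (- t)| + `|G (- t)|))).
    by rewrite ler_wpM2l// E ler_normB.
  rewrite mulrDr; apply: lerD.
    have := @tail_le `]-oo, (- t)] h 1 B (- t); rewrite nt expr1; apply=> //.
    move=> s /=; rewrite in_itv /= => st.
    by rewrite ler0_norm ?(le_trans st) ?oppr_le0// lerNr.
  by have := GA (- t); rewrite nt expr1.
apply: (small _ (B * cauchyint + A)) => t t0.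
have E : \int[mu]_s h s = \int[mu]_(s in `]t, +oo[) h s + G t.
  have -> : G t = prim h t by rewrite hc c0 addr0.
  rewrite /prim addrC -Rintegral_setU//.
  - by rewrite itv_splitT.
  - by rewrite itv_splitT.
  - exact: itv_split_disj.
have nt : `|t| = t by rewrite ger0_norm.
have p0 : 0 <= 1 + t by rewrite addr_ge0.
apply: (@le_trans _ _ ((1 + t) * (`|\int[mu]_(s in `]t, +oo[) h s| + `|G t|))).
  by rewrite ler_wpM2l// E ler_normD.
rewrite mulrDr; apply: lerD.
  have := @tail_le `]t, +oo[ h 1 B t; rewrite nt expr1; apply=> //.
  move=> s /=; rewrite in_itv /= andbT => st.
  by rewrite ger0_norm ?ltW// (le_lt_trans t0).
by have := GA t; rewrite nt expr1.
Qed.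
End Primitive.

(** * Integration by parts in several variables *)

Section IntegralOfPartial.
Context {R : realType}.
Local Notation mu := (@lebesgue_measure R).
Local Notation tup n := (n.-tuple (measurableTypeR R)).

Definition upd n (t : tup n) (i : 'I_n) (x : R) : tup n :=
  [tuple if j == i then x else tnth t j | j < n].

Lemma cons_pair_upd0 n (x y : R) (t : tup n) :
  upd (cons_pair (y, t)) ord0 x = cons_pair (x, t).
Proof.
apply: eq_from_tnth => j; rewrite tnth_mktuple.
by case: (unliftP ord0 j) => [k ->|->]; rewrite ?tnth0//= !tnthS.
Qed.

Lemma cons_pair_updS n (x y : R) (t : tup n) (i : 'I_n) :
  upd (cons_pair (y, t)) (lift ord0 i) x = cons_pair (y, upd t i x).
Proof.
apply: eq_from_tnth => j; rewrite tnth_mktuple.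
case: (unliftP ord0 j) => [k ->|->]; rewrite ?tnth0//= !tnthS tnth_mktuple.
by rewrite (inj_eq lift_inj).
Qed.

(** A single factor [1/(1+x^2)] decays only to order 2, short of the order 3 that [int_derive0] asks
    for; hence bounds by the square of [prodw]. The constant is that of
    [(1+|x|)^4 <= 4 (1+x^2)^2]. *)
Lemma oneDsqrV_sqr_le (x : R) : (1 + `|x|) ^+ 3 * ((oneDsqr x)^-1) ^+ 2 <= 4.
Proof.
have o0 : 0 < oneDsqr x by exact: lt_le_trans (oneDsqr_ge1 _).
rewrite exprVn ler_pdivrMr ?exprn_gt0//.
have x0 : 0 <= `|x| by [].
have -> : oneDsqr x = 1 + `|x| ^+ 2 by rewrite /oneDsqr real_normK ?num_real.
by move: `|x| x0 => y y0; nra.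
Qed.

Lemma prodw_le1 n (t : tup n) : prodw t <= 1.
Proof.
apply: prodr_ile1 => i _; rewrite oneDsqrV_ge0 /=.
by rewrite invf_le1 ?oneDsqr_ge1// (lt_le_trans ltr01 (oneDsqr_ge1 _)).
Qed.

Lemma le_prodw_integrable n (F : tup n -> R) C : measurable_fun setT F ->
  (forall t, `|F t| <= C * prodw t ^+ 2) ->
  (lebesgue_rn R n).-integrable setT (EFin \o F).
Proof.
move=> mF hF; apply: (@le_integrable _ _ _ _ _ measurableT _ (fun t => (`|C| * prodw t)%:E)).
- exact/measurable_EFinP.
- move=> t _; rewrite lee_fin; apply: (le_trans (hF t)).
  apply: (le_trans _ (ler_norm _)); rewrite expr2 mulrA.
  apply: (@le_trans _ _ (`|C| * prodw t * prodw t)).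
    by rewrite !ler_wpM2r ?prodw_ge0// ler_norm.
  by rewrite ler_piMr ?prodw_le1// mulr_ge0 ?prodw_ge0.
- by have := integrableZl measurableT `|C| (@integrable_prodw R n).
Qed.

(** Induction on the dimension. If [i] is the head coordinate, the inner one-dimensional integral of
    a derivative vanishes for every tail; otherwise the head is frozen at [x] and the induction
    hypothesis applies, with [C] multiplied by the squared weight of [x]. *)
Lemma int_partial_tuple n (i : 'I_n) (F dF : tup n -> R) C :
  measurable_fun setT dF ->
  (forall t (x : R), is_derive x 1 (fun y : R => F (upd t i y)) (dF (upd t i x))) ->
  (forall t, continuous (fun y : R => dF (upd t i y))) ->
  (forall t, `|F t| <= C * prodw t ^+ 2) ->
  (forall t, `|dF t| <= C * prodw t ^+ 2) ->
  (\int[lebesgue_rn R n]_t (dF t)%:E = 0)%E.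
Proof.
elim: n i F dF C => [[]//|n IH] i F dF C mdF dFd cdF hF hdF.
have iF := le_prodw_integrable mdF hdF.
have [i0|[j ij]] : i = ord0 \/ exists j, i = lift ord0 j.
- by case: (unliftP ord0 i) => [j ->|->]; [right; exists j|left].
- rewrite (Fubini_rn2 iF) integral0_eq// => t _.
  pose G (x : R) := F (cons_pair (x, t)); pose h (x : R) := dF (cons_pair (x, t)).
  have dG (x : R) : is_derive x 1 G (h x).
    have := dFd (cons_pair (0, t)) x; rewrite i0.
    by under eq_fun do rewrite cons_pair_upd0; rewrite cons_pair_upd0.
  have ch : continuous h.
    have := cdF (cons_pair (0, t)); rewrite i0.
    by under eq_fun do rewrite cons_pair_upd0.
  have D0 : 0 <= C * prodw t ^+ 2.
    have := le_trans (normr_ge0 _) (hF (cons_pair (0, t))).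
    by rewrite prodw_cons /oneDsqr expr0n /= addr0 invr1 mul1r.
  have comb_bound (f : R -> R) : (forall x, `|f x| <= C * prodw (cons_pair (x, t)) ^+ 2) ->
      decay1 3 f (4 * (C * prodw t ^+ 2)).
    move=> hf x; apply: (le_trans (ler_wpM2l (exprn_ge0 3 (one_norm_ge0 x)) (hf x))).
    rewrite prodw_cons exprMn (_ : _ * _ = (1 + `|x|) ^+ 3 * ((oneDsqr x)^-1) ^+ 2 *
      (C * prodw t ^+ 2)); last by ring.
    by rewrite ler_wpM2r// oneDsqrV_sqr_le.
  have bh : decay1 3 h (4 * (C * prodw t ^+ 2)) by apply: comb_bound => x; exact: hdF.
  have bG : decay1 1 G (4 * (C * prodw t ^+ 2)).
    by apply: (@decay1W _ _ 3) => //; apply: comb_bound => x; exact: hF.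
  have ih := decay1_integrable ch (decay1W (isT : 2 <= 3)%N bh).
  rewrite -[LHS]fineK; last exact: (integrable_fin_num measurableT ih).
  by rewrite [X in X%:E](int_derive0 dG ch bG bh).
- rewrite (Fubini_rn1 iF) integral0_eq// => x _.
  apply: (IH j (fun t => F (cons_pair (x, t))) (fun t => dF (cons_pair (x, t)))
            (C * ((oneDsqr x)^-1) ^+ 2)).
  + apply: (measurableT_comp mdF).
    exact: (measurable_cons (measurable_cst (x : measurableTypeR R)) (@measurable_id _ (tup n) setT)).
  + move=> t y; have := dFd (cons_pair (x, t)) y; rewrite ij.
    by under eq_fun do rewrite cons_pair_updS; rewrite cons_pair_updS.
  + move=> t; have := cdF (cons_pair (x, t)); rewrite ij.
    by under eq_fun do rewrite cons_pair_updS.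
  + by move=> t; have := hF (cons_pair (x, t)); rewrite prodw_cons exprMn mulrA.
  + by move=> t; have := hdF (cons_pair (x, t)); rewrite prodw_cons exprMn mulrA.
Qed.

Lemma row_of_upd n (t : tup n) (i : 'I_n) (x : R) :
  row_of (upd t i x) = row_of t + (x - tnth t i) *: delta_mx 0 i.
Proof.
apply/rowP => j; rewrite !mxE tnth_mktuple eqxx /=.
case: eqP => [->|_]; first by rewrite mulr1 addrC subrK.
by rewrite mulr0 addr0.
Qed.

Lemma wt_prodw2 n (t : tup n) : 1 <= wt (row_of t) ^+ (4 * n) * prodw t ^+ 2.
Proof.
rewrite (_ : (4 * n = (2 * n) * 2)%N); last by rewrite mulnAC.
by rewrite exprM -exprMn exprn_ege1// wt_prodw.
Qed.

Lemma decay_prodw2 n (f : 'rV[R]_n -> R) C (t : tup n) : decay (4 * n) f C ->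
  `|f (row_of t)| <= C * prodw t ^+ 2.
Proof.
move=> /(_ (row_of t)) h.
apply: (@le_trans _ _ (wt (row_of t) ^+ (4 * n) * `|f (row_of t)| * prodw t ^+ 2)).
  by rewrite mulrAC -[leLHS]mul1r ler_wpM2r// wt_prodw2.
by rewrite ler_wpM2r// exprn_ge0// prodw_ge0.
Qed.

(** The two difference quotients are the same function of [h]. This converts directional derivatives
    into derivatives of one real variable; the offset [c] accommodates the update of one coordinate
    of a tuple. *)
Lemma is_derive_line (V : normedModType R) (F : V -> R) (a v : V) (x c d : R) :
  is_derive (a + (x - c) *: v) v F d ->
  is_derive x 1 (fun y : R => F (a + (y - c) *: v)) d.
Proof.
move=> [d1 d2].
have E : (fun h : R => h^-1 *: (((fun y : R => F (a + (y - c) *: v)) \o shift x) (h *: (1 : R))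
          - F (a + (x - c) *: v))) =
         (fun h : R => h^-1 *: ((F \o shift (a + (x - c) *: v)) (h *: v) - F (a + (x - c) *: v))).
  apply/funext => h /=; congr (_ *: (F _ - _)).
  by rewrite [h *: (1 : R)]mulr1 -addrA scalerDl addrCA.
by split; [rewrite /derivable E|rewrite /derive E].
Qed.

Lemma rnint_partial n (i : 'I_n) (F dF : 'rV[R]_n -> R) A B :
  (forall x, is_derive x (delta_mx 0 i : 'rV[R]_n) F (dF x)) -> continuous dF ->
  decay (4 * n) F A -> decay (4 * n) dF B -> rnint dF = 0.
Proof.
move=> dFd cdF FA dFB; rewrite /rnint /Rintegral.
have A0 := decay_ge0 FA; have B0 := decay_ge0 dFB.
suff -> : (\int[lebesgue_rn R n]_t (dF (row_of t))%:E = 0)%E by [].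
apply: (@int_partial_tuple n i (fun t => F (row_of t)) (fun t => dF (row_of t)) (A + B)).
- exact: measurable_row_of.
- move=> t x; under eq_fun do rewrite row_of_upd.
  by rewrite row_of_upd; apply: is_derive_line.
- move=> t x; under eq_fun do rewrite row_of_upd.
  apply: (@continuous_comp _ _ _ (fun y : R => row_of t + (y - tnth t i) *: delta_mx 0 i : 'rV[R]_n) dF).
    apply: cvgD; first exact: cvg_cst.
    apply: cvgZr_tmp; first by apply: cvgB; [exact: cvg_id|exact: cvg_cst].
  exact: cdF.
- by move=> t; apply: decay_prodw2; apply: decay_le FA; rewrite lerDl.
- by move=> t; apply: decay_prodw2; apply: decay_le dFB; rewrite lerDr.
Qed.
End IntegralOfPartial.

(** * Rapidly decreasing functions on the line and their moments *)

Section OneDim.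
Context {R : realType}.
Local Notation mu := (@lebesgue_measure R).
Implicit Types (g h : R -> R) (s t : R).

Lemma decay1D N g h A B : decay1 N g A -> decay1 N h B ->
  decay1 N (fun t => g t + h t) (A + B).
Proof.
move=> hf hg x; apply: (le_trans _ (lerD (hf x) (hg x))).
by rewrite -mulrDr ler_wpM2l ?exprn_ge0 ?one_norm_ge0// ler_normD.
Qed.

Lemma decay1Z N g A c : decay1 N g A -> decay1 N (fun t => c * g t) (`|c| * A).
Proof. by move=> hf x; rewrite normrM mulrCA ler_wpM2l. Qed.

Lemma decay1_mulX N k h B : decay1 (N + k) h B -> decay1 N (fun t => t ^+ k * h t) B.
Proof.
move=> hB t; apply: le_trans (hB t).
rewrite normrM normrX exprD -mulrA ler_wpM2l ?exprn_ge0 ?one_norm_ge0//.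
by rewrite ler_wpM2r// lerXn2r ?nnegrE ?one_norm_ge0// lerDr.
Qed.

Definition schwartz_line g := forall k, (forall t, derivable (derive1n k g) t 1) /\
  (forall N, exists B, decay1 N (derive1n k g) B).

Definition bound_line (N K : nat) g (B : R) := forall k, (k <= K)%N -> decay1 N (derive1n k g) B.

Definition moments_line g := forall k : nat, \int[mu]_t (t ^+ k * g t) = 0.

Lemma derivable_continuousR h : (forall t, derivable h t 1) -> continuous h.
Proof.
by move=> dh t; apply: differentiable_continuous; apply/derivable1_diffP; exact: dh.
Qed.

Lemma schwartz_line_is_derive g k t : schwartz_line g -> is_derive t 1 (derive1n k g) ((derive1n k.+1 g) t).
Proof.
by move=> /(_ k) [dg _]; rewrite derive1nS derive1E; apply: derivableP; exact: dg.
Qed.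

Lemma schwartz_line_is_derive0 g t : schwartz_line g -> is_derive t 1 g ((derive1 g) t).
Proof. by move=> /(@schwartz_line_is_derive _ 0 t); rewrite derive1nS. Qed.

Lemma schwartz_line_continuous g k : schwartz_line g -> continuous (derive1n k g).
Proof. by move=> /(_ k) [dg _]; exact: derivable_continuousR. Qed.

Lemma schwartz_line_continuous0 g : schwartz_line g -> continuous g.
Proof. by move=> /(@schwartz_line_continuous _ 0%N). Qed.

Lemma schwartz_line_deriv g : schwartz_line g -> schwartz_line (derive1 g).
Proof. by move=> hg k; rewrite -derive1Sn; exact: hg. Qed.

Lemma bound_line_deriv N K g B : bound_line N K.+1 g B -> bound_line N K (derive1 g) B.
Proof. by move=> hg k kK; rewrite -derive1Sn; exact: hg. Qed.

Lemma bound_lineW N N' K K' g B : (N <= N')%N -> (K <= K')%N -> bound_line N' K' g B -> bound_line N K g B.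
Proof.
move=> NN KK h k kK; apply: decay1W (h k _) => //.
exact: leq_trans KK.
Qed.

Lemma bound_line_ge0 N K g B : bound_line N K g B -> 0 <= B.
Proof. by move=> /(_ 0 (leq0n _)); exact: decay1_ge0. Qed.

Lemma derive1_eq h (h' : R -> R) : (forall t, is_derive t 1 h (h' t)) -> (derive1 h) = h'.
Proof. by move=> dh; apply/funext => t; rewrite derive1E; have [_ ->] := dh t. Qed.

Definition mulT g : R -> R := fun t => t * g t.

Lemma is_derive_mulT g k t : schwartz_line g ->
  is_derive t 1 (fun t => t * derive1n k g t + k%:R * derive1n k.-1 g t)
    (t * derive1n k.+1 g t + k.+1%:R * derive1n k g t).
Proof.
move=> hg; have h1 := schwartz_line_is_derive k t hg.
have h2 : is_derive t 1 (fun t => k%:R * (derive1n k.-1 g) t) (k%:R * (derive1n k g) t).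
  case: k {h1} => [|k].
    rewrite mul0r (_ : (fun _ => _) = cst 0); first exact: is_derive_cst.
    by apply/funext => u; rewrite mul0r.
  have h1 := schwartz_line_is_derive k t hg.
  by apply: is_derive_eq.
have h3 : is_derive t 1 (id * (derive1n k g)) (t *: (derive1n k.+1 g) t + (derive1n k g) t *: 1).
  exact: is_deriveM.
apply: (is_derive_eq (is_deriveD h3 h2)).
rewrite /= /GRing.scale /=; rewrite mulr1 -addrA; congr (_ + _).
by rewrite mulrS mulrDl mul1r.
Qed.

(** Leibniz rule for the factor [t]. At [k = 0] the expression [k.-1] is again 0, but that term has
    coefficient 0. *)
Lemma derive1n_mulT g k : schwartz_line g ->
  derive1n k (mulT g) = fun t => t * (derive1n k g) t + k%:R * (derive1n k.-1 g) t.
Proof.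
move=> hg; elim: k => [|k IH].
  by apply/funext => t; rewrite mul0r addr0.
by rewrite derive1nS IH; apply: derive1_eq => t; exact: is_derive_mulT.
Qed.

Lemma schwartz_line_mulT g : schwartz_line g -> schwartz_line (mulT g).
Proof.
move=> hg k; rewrite derive1n_mulT//; split => [t|N].
  by have [] := is_derive_mulT k t hg.
have [B1 hB1] := (hg k).2 (N + 1)%N.
have [B2 hB2] := (hg k.-1).2 N.
exists (B1 + `|k%:R| * B2); apply: decay1D; last exact: decay1Z.
exact: (@decay1_mulX N 1).
Qed.

Lemma bound_line_mulT N K g B : schwartz_line g -> bound_line N.+1 K g B -> bound_line N K (mulT g) (K.+1%:R * B).
Proof.
move=> hg hB k kK; rewrite derive1n_mulT//.
have B0 := bound_line_ge0 hB.
have h1 : decay1 N (fun t => t * (derive1n k g) t) B.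
  by apply: (@decay1_mulX N 1); rewrite addn1; exact: hB.
have h2 : decay1 N (derive1n k.-1 g) B.
  by apply: (@decay1W _ _ N.+1) => //; apply: hB; exact: leq_trans (leq_pred _) kK.
move=> t; apply: (le_trans (decay1D h1 (decay1Z k%:R h2) t)).
by rewrite normr_nat mulrS mulrDl mul1r lerD2l ler_wpM2r// ler_nat.
Qed.

Lemma moments_line_mulT g : moments_line g -> moments_line (mulT g).
Proof. by move=> hg k; rewrite -(hg k.+1); congr Rintegral; apply/funext => t; rewrite exprSr mulrA. Qed.

Lemma is_derive_expM h (h' : R) k t : is_derive t 1 h h' ->
  is_derive t 1 (fun s => s ^+ k.+1 * h s) (k.+1%:R * (t ^+ k * h t) + t ^+ k.+1 * h').
Proof.
move=> dh.
have hX : is_derive t 1 ((@id R) ^+ k.+1) ((k.+1%:R * t ^+ k) *: 1) by exact: is_deriveX.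
have := is_deriveM hX dh.
rewrite (_ : id ^+ k.+1 * h = (fun s => s ^+ k.+1 * h s)); last first.
  by apply/funext => s; rewrite /= !fctE.
move=> d; apply: (is_derive_eq d); rewrite /GRing.scale /= !fctE mulr1 addrC; congr (_ + _).
by ring.
Qed.

(** The derivative of [t^(k+1) h(t)] has integral 0. Read in one direction, vanishing moments pass
    from [h] to [h']; read in the other, from [h'] to [h]. *)
Lemma int_by_parts h h' k : (forall t, is_derive t 1 h (h' t)) -> continuous h' ->
  (exists B, decay1 (k + 5) h B) -> (exists B, decay1 (k + 5) h' B) ->
  \int[mu]_t (t ^+ k.+1 * h' t) = - (k.+1%:R * \int[mu]_t (t ^+ k * h t)).
Proof.
move=> dh ch' [A hA] [B hB].
have ch : continuous h by apply: derivable_continuousR => t; exact: ex_derive.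
have cX j (f : R -> R) : continuous f -> continuous (fun t => t ^+ j * f t).
  move=> cf t; apply: (@cvgM _ _ (nbhs t) _ (fun t => t ^+ j)); last exact: cf.
  exact: exprn_continuous.
have h1 : decay1 3 (fun t => t ^+ k.+1 * h' t) B.
  by apply: decay1_mulX; apply: (decay1W _ hB); rewrite addnC addSnnS leq_add2l.
have h2 : decay1 3 (fun t => t ^+ k * h t) A.
  by apply: decay1_mulX; apply: (decay1W _ hA); rewrite addnC leq_add2l.
have h3 : decay1 1 (fun t => t ^+ k.+1 * h t) A.
  by apply: decay1_mulX; apply: (decay1W _ hA); rewrite addnC addSnnS leq_add2l.
have c1 := cX k.+1 _ ch'; have c2 := cX k _ ch.
have i1 := decay1_integrable c1 (decay1W (isT : 2 <= 3)%N h1).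
have i2 := decay1_integrable c2 (decay1W (isT : 2 <= 3)%N h2).
have dd t := is_derive_expM k (dh t).
have cc : continuous (fun t => k.+1%:R * (t ^+ k * h t) + t ^+ k.+1 * h' t).
  by move=> t; apply: cvgD; [apply: cvgM; [exact: cvg_cst|exact: c2]|exact: c1].
have := int_derive0 dd cc h3 (decay1D (decay1Z k.+1%:R h2) h1).
rewrite RintegralD//; last first.
  by have := integrableZl measurableT k.+1%:R i2.
by rewrite RintegralZl// => /eqP; rewrite addrC addr_eq0 => /eqP.
Qed.

Lemma moments_line_deriv g : schwartz_line g -> moments_line g -> moments_line (derive1 g).
Proof.
move=> hg mg [|k].
  have [A hA] := (hg 0%N).2 1%N; have [B hB] := (hg 1%N).2 3%N.
  under eq_Rintegral do rewrite expr0 mul1r.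
  apply: (int_derive0 _ _ hA hB); last exact: (@schwartz_line_continuous _ 1%N).
  by move=> t; exact: schwartz_line_is_derive0.
have -> := int_by_parts (fun t => schwartz_line_is_derive0 t hg) (@schwartz_line_continuous _ 1%N hg)
  ((hg 0%N).2 _) ((hg 1%N).2 _).
by rewrite mg mulr0 oppr0.
Qed.

(* Vanishing moments are inherited by the primitive, so that the passage to the
   primitive can be iterated. *)
Lemma schwartz_line_prim g : schwartz_line g -> moments_line g ->
  [/\ schwartz_line (prim g), moments_line (prim g), derive1 (prim g) = g &
      forall N B, bound_line N.+2 0 g B -> bound_line N 0 (prim g) (B * cauchyint)].
Proof.
move=> hg mg.
have cg := schwartz_line_continuous0 hg.
have g0 : \int[mu]_t g t = 0.
  by have := mg 0%N; under eq_Rintegral do rewrite expr0 mul1r.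
have [B2 hB2] := (hg 0%N).2 2%N.
have dp t : is_derive t 1 (prim g) (g t) by apply: (prim_derive t cg hB2).
have pE : derive1 (prim g) = g by exact: derive1_eq.
have pd N B : decay1 N.+2 g B -> decay1 N (prim g) (B * cauchyint).
  by move=> hB t; exact: prim_decay.
have cp : schwartz_line (prim g).
  case=> [|k]; last by rewrite derive1Sn pE; exact: hg.
  split => [t|N]; first exact: ex_derive.
  by have [B hB] := (hg 0%N).2 N.+2; exists (B * cauchyint); exact: pd.
split => //; last first.
  by move=> N B hB [|//] _; apply: pd; exact: (hB 0%N).
(* The moment of order [k+1] of [g] is [-(k+1)] times the moment of order [k] of its primitive, and
   [k+1] is nonzero. *)
move=> k; have := int_by_parts (k:=k) dp cg ((cp 0%N).2 _) ((hg 0%N).2 _).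
rewrite mg => /esym/eqP; rewrite oppr_eq0 mulf_eq0 pnatr_eq0 /=.
by move/eqP.
Qed.

End OneDim.

(** * Mean value and Taylor bounds on the line *)

Section MeanValue.
Context {R : realType}.
Implicit Types (h : R -> R) (s t : R).

Lemma mean_value h (h' : R -> R) s t : (forall u : R, is_derive u 1 h (h' u)) ->
  exists2 c, `|c - s| <= `|t - s| & h t - h s = h' c * (t - s).
Proof.
move=> dh.
have ch : continuous h by apply: derivable_continuousR => u; exact: ex_derive.
have [st|ts] := leP s t.
  have [c] := MVT_segment st (fun x _ => dh x) (continuous_subspaceT ch).
  rewrite in_itv /= => /andP[sc ct] E; exists c => //.
  by rewrite !ger0_norm ?subr_ge0// lerD2r.
have [c] := MVT_segment (ltW ts) (fun x _ => dh x) (continuous_subspaceT ch).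
rewrite in_itv /= => /andP[tc cs] E; exists c.
  by rewrite !ler0_norm ?subr_le0// ?(ltW ts)// lerN2 lerD2r.
by rewrite -opprB E -mulrN opprB.
Qed.

Lemma lipschitz_of_derive h (h' : R -> R) M s t : (forall u : R, is_derive u 1 h (h' u)) ->
  (forall u, `|h' u| <= M) -> `|h t - h s| <= M * `|t - s|.
Proof.
by move=> dh hM; have [c _ ->] := mean_value s t dh; rewrite normrM ler_wpM2r.
Qed.

(** Two applications of the mean value theorem; the intermediate point is no farther from [s] than
    [t] is, which gives the constant [M] in place of the optimal [M/2]. *)
Lemma taylor2 h (h' h'' : R -> R) M s t : (forall u : R, is_derive u 1 h (h' u)) ->
  (forall u : R, is_derive u 1 h' (h'' u)) -> (forall u, `|h'' u| <= M) ->
  `|h t - h s - h' s * (t - s)| <= M * `|t - s| ^+ 2.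
Proof.
move=> dh dh' hM; have [c cs ->] := mean_value s t dh.
rewrite -mulrBl normrM expr2 mulrA ler_wpM2r//.
apply: (le_trans (lipschitz_of_derive s c dh' hM)).
by rewrite ler_wpM2l// (le_trans (normr_ge0 (h'' 0))).
Qed.

End MeanValue.

(** * Integrals against ridge functions *)

Section Radon.
Context {R : realType} {n : nat}.
Implicit Types (f : 'rV[R]_n -> R) (g : R -> R) (w x : 'rV[R]_n) (b : R).

Definition rapid f := continuous f /\ forall N, exists C, decay N f C.

Definition mulX (j : 'I_n) f : 'rV[R]_n -> R := fun x => x 0 j * f x.

Lemma rapid_mulX j f : rapid f -> rapid (mulX j f).
Proof.
move=> [cf hf]; split; first exact: continuous_coordM.
by move=> N; have [C hC] := hf N.+1; exists C; exact: decay_coord.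
Qed.

Definition wave_int f g w b : R := rnint (fun x => f x * g (edot x w - b)).

Lemma continuous_phase g w b : continuous g -> continuous (fun x => g (edot x w - b)).
Proof.
move=> cg x; apply: (@continuous_comp _ _ _ (fun x => edot x w - b) g); last exact: cg.
exact: (cvgB (@continuous_edot _ _ w x) (cvg_cst b)).
Qed.

Lemma L1_wave_int f g w b : rapid f -> schwartz_line g -> L1 (fun x => f x * g (edot x w - b)).
Proof.
move=> [cf hf] hg; split.
  move=> x; apply: (cvgM (cf x)); apply: continuous_phase; exact: schwartz_line_continuous0.
have [C hC] := hf (2 * n)%N; have [B hB] := (hg 0%N).2 0%N.
by exists (C * B); apply: decayM => // x; have := hB (edot x w - b); rewrite expr0 mul1r.
Qed.

Definition l1dist w b w' b' : R := \sum_j `|w' 0 j - w 0 j| + `|b' - b|.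

Lemma l1dist_ge0 w b w' b' : 0 <= l1dist w b w' b'.
Proof. by rewrite addr_ge0// sumr_ge0. Qed.

Lemma phase_sub x w b w' b' : edot x w' - b' - (edot x w - b) =
  \sum_j x 0 j * (w' 0 j - w 0 j) - (b' - b).
Proof.
under eq_bigr do rewrite mulrBr.
by rewrite sumrB /edot; ring.
Qed.

(** The phase moves by at most a multiple [wt x] of the displacement of [(w, b)]. This growth in [x]
    is absorbed by the decay of [f], one power of [wt] per order of expansion. *)
Lemma phase_le x w b w' b' : `|edot x w' - b' - (edot x w - b)| <=
  wt x * l1dist w b w' b'.
Proof.
rewrite phase_sub /l1dist mulrDr; apply: (le_trans (ler_normB _ _)); apply: lerD.
  rewrite mulr_sumr; apply: (le_trans (ler_norm_sum _ _ _)); apply: ler_sum => j _.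
  by rewrite normrM ler_wpM2r// norm_coord_le_wt.
by rewrite ler_peMl// wt_ge1.
Qed.

Lemma wave_int_lipschitz f g : rapid f -> schwartz_line g -> exists2 C, 0 <= C &
  forall w b w' b', `|wave_int f g w' b' - wave_int f g w b| <= C * l1dist w b w' b'.
Proof.
move=> hf hg; have [A hA] := hf.2 (2 * n).+1; have [M hM] := (hg 1%N).2 0%N.
have A0 := decay_ge0 hA; have M0 := decay1_ge0 hM.
exists (A * M * @wint R n) => [|w b w' b'].
  by rewrite !mulr_ge0// wint_ge0.
have l1 := L1_wave_int w b hf hg; have l2 := L1_wave_int w' b' hf hg.
rewrite /wave_int -rnintB// mulrAC; apply: rnint_le.
  by move=> x; exact: (cvgB (l2.1 x) (l1.1 x)).
move=> x; rewrite -mulrBr normrM.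
set d := l1dist _ _ _ _.
have h1 := lipschitz_of_derive (edot x w - b) (edot x w' - b') (fun u => schwartz_line_is_derive0 u hg)
  (fun u => _ : `|derive1 g u| <= M).
apply: (@le_trans _ _ (wt x ^+ (2 * n) * (`|f x| * (M * (wt x * d))))).
  rewrite ler_wpM2l ?exprn_ge0 ?wt_ge0// ler_wpM2l// (le_trans (h1 _))//.
    by move=> u; have := hM u; rewrite expr0 mul1r.
  by rewrite ler_wpM2l// phase_le.
rewrite (_ : _ * _ = wt x ^+ (2 * n).+1 * `|f x| * (M * d)); last by rewrite exprS; ring.
by rewrite -(mulrA A) ler_wpM2r ?mulr_ge0 ?l1dist_ge0//.
Qed.

Definition wave_int_diff f g w b (dw : 'I_n -> R) (db : R) : R :=
  \sum_j dw j * wave_int (mulX j f) (derive1 g) w b - db * wave_int f (derive1 g) w b.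

(** The pointwise bound of [taylor2] is integrated against [f]. The remainder is quadratic with a
    constant uniform in [(w, b)], which replaces differentiation under the integral sign. *)
Lemma wave_int_taylor f g : rapid f -> schwartz_line g -> exists2 C, 0 <= C &
  forall w b w' b',
  `|wave_int f g w' b' - wave_int f g w b - wave_int_diff f g w b (fun j => w' 0 j - w 0 j) (b' - b)|
    <= C * l1dist w b w' b' ^+ 2.
Proof.
move=> hf hg; have [A hA] := hf.2 (2 * n).+2; have [M hM] := (hg 2%N).2 0%N.
have A0 := decay_ge0 hA; have M0 := decay1_ge0 hM.
exists (A * M * @wint R n) => [|w b w' b'].
  by rewrite !mulr_ge0// wint_ge0.
have hg' := schwartz_line_deriv hg.
have l1 := L1_wave_int w b hf hg; have l2 := L1_wave_int w' b' hf hg.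
have l3 j := L1Z (w' 0 j - w 0 j) (L1_wave_int w b (rapid_mulX j hf) hg').
have l4 := L1Z (b' - b) (L1_wave_int w b hf hg').
have l5 : L1 (fun x => - 1 * ((b' - b) * (f x * derive1 g (edot x w - b)))) by exact: L1Z.
have l6 := L1_sum (index_enum 'I_n) l3.
have l7 := L1D l6 l5.
have l8 := L1Z (-1) l7; have l9 := L1D l2 (L1Z (-1) l1); have l10 := L1D l9 l8.
(* The left side keeps the shape of the [L1D] and [L1Z] facts, to which linearity of the integral
   applies; the right side is the integrand to which the Taylor bound applies. *)
have FE x : f x * g (edot x w' - b') + -1 * (f x * g (edot x w - b)) +
     -1 * (\sum_j (w' 0 j - w 0 j) * (mulX j f x * derive1 g (edot x w - b)) +
       -1 * ((b' - b) * (f x * derive1 g (edot x w - b)))) =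
   f x * (g (edot x w' - b') - g (edot x w - b) -
     derive1 g (edot x w - b) * (edot x w' - b' - (edot x w - b))).
  rewrite phase_sub.
  under eq_bigr do rewrite /mulX mulrA.
  rewrite -mulr_suml.
  rewrite (eq_bigr (fun j => f x * (x 0 j * (w' 0 j - w 0 j)))); last by move=> j _; ring.
  by rewrite -mulr_sumr; ring.
have E : wave_int f g w' b' - wave_int f g w b - wave_int_diff f g w b (fun j => w' 0 j - w 0 j) (b' - b) =
  rnint (fun x => f x * (g (edot x w' - b') - g (edot x w - b) -
     derive1 g (edot x w - b) * (edot x w' - b' - (edot x w - b)))).
  transitivity (rnint (fun x => f x * g (edot x w' - b') + -1 * (f x * g (edot x w - b)) +
     -1 * (\sum_j (w' 0 j - w 0 j) * (mulX j f x * derive1 g (edot x w - b)) +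
       -1 * ((b' - b) * (f x * derive1 g (edot x w - b)))))).
    rewrite (rnintD l9 l8) (rnintD l2 (L1Z (-1) l1)) (rnintZ (-1) l1) (rnintZ (-1) l7).
    rewrite (rnintD l6 l5) (rnintZ (-1) l4) (rnintZ _ (L1_wave_int w b hf hg')).
    rewrite (rnint_sum (index_enum 'I_n) l3) /wave_int_diff !mulN1r; congr (_ - _ - (_ - _)).
    by apply: eq_bigr => j _; rewrite rnintZ//; exact: L1_wave_int (rapid_mulX j hf) hg'.
  congr rnint; apply/funext => x; exact: FE.
rewrite E mulrAC; apply: rnint_le.
  by move=> x; have := l10.1 x; under eq_fun do rewrite FE.
move=> x; rewrite normrM.
set d := l1dist _ _ _ _.
have d0 : 0 <= d by exact: l1dist_ge0.
have h1 : `|g (edot x w' - b') - g (edot x w - b) -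
     derive1 g (edot x w - b) * (edot x w' - b' - (edot x w - b))| <= M * (wt x * d) ^+ 2.
  apply: (le_trans (taylor2 _ _ (fun u => schwartz_line_is_derive0 u hg) (fun u => schwartz_line_is_derive0 u hg')
   (fun u => _ : `|derive1 (derive1 g) u| <= M))).
    by move=> u; have := hM u; rewrite expr0 mul1r.
  by rewrite ler_wpM2l// lerXn2r ?nnegrE ?mulr_ge0 ?wt_ge0// phase_le.
apply: (@le_trans _ _ (wt x ^+ (2 * n) * (`|f x| * (M * (wt x * d) ^+ 2)))).
  by rewrite ler_wpM2l ?exprn_ge0 ?wt_ge0// ler_wpM2l//.
rewrite (_ : _ * _ = wt x ^+ (2 * n).+2 * `|f x| * (M * d ^+ 2)); last by rewrite !exprS; ring.
by rewrite -(mulrA A) ler_wpM2r ?mulr_ge0 ?exprn_ge0//.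
Qed.

Lemma is_deriveP (V : normedModType R) (F : V -> R) p v d :
  is_derive p v F d <->
  h^-1 * (F (h *: v + p) - F p) @[h --> 0^'] --> d.
Proof.
split=> [[d1 <-]|c]; first exact: d1.
by split; [apply/cvg_ex; exists d|exact: cvg_lim c].
Qed.

(** Chain rule along a single direction: only the directional derivatives of [W] and [B] at [p]
    enter, because the Taylor remainder of [wave_int] is quadratic in the increments of [W] and
    [B]. *)
Lemma wave_int_is_derive (V : normedModType R) f g (W : V -> 'rV[R]_n) (B : V -> R)
    (p v : V) (dW : 'I_n -> R) (dB : R) : rapid f -> schwartz_line g ->
  (forall j, is_derive p v (fun q => W q 0 j) (dW j)) -> is_derive p v B dB ->
  is_derive p v (fun q => wave_int f g (W q) (B q)) (wave_int_diff f g (W p) (B p) dW dB).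
Proof.
move=> hf hg hW hB; have [C C0 hC] := wave_int_taylor hf hg.
apply/is_deriveP.
have cW j : h^-1 * (W (h *: v + p) 0 j - W p 0 j) @[h --> 0^'] --> dW j.
  by have /is_deriveP := hW j.
have /is_deriveP cB := hB.
(* [D h] is the l1 increment divided by [|h|]; it converges, so the remainder divided by [h], at
   most [C |h| D(h)^2], tends to 0. [L h] is the linear part. *)
pose D (h : R) := \sum_j `|h^-1 * (W (h *: v + p) 0 j - W p 0 j)| +
                  `|h^-1 * (B (h *: v + p) - B p)|.
pose L (h : R) := wave_int_diff f g (W p) (B p) (fun j => h^-1 * (W (h *: v + p) 0 j - W p 0 j))
  (h^-1 * (B (h *: v + p) - B p)).
have cL : L h @[h --> 0^'] --> wave_int_diff f g (W p) (B p) dW dB.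
  apply: cvgB; last by apply: cvgM; [exact: cB|exact: cvg_cst].
  apply: (@cvg_big R^o _ +%R 0 xpredT) => [|j _]; first exact: (@add_continuous R^o).
  by apply: cvgM; [exact: cW|exact: cvg_cst].
have cD : D h @[h --> 0^'] --> \sum_j `|dW j| + `|dB|.
  apply: cvgD; last exact: cvg_norm.
  apply: (@cvg_big R^o _ +%R 0 xpredT) => [|j _]; first exact: (@add_continuous R^o).
  exact: cvg_norm.
have c0 : C * (`|h| * D h ^+ 2) @[h --> 0^'] --> (0 : R).
  have E0 : C * (0 * (\sum_j `|dW j| + `|dB|) ^+ 2) = 0 by rewrite mul0r mulr0.
  suff : C * (`|h| * D h ^+ 2) @[h --> (0 : R)^'] --> C * (0 * (\sum_j `|dW j| + `|dB|) ^+ 2).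
    by rewrite E0.
  apply: cvgM; first exact: cvg_cst.
  apply: cvgM.
    have hh : h @[h --> (0 : R)^'] --> (0 : R) by exact: cvg_within.
    by have := cvg_norm hh; rewrite normr0; apply.
  by rewrite !expr2; under eq_fun do rewrite expr2; apply: cvgM.
rewrite -[X in _ --> X]addr0.
have -> : (fun h : R => h^-1 * (wave_int f g (W (h *: v + p)) (B (h *: v + p)) - wave_int f g (W p) (B p))) =
   (fun h : R => L h + (h^-1 * (wave_int f g (W (h *: v + p)) (B (h *: v + p)) - wave_int f g (W p) (B p)) - L h)).
  by apply/funext => h; ring.
apply: cvgD => //.
apply/norm_cvg0P; apply: (@squeeze_cvgr _ _ _ _ (cst 0) (fun h => C * (`|h| * D h ^+ 2))); last 2 first.
- exact: cvg_cst.
- exact: c0.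
near=> h; rewrite normr_ge0 /=.
have h0 : h != 0 by near: h; exact: nbhs_dnbhs_neq.
have -> : L h = h^-1 * wave_int_diff f g (W p) (B p) (fun j => (W (h *: v + p) 0 j - W p 0 j))
  (B (h *: v + p) - B p).
  rewrite /L /wave_int_diff [RHS]mulrBr mulr_sumr; congr (_ - _); last by rewrite mulrA.
  by apply: eq_bigr => j _; rewrite mulrA.
rewrite -mulrBr normrM.
apply: (le_trans (ler_wpM2l (normr_ge0 _) (hC _ _ _ _))).
have -> : D h = `|h|^-1 * l1dist (W p) (B p) (W (h *: v + p)) (B (h *: v + p)).
  rewrite /D /l1dist [RHS]mulrDr normrM normfV; congr (_ + _).
  by rewrite mulr_sumr; apply: eq_bigr => j _; rewrite normrM normfV.
rewrite normfV le_eqVlt; apply/orP; left; apply/eqP.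
by field; rewrite normr_eq0.
Unshelve. all: by end_near.
Qed.

Lemma wave_int_continuous (V : topologicalType) f g (W : V -> 'rV[R]_n) (B : V -> R) (p : V) :
  rapid f -> schwartz_line g ->
  (forall j, {for p, continuous (fun q => W q 0 j)}) -> {for p, continuous B} ->
  {for p, continuous (fun q => wave_int f g (W q) (B q))}.
Proof.
move=> hf hg hW hB; have [C C0 hC] := wave_int_lipschitz hf hg.
apply/subr_cvg0.
have c0 : C * l1dist (W p) (B p) (W q) (B q) @[q --> p] --> (0 : R).
  have E0 : C * l1dist (W p) (B p) (W p) (B p) = 0.
    by rewrite /l1dist subrr normr0 addr0 big1 ?mulr0// => j _; rewrite subrr normr0.
  suff : C * l1dist (W p) (B p) (W q) (B q) @[q --> p] --> C * l1dist (W p) (B p) (W p) (B p).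
    by rewrite E0.
  apply: cvgM; first exact: cvg_cst.
  apply: cvgD; last by apply: cvg_norm; apply: cvgB; [exact: hB|exact: cvg_cst].
  apply: (@cvg_big R^o _ +%R 0 xpredT) => [|j _]; first exact: (@add_continuous R^o).
  by apply: cvg_norm; apply: cvgB; [exact: hW|exact: cvg_cst].
apply/norm_cvg0P; apply: (@squeeze_cvgr _ _ _ _ (cst 0) (fun q => C * l1dist (W p) (B p) (W q) (B q))); last 2 first.
- exact: cvg_cst.
- exact: c0.
by near=> q; rewrite normr_ge0 /=.
Unshelve. all: by end_near.
Qed.
End Radon.

(** * Estimates of the transform *)

Section PureDerivatives.
Context {R : realType} {n : nat}.
Implicit Types (f : 'rV[R]_n -> R) (x : 'rV[R]_n) (i j : 'I_n).

Definition basis_row i : 'rV[R]_n := delta_mx 0 i.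

Definition pure_derive i (k : nat) f : 'rV[R]_n -> R := iter k (fun h => 'D_(basis_row i) h) f.

(** Regularity along one coordinate axis, which is all that integration by parts along that axis
    consumes; it is stable under multiplication by every coordinate. *)
Definition schwartz_along i f := forall k,
  [/\ continuous (pure_derive i k f), forall x, derivable (pure_derive i k f) x (basis_row i) &
      forall N, exists C, decay N (pure_derive i k f) C].

Definition bound_along i (N K : nat) f (A : R) := forall k, (k <= K)%N -> decay N (pure_derive i k f) A.

Lemma dirDS i k f : pure_derive i k.+1 f = pure_derive i k (pure_derive i 1 f).
Proof. exact: iterSr. Qed.

Lemma schwartz_along_rapid i f : schwartz_along i f -> rapid f.
Proof. by move=> /(_ 0%N) [? _ ?]. Qed.

Lemma schwartz_along_pure_derive i f : schwartz_along i f -> schwartz_along i (pure_derive i 1 f).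
Proof. by move=> hf k; rewrite -dirDS; exact: hf. Qed.

Lemma bound_along_pure_derive i N K f A : bound_along i N K.+1 f A -> bound_along i N K (pure_derive i 1 f) A.
Proof. by move=> hf k kK; rewrite -dirDS; exact: hf. Qed.

Lemma bound_alongW i N N' K K' f A : (N <= N')%N -> (K <= K')%N -> bound_along i N' K' f A -> bound_along i N K f A.
Proof.
move=> NN KK h k kK; apply: decayW (h k _) => //.
exact: leq_trans KK.
Qed.

Lemma bound_along_ge0 i N K f A : bound_along i N K f A -> 0 <= A.
Proof. by move=> /(_ 0 (leq0n _)); exact: decay_ge0. Qed.

Lemma schwartz_along_is_derive i k f x : schwartz_along i f -> is_derive x (basis_row i) (pure_derive i k f) (pure_derive i k.+1 f x).
Proof. by move=> /(_ k) [_ df _]; apply: derivableP; exact: df. Qed.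

Lemma derive_eq (V : normedModType R) (v : V) (F F' : V -> R) :
  (forall x : V, is_derive x v F (F' x)) -> 'D_v F = F'.
Proof. by move=> dF; apply/funext => x; have [_ ->] := dF x. Qed.

Lemma is_derive_coord i j x : is_derive x (basis_row i) (fun y : 'rV[R]_n => y 0 j) ((i == j)%:R : R).
Proof.
apply/is_deriveP.
apply: cvg_near_cst.
near=> h.
have h0 : h != 0 by near: h; exact: nbhs_dnbhs_neq.
by rewrite !mxE eqxx /= eq_sym addrK mulKf.
Unshelve. all: by end_near.
Qed.

Lemma is_derive_mulX i j k f x : schwartz_along i f ->
  is_derive x (basis_row i)
    (fun x => mulX j (pure_derive i k f) x + (i == j)%:R * k%:R * pure_derive i k.-1 f x)
    (mulX j (pure_derive i k.+1 f) x + (i == j)%:R * k.+1%:R * pure_derive i k f x).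
Proof.
move=> hf; have h1 := schwartz_along_is_derive k x hf.
have h2 : is_derive x (basis_row i) (fun x => (i == j)%:R * k%:R * pure_derive i k.-1 f x)
    ((i == j)%:R * k%:R * pure_derive i k f x).
  case: k {h1} => [|k].
    rewrite mulr0 mul0r (_ : (fun _ => _) = cst 0); first exact: is_derive_cst.
    by apply/funext => u; rewrite mul0r.
  have h1 := schwartz_along_is_derive k x hf.
  exact: (is_derive_eq (is_deriveZ ((i == j)%:R * k.+1%:R) h1)).
apply: (is_derive_eq (is_deriveD (is_deriveM (is_derive_coord i j x) h1) h2)).
rewrite /mulX /GRing.scale /=.
by rewrite -[k.+1%:R]natr1; ring.
Qed.

Lemma pure_derive_mulX i j k f : schwartz_along i f ->
  pure_derive i k (mulX j f) = fun x => mulX j (pure_derive i k f) x + (i == j)%:R * k%:R * pure_derive i k.-1 f x.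
Proof.
move=> hf; elim: k => [|k IH].
  by apply/funext => x; rewrite mulr0 mul0r addr0.
by rewrite [LHS]/= -/(pure_derive i k _) IH; apply: derive_eq => x; exact: is_derive_mulX.
Qed.

Lemma schwartz_along_mulX i j f : schwartz_along i f -> schwartz_along i (mulX j f).
Proof.
move=> hf k; rewrite pure_derive_mulX//.
have [c1 d1 b1] := hf k; have [c2 d2 b2] := hf k.-1; split.
- by move=> x; exact: (cvgD (@continuous_coordM _ _ j _ c1 x) (cvgM (cvg_cst _) (c2 x))).
- by move=> x; have [] := is_derive_mulX j k x hf.
move=> N; have [C1 h1] := b1 N.+1; have [C2 h2] := b2 N.
by exists (C1 + `|(i == j)%:R * k%:R| * C2); exact: (decayD (decay_coord j h1) (decayZ _ h2)).
Qed.

Lemma bound_along_mulX i j N K f A : schwartz_along i f -> bound_along i N.+1 K f A -> bound_along i N K (mulX j f) (K.+1%:R * A).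
Proof.
move=> hf hA k kK; rewrite pure_derive_mulX//.
have A0 := bound_along_ge0 hA.
have h1 : decay N (mulX j (pure_derive i k f)) A by apply: decay_coord; exact: hA.
have h2 : decay N (pure_derive i k.-1 f) A.
  by apply: (decayW (leqnSn N)); apply: hA; exact: leq_trans (leq_pred _) kK.
move=> x; apply: (le_trans (decayD h1 (decayZ ((i == j)%:R * k%:R) h2) x)).
rewrite normrM !normr_nat mulrS mulrDl mul1r lerD2l ler_wpM2r//.
by case: (i == j); rewrite ?mul1r ?mul0r ?ler_nat// ler0n.
Qed.

Definition moments_rn f := forall m : multi_index n, rnint (fun x => monomial m x * f x) = 0.

Lemma moments_rn_mulX j f : moments_rn f -> moments_rn (mulX j f).
Proof.
move=> hf m; rewrite -(hf (fun k => (m k + (k == j))%N)); congr rnint.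
apply/funext => x; rewrite /mulX mulrA; congr (_ * _).
rewrite /monomial [RHS](bigD1 j)//= [X in X * _](bigD1 j)//= eqxx exprD expr1.
rewrite mulrAC; congr (_ * _); apply: eq_bigr => k /negbTE ->.
by rewrite addn0.
Qed.

Lemma moments_rn_rnint f : moments_rn f -> rnint f = 0.
Proof.
move=> /(_ (fun=> 0%N)) h; rewrite -[RHS]h; congr rnint; apply/funext => x.
by rewrite /monomial big1 ?mul1r.
Qed.

Definition S0_real f := [/\ rapid f, forall i, schwartz_along i f & moments_rn f].

Lemma S0_real_mulX j f : S0_real f -> S0_real (mulX j f).
Proof.
by case=> h1 h2 h3; split; [exact: rapid_mulX|move=> i; exact: schwartz_along_mulX|exact: moments_rn_mulX].
Qed.

End PureDerivatives.

Section Estimates.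
Context {R : realType} {n : nat}.
Implicit Types (f : 'rV[R]_n -> R) (g : R -> R) (w x u : 'rV[R]_n) (a b : R) (i j : 'I_n).

Lemma is_derive_lineP (V : normedModType R) (F : V -> R) (p v : V) d :
  is_derive (0 : R) 1 (fun h : R => F (h *: v + p)) d <-> is_derive p v F d.
Proof.
rewrite !is_deriveP; rewrite (_ : (fun h : R => _) =
  (fun h : R => h^-1 * (F (h *: v + p) - F p)))//.
by apply/funext => h; rewrite scale0r add0r addr0 [h *: (1 : R)]mulr1.
Qed.

(** Along the [i]-th axis the phase is affine with slope [w_i], so the claim reduces to the
    one-variable chain rule. *)
Lemma is_derive_phase g (g' : R -> R) w b x i : (forall t : R, is_derive t 1 g (g' t)) ->
  is_derive x (basis_row i) (fun x => g (edot x w - b)) (w 0 i * g' (edot x w - b)).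
Proof.
move=> dg; apply/is_derive_lineP.
have E : (fun h : R => g (edot (h *: basis_row i + x) w - b)) =
         g \o (fun h : R => h * w 0 i + (edot x w - b)).
  apply/funext => h /=; congr g; rewrite addrA; congr (_ - _).
  rewrite /edot (eq_bigr (fun j => (h * (i == j)%:R * w 0 j) + x 0 j * w 0 j)); last first.
    by move=> j _; rewrite !mxE eqxx /= eq_sym mulrDl.
  rewrite big_split /= (bigD1 i)//= eqxx mulr1 big1 ?addr0// => j /negbTE ij.
  by rewrite eq_sym ij mulr0 mul0r.
have dl : is_derive (0 : R) 1 (fun h : R => h * w 0 i + (edot x w - b)) (w 0 i).
  apply/is_deriveP; apply: cvg_near_cst; near=> h.
  have h0 : h != 0 by near: h; exact: nbhs_dnbhs_neq.
  by rewrite [h *: (1 : R)]mulr1 addr0 mul0r add0r addrK mulKf.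
rewrite E mulrC; apply: is_derive1_comp.
by rewrite mul0r add0r; exact: dg.
Unshelve. all: by end_near.
Qed.

Lemma schwartz_line_bounded g : schwartz_line g -> exists2 M, 0 <= M & forall t, `|g t| <= M.
Proof.
move=> /(_ 0%N) [_ /(_ 0%N)] [M hM]; exists M; first exact: decay1_ge0 hM.
by move=> t; have := hM t; rewrite expr0 mul1r.
Qed.

Lemma wave_int_by_parts i f g w b : schwartz_along i f -> schwartz_line g ->
  wave_int (pure_derive i 1 f) g w b = - (w 0 i * wave_int f (derive1 g) w b).
Proof.
move=> hf hg; have hg' := schwartz_line_deriv hg.
have rf := schwartz_along_rapid hf; have rdf := schwartz_along_rapid (schwartz_along_pure_derive hf).
have l1 := L1_wave_int w b rdf hg; have l2 := L1_wave_int w b rf hg'.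
have l3 := L1Z (w 0 i) l2.
have [M M0 hM] := schwartz_line_bounded hg; have [M' M'0 hM'] := schwartz_line_bounded hg'.
have [A hA] := rf.2 (4 * n)%N; have [A' hA'] := rdf.2 (4 * n)%N.
have dF x : is_derive x (basis_row i) (fun x => f x * g (edot x w - b))
   (pure_derive i 1 f x * g (edot x w - b) + w 0 i * (f x * derive1 g (edot x w - b))).
  have h1 := schwartz_along_is_derive 0 x hf.
  have h2 := is_derive_phase w b x i (fun t => schwartz_line_is_derive0 t hg).
  apply: (is_derive_eq (is_deriveM h1 h2)).
  by rewrite /GRing.scale /=; ring.
have l4 := L1D l1 l3.
have := rnint_partial dF l4.1 (decayM hA (fun x => hM _))
  (decayD (decayM hA' (fun x => hM _)) (decayZ (w 0 i) (decayM hA (fun x => hM' _)))).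
by rewrite rnintD// rnintZ// => /eqP; rewrite addr_eq0 => /eqP.
Qed.

(** The hypothesis on [c] splits the weight under the integral between [x] and the phase: [r] powers
    go to [f], [r] to [g], and [2 * n] further powers of [f] ensure integrability. The parameter [c]
    is kept apart from [b] because for small [a] the weight is wanted in [b] while the integral is
    taken at [b / a]. *)
Lemma wave_int_weight r f g w b (c A B : R) : rapid f -> decay (2 * n + r) f A ->
  schwartz_line g -> decay1 r g B ->
  (forall x, 1 + `|c| <= wt x * (1 + `|edot x w - b|)) ->
  (1 + `|c|) ^+ r * `|wave_int f g w b| <= A * B * @wint R n.
Proof.
move=> rf fA hg gB hc.
have l1 := L1_wave_int w b rf hg.
have c0 : 0 <= (1 + `|c|) ^+ r by rewrite exprn_ge0// addr_ge0.
rewrite -{1}(ger0_norm c0) -normrM /wave_int -rnintZ//.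
apply: rnint_le; first exact: (L1Z _ l1).1.
move=> x; rewrite !normrM (ger0_norm c0).
set t := edot x w - b.
apply: (@le_trans _ _ ((wt x ^+ (2 * n + r) * `|f x|) * ((1 + `|t|) ^+ r * `|g t|))).
  rewrite exprD [X in _ <= X](_ : _ = wt x ^+ (2 * n) * ((wt x * (1 + `|t|)) ^+ r * (`|f x| * `|g t|))).
    rewrite ler_wpM2l ?exprn_ge0 ?wt_ge0// ler_wpM2r ?mulr_ge0//.
    by rewrite lerXn2r ?nnegrE ?addr_ge0 ?mulr_ge0 ?wt_ge0 ?addr_ge0.
  by rewrite exprMn; ring.
by apply: ler_pM => //; rewrite mulr_ge0 ?exprn_ge0 ?wt_ge0.
Qed.

Lemma edot_le x w e : (forall j, `|w 0 j| <= e) -> 0 <= e -> `|edot x w| <= e * (\sum_j `|x 0 j|).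
Proof.
move=> hw e0; rewrite mulr_sumr; apply: (le_trans (ler_norm_sum _ _ _)).
by apply: ler_sum => j _; rewrite normrM mulrC ler_wpM2r.
Qed.

(* Writing [g] as an iterated derivative and integrating by parts along the
   coordinate [i] gains a factor [a] at each step. *)
Lemma wave_int_small i r N f g u a b A B : schwartz_along i f -> schwartz_line g -> moments_line g ->
  bound_along i (2 * n + r) N f A -> bound_line (r + 2 * N) 0 g B ->
  u 0 i != 0 -> (forall j, `|u 0 j| <= 1) -> 0 < a <= 1 ->
  (1 + `|b|) ^+ r * `|wave_int f g (a^-1 *: u) (b / a)| <=
  A * (B * cauchyint ^+ N) * @wint R n * (a / `|u 0 i|) ^+ N.
Proof.
move=> + + + + + ui hu /andP[a0 a1].
elim: N f g B => [|N IH] f g B hf hg mg hA hB.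
  rewrite expr0 !mulr1; apply: wave_int_weight => //.
  - exact: schwartz_along_rapid hf.
  - exact: (hA 0%N).
  - by have := hB 0%N (leqnn _); rewrite muln0 addn0.
  move=> x; set t := edot _ _ - _.
  (* With [t] the phase and [a <= 1], this gives [|b| <= sum |x_j| + |t|], hence
     [1 + |b| <= wt x * (1 + |t|)]. *)
  have -> : b = edot x u - a * t.
    rewrite /t mulrBr mulrCA divff ?gt_eqF// mulr1.
    have -> : edot x (a^-1 *: u) = a^-1 * edot x u.
      by rewrite /edot mulr_sumr; apply: eq_bigr => j _; rewrite mxE mulrCA.
    by rewrite mulrA divff ?gt_eqF// mul1r opprB addrC subrK.
  have h1 : `|edot x u - a * t| <= \sum_j `|x 0 j| + `|t|.
    apply: (le_trans (ler_normB _ _)); apply: lerD.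
      by have := edot_le x hu ler01; rewrite mul1r.
    by rewrite normrM (gtr0_norm a0) ler_piMl.
  rewrite /wt mulrDl mul1r.
  apply: (@le_trans _ _ (1 + (\sum_j `|x 0 j| + `|t|))); first by rewrite lerD2l.
  have h2 : 0 <= \sum_j `|x 0 j| by rewrite sumr_ge0.
  have h3 : 0 <= `|t| by [].
  by nra.
have [cp mp pE pb] := schwartz_line_prim hg mg.
have hdf := schwartz_along_pure_derive hf; have hAd := bound_along_pure_derive hA.
(* Each primitive costs two powers of decay and one factor [cauchyint]: the origin of [2 * N] and
   [cauchyint ^+ N]. *)
have hBp : bound_line (r + 2 * N) 0 (prim g) (B * cauchyint).
  by apply: pb; rewrite -addn2 -addnA -mulnSr; exact: hB.
have {}IH := IH _ _ _ hdf cp mp hAd hBp.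
have E : wave_int f g (a^-1 *: u) (b / a) = - (a / u 0 i) * wave_int (pure_derive i 1 f) (prim g) (a^-1 *: u) (b / a).
  rewrite (wave_int_by_parts _ _ hf cp) pE mxE mulrNN !mulrA; field.
  by rewrite ui gt_eqF.
rewrite E normrM mulrCA normrN normf_div (gtr0_norm a0).
apply: (le_trans (ler_wpM2l _ IH)).
  by rewrite divr_ge0// ltW.
by rewrite !exprS le_eqVlt; apply/orP; left; apply/eqP; ring.
Qed.

(* All derivatives of [th |-> wave_int f g (th w) b] at [0] are moments of [f]. *)
Lemma wave_int_big r N f g w b A B e : rapid f -> moments_rn f -> schwartz_line g ->
  decay (2 * n + r + N) f A -> bound_line r N g B ->
  (forall j, `|w 0 j| <= e) -> 0 <= e <= 1 ->
  forall th, 0 <= th <= 1 ->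
  (1 + `|b|) ^+ r * `|wave_int f g (th *: w) b| <=
  A * B * @wint R n * (n%:R * e) ^+ N.
Proof.
move=> + + + + + hw /andP[e0 e1].
elim: N f g => [|N IH] f g rf mf hg hA hB th /andP[th0 th1].
  rewrite expr0 !mulr1; apply: wave_int_weight => //.
  - by move: hA; rewrite addn0.
  - exact: (hB 0%N).
  move=> x; set t := edot _ _ - _.
  have -> : b = edot x (th *: w) - t by rewrite /t opprB addrC subrK.
  have h1 : `|edot x (th *: w) - t| <= \sum_j `|x 0 j| + `|t|.
    apply: (le_trans (ler_normB _ _)); apply: lerD => //.
    have h : forall j, `|(th *: w) 0 j| <= 1.
      move=> j; rewrite mxE normrM (ger0_norm th0) mulr_ile1//.
      exact: le_trans (hw j) e1.
    by have := edot_le x h ler01; rewrite mul1r.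
  rewrite /wt mulrDl mul1r.
  apply: (@le_trans _ _ (1 + (\sum_j `|x 0 j| + `|t|))); first by rewrite lerD2l.
  have h2 : 0 <= \sum_j `|x 0 j| by rewrite sumr_ge0.
  have h3 : 0 <= `|t| by [].
  by nra.
have hg' := schwartz_line_deriv hg.
(* The derivative along the ray is a sum of [n] terms [w_j wave_int (x_j f) g'], each again with
   vanishing moments; the [n] terms and [|w_j| <= e] yield the factor [n e] at each order. *)
pose psi s := wave_int_diff f g (s *: w) b (fun j => w 0 j) 0.
have dpsi (s : R) : is_derive s 1 (fun s => wave_int f g (s *: w) b) (psi s).
  apply: (@wave_int_is_derive R n R^o f g (fun s : R^o => s *: w) (cst b) s 1 (fun j => w 0 j) 0) => //.
  move=> j; under eq_fun do rewrite mxE.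
  have := is_deriveM (is_derive_id s 1) (is_derive_cst (w 0 j) s 1).
  by move=> d; apply: (is_derive_eq d); rewrite /GRing.scale /= mulr0 add0r mulr1.
have bpsi s : 0 <= s <= 1 -> (1 + `|b|) ^+ r * `|psi s| <=
    A * B * @wint R n * (n%:R * e) ^+ N.+1.
  move=> hs; rewrite /psi /wave_int_diff mul0r subr0.
  apply: (@le_trans _ _ (\sum_(j < n) e * (A * B * @wint R n * (n%:R * e) ^+ N))).
    apply: (@le_trans _ _ (\sum_j (1 + `|b|) ^+ r * `|w 0 j * wave_int (mulX j f) (derive1 g) (s *: w) b|)).
      rewrite -mulr_sumr ler_wpM2l ?exprn_ge0 ?addr_ge0//; exact: ler_norm_sum.
    apply: ler_sum => j _; rewrite normrM mulrCA; apply: ler_pM => //.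
    apply: IH => //.
    - exact: rapid_mulX.
    - exact: moments_rn_mulX.
    - by apply: decay_coord; rewrite -addnS.
    - exact: bound_line_deriv.
  by rewrite sumr_const card_ord -mulr_natr exprS le_eqVlt; apply/orP; left; apply/eqP; ring.
(* At the origin of the ray the phase is the constant [-b], so the integral is [g(-b)] times the
   zeroth moment of [f]. *)
have H0 : wave_int f g (0 *: w) b = 0.
  rewrite /wave_int scale0r (_ : (fun x => _) = (fun x => g (- b) * f x)).
    rewrite rnintZ ?moments_rn_rnint ?mulr0//; split; first exact: rf.1.
    exact: rf.2.
  apply/funext => x; rewrite mulrC; congr (g _ * _).
  by rewrite /edot big1 ?sub0r// => j _; rewrite mxE mulr0.
have [c] := MVT_segment th0 (fun s _ => dpsi s)
  (continuous_subspaceT (derivable_continuousR (fun s => @ex_derive _ _ _ _ _ _ _ (dpsi s)))).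
rewrite in_itv /= => /andP[c0 cth]; rewrite H0 !subr0 => ->.
rewrite normrM mulrA (ger0_norm th0).
apply: (@le_trans _ _ ((1 + `|b|) ^+ r * `|psi c|)).
  by rewrite ler_piMr// mulr_ge0 ?exprn_ge0 ?addr_ge0.
by apply: bpsi; rewrite c0 (le_trans cth).
Qed.
End Estimates.

(** * Weighted estimate over the sphere, uniform in the scale *)

Section SphereEstimate.
Context {R : realType} {n : nat}.
Implicit Types (f : 'rV[R]_n -> R) (g : R -> R) (w x u : 'rV[R]_n) (a b : R) (i j : 'I_n).

Definition S0_line g := schwartz_line g /\ moments_line g.

Lemma sphere_coord_le1 u j : edot u u = 1 -> `|u 0 j| <= 1.
Proof.
move=> u1; rewrite -(@ler_pXn2r _ 2)// ?nnegrE// expr1n real_normK ?num_real// -u1 expr2.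
by rewrite /edot (bigD1 j)//= lerDl sumr_ge0// => k _; rewrite -expr2 sqr_ge0.
Qed.

(** If every [|u_i|] were below [1/n], then [sum u_i^2 <= sum |u_i| < 1]. The chosen coordinate
    keeps the division by [u_i] in the integration by parts under uniform control. *)
Lemma sphere_big_coord u : edot u u = 1 -> exists i, 1 <= n%:R * `|u 0 i|.
Proof.
move=> u1; apply/not_existsP => H0.
have : edot u u < 1.
  rewrite /edot; case: (posnP n) => [n0|n0].
    by rewrite big1// => -[k kn]; exfalso; rewrite n0 in kn.
  apply: (@lt_le_trans _ _ (\sum_(k < n) n%:R^-1)); last first.
    by rewrite sumr_const card_ord -[leLHS]mulr_natr mulVf// pnatr_eq0 -lt0n.
  apply: ltr_sum => [|k _].
    by apply/hasP; exists (Ordinal n0); rewrite ?mem_index_enum.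
  have /negP := H0 k; rewrite -ltNge -ltr_pdivlMl ?ltr0n// mulr1 => hk.
  apply: le_lt_trans hk; rewrite -expr2 -[X in X <= _]real_normK ?num_real// expr2.
  by rewrite ler_piMr// sphere_coord_le1.
by rewrite u1 ltxx.
Qed.

(** For [a <= 1], [s+1] integrations by parts compensate [a^-s] and the prefactor [1/a]. For
    [a >= 1], [s+r] orders of vanishing compensate [a^s] and the [a^r] lost in passing from the
    weight in [b/a] to the weight in [b]. [N] and [K] are large enough for both regimes, and [C] is
    the sum of their constants. *)
Lemma wave_int_sphere_estimate (s r : nat) : exists C N K, 0 <= C /\
  forall f g A B, S0_real f -> S0_line g -> (forall i, bound_along i N K f A) -> bound_line N K g B ->
  forall u b a, edot u u = 1 -> 0 < a ->
  (a ^+ s + (a ^+ s)^-1) * (1 + `|b|) ^+ r * `|a^-1 * wave_int f g (a^-1 *: u) (b / a)| <= C * A * B.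
Proof.
exists (2 * @wint R n * (@cauchyint R ^+ s.+1 * n%:R ^+ s.+1 + n%:R ^+ (s + r))).
exists (2 * n + r + (s + r) + 2 * s.+1)%N, (s.+1 + r)%N; split.
  by rewrite !mulr_ge0 ?addr_ge0 ?mulr_ge0 ?exprn_ge0 ?wint_ge0 ?cauchyint_ge0.
move=> f g A B [rf hf mf] [hg mg] hA hB u b a u1 a0.
have [i hi] := sphere_big_coord u1.
have A0 := bound_along_ge0 (hA i); have B0 := bound_line_ge0 hB.
have uj j : `|u 0 j| <= 1 by exact: sphere_coord_le1.
have ui : 0 < `|u 0 i|.
  rewrite lt_neqAle normr_ge0 andbT eq_sym; apply/eqP => u0.
  by move: hi; rewrite u0 mulr0 ler10.
have w0 := @wint_ge0 R n; have c0 := @cauchyint_ge0 R.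
have as0 : 0 < a ^+ s by rewrite exprn_gt0.
rewrite normrM normfV (gtr0_norm a0).
set h := `|wave_int _ _ _ _|; have h0 : 0 <= h by rewrite /h.
have [a1|a1] := leP a 1.
  have hs : h * (1 + `|b|) ^+ r <= A * (B * cauchyint ^+ s.+1) * @wint R n * (a / `|u 0 i|) ^+ s.+1.
    rewrite mulrC; apply: wave_int_small => //.
    - apply: bound_alongW (hA i); clear; lia.
    - apply: bound_lineW hB; clear; lia.
    - by rewrite -normr_gt0.
    - by rewrite a0.
  apply: (@le_trans _ _ ((2 * (a ^+ s)^-1) * a^-1 * (A * (B * cauchyint ^+ s.+1) * @wint R n * (a / `|u 0 i|) ^+ s.+1))).
    rewrite (_ : _ * _ * (_ * h) = (a ^+ s + (a ^+ s)^-1) * a^-1 * (h * (1 + `|b|) ^+ r)); last by ring.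
    apply: ler_pM => //.
    - by rewrite mulr_ge0 ?invr_ge0 ?addr_ge0 ?invr_ge0 ?ltW.
    - by rewrite mulr_ge0 ?exprn_ge0 ?addr_ge0.
    - have h2 : a ^+ s <= (a ^+ s)^-1.
        apply: (@le_trans _ _ 1); first by rewrite exprn_ile1// ltW.
        by rewrite invf_ge1// exprn_ile1// ltW.
      apply: ler_wpM2r; first by rewrite invr_ge0 ltW.
      by lra.
  have -> : 2 * (a ^+ s)^-1 * a^-1 * (A * (B * cauchyint ^+ s.+1) * @wint R n * (a / `|u 0 i|) ^+ s.+1)
     = (2 * @wint R n * (cauchyint ^+ s.+1) * A * B) * (`|u 0 i|^-1) ^+ s.+1.
    rewrite exprMn [a ^+ s.+1]exprS; field.
    by rewrite !gt_eqF.
  (* All powers of [a] have cancelled; what is left of the integrations by parts is controlled by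
     the choice of [i]. *)
  have hu : (`|u 0 i|^-1) ^+ s.+1 <= n%:R ^+ s.+1.
    rewrite lerXn2r ?nnegrE ?invr_ge0//.
    by rewrite -[leLHS]mul1r ler_pdivrMr.
  apply: (@le_trans _ _ ((2 * @wint R n * (cauchyint ^+ s.+1) * A * B) * n%:R ^+ s.+1)).
    by rewrite ler_wpM2l// !mulr_ge0 ?exprn_ge0.
  rewrite -subr_ge0 (_ : _ - _ = 2 * @wint R n * A * B * n%:R ^+ (s + r)); last by ring.
  by rewrite !mulr_ge0 ?exprn_ge0.
have ai : 0 < a^-1 by rewrite invr_gt0.
have ai1 : a^-1 <= 1 by rewrite invf_le1// ltW.
have hs : h * (1 + `|b / a|) ^+ r <= A * B * @wint R n * (n%:R * a^-1) ^+ (s + r).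
  rewrite mulrC /h -[a^-1 *: u]scale1r; apply: wave_int_big => //; last 2 first.
  - by rewrite (ltW ai) ai1.
  - by rewrite ler01 lexx.
  - apply: decayW (hA i 0%N _) => //; clear; lia.
  - apply: bound_lineW hB; clear; lia.
  - by move=> j; rewrite mxE normrM (gtr0_norm ai) ler_piMr// ltW.
(* [wave_int_big] gives decay in its own argument [b / a]; since [a >= 1],
   [1 + |b| <= a (1 + |b / a|)]. *)
have hb : (1 + `|b|) ^+ r <= a ^+ r * (1 + `|b / a|) ^+ r.
  rewrite -exprMn lerXn2r ?nnegrE ?mulr_ge0 ?addr_ge0 ?(ltW a0)//.
  rewrite normrM normfV (gtr0_norm a0) mulrDr mulr1 mulrCA divff ?gt_eqF// mulr1.
  by rewrite lerD2r ltW.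
apply: (@le_trans _ _ ((2 * a ^+ s) * a ^+ r * 1 * (A * B * @wint R n * (n%:R * a^-1) ^+ (s + r)))).
  apply: (@le_trans _ _ ((2 * a ^+ s) * (a ^+ r * (1 + `|b / a|) ^+ r) * (1 * h))).
    apply: ler_pM => //.
    - by rewrite mulr_ge0 ?exprn_ge0 ?addr_ge0 ?invr_ge0 ?(ltW as0).
    - by rewrite mulr_ge0 ?(ltW ai).
    - apply: ler_pM => //.
      + by rewrite addr_ge0 ?invr_ge0 ?(ltW as0).
      + have h2 : (a ^+ s)^-1 <= a ^+ s.
          apply: (@le_trans _ _ 1); last by rewrite exprn_ege1// ltW.
          by rewrite invf_le1// exprn_ege1// ltW.
        by lra.
    - by rewrite ler_wpM2r.
  rewrite [X in X <= _](_ : _ = 2 * a ^+ s * a ^+ r * 1 * (h * (1 + `|b / a|) ^+ r)); last by ring.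
  by rewrite ler_wpM2l// !mulr_ge0 ?exprn_ge0// ltW.
have -> : 2 * a ^+ s * a ^+ r * 1 * (A * B * @wint R n * (n%:R * a^-1) ^+ (s + r)) =
   2 * @wint R n * A * B * n%:R ^+ (s + r).
  rewrite exprMn exprVn !exprD; field.
  by rewrite !expf_neq0// gt_eqF.
rewrite -subr_ge0 (_ : _ - _ = 2 * @wint R n * A * B * (cauchyint ^+ s.+1 * n%:R ^+ s.+1)); last by ring.
by rewrite !mulr_ge0 ?exprn_ge0.
Qed.

Lemma powR_weight (b : R) (r : nat) : (1 + b ^+ 2) `^ (r%:R / 2) <= (1 + `|b|) ^+ r.
Proof.
have h0 : 0 <= 1 + `|b| by rewrite addr_ge0.
apply: (@le_trans _ _ (((1 + `|b|) ^+ 2) `^ (r%:R / 2))).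
  apply: ge0_ler_powR; rewrite ?nnegrE ?divr_ge0 ?addr_ge0 ?sqr_ge0//.
  by rewrite sqrrD expr1n real_normK ?num_real// lerD2r lerDl mulrn_wge0// mulr_ge0.
rewrite -powR_mulrn// -powRrM (_ : 2%:R * (r%:R / 2) = r%:R); last by field.
by rewrite powR_mulrn.
Qed.
End SphereEstimate.

(** * Derivatives of the transform *)

Section Expressions.
Context {R : realType} {n : nat}.
Implicit Types (f : 'rV[R]_n -> R) (g : R -> R) (a b : R) (i j : 'I_n).
Local Notation VY := ('rV[R]_n * R * R)%type.
Implicit Types (p q v : VY).

Lemma S0_line_derive1 g : S0_line g -> S0_line (derive1 g).
Proof. by case=> h1 h2; split; [exact: schwartz_line_deriv|exact: moments_line_deriv]. Qed.

Lemma S0_line_mulT g : S0_line g -> S0_line (mulT g).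
Proof. by case=> h1 h2; split; [exact: schwartz_line_mulT|exact: moments_line_mulT]. Qed.

Definition ucoord p j : R := (enorm p.1.1)^-1 * p.1.1 0 j.

Definition ridge f g p : R :=
  p.2^-1 * wave_int f g (p.2^-1 *: ((enorm p.1.1)^-1 *: p.1.1)) (p.1.2 / p.2).

(* The bilinear expressions in [(f, g)] produced by differentiating [ridge f g],
   as a syntax closed under derivation; [AppX], [AppD], [AppT] act on the
   arguments: [f -> x_j f], [g -> g'], [g -> t g]. *)
Inductive expr : Type :=
  | Base | AppX of 'I_n & expr | AppD of expr | AppT of expr
  | Add of expr & expr | Sum of ('I_n -> expr) | Cst of R & expr
  | MulU of 'I_n & expr | MulW of expr | MulA of expr.

Fixpoint eval_expr (e : expr) f g p : R :=
  match e with
  | Base => ridge f g p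
  | AppX j e => eval_expr e (mulX j f) g p
  | AppD e => eval_expr e f (derive1 g) p
  | AppT e => eval_expr e f (mulT g) p
  | Add e1 e2 => eval_expr e1 f g p + eval_expr e2 f g p
  | Sum F => \sum_j eval_expr (F j) f g p
  | Cst c e => c * eval_expr e f g p
  | MulU j e => ucoord p j * eval_expr e f g p
  | MulW e => (enorm p.1.1)^-1 * eval_expr e f g p
  | MulA e => p.2^-1 * eval_expr e f g p
  end.

(** Multiplies [e] by [v_j - u_j <u, v>], the [j]-th coordinate of the tangential projection of [v],
    which is [|w|] times the derivative of [u_j = w_j / |w|] along [v]. *)
Definition expr_ucoord_derive v j (e : expr) : expr :=
  Add (Cst (v.1.1 0 j) e) (Sum (fun i => Cst (- v.1.1 0 i) (MulU j (MulU i e)))).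

(** In the case of [Base] the four terms come from the prefactor [1/a] and from the dependence of
    the phase [(x.u - b)/a] on [u], [b] and [a]. The operations on the arguments are read from the
    outside in: [AppD (AppT Base)] puts [t g'(t)] in place of [g], as the derivative of the phase in
    [a] is [-1/a] times the phase. *)
Fixpoint expr_derive v (e : expr) : expr :=
  match e with
  | Base =>
     Add (Cst (- v.2) (MulA Base))
    (Add (Sum (fun j => MulA (MulW (expr_ucoord_derive v j (AppX j (AppD Base))))))
    (Add (Cst (- v.1.2) (MulA (AppD Base)))
         (Cst (- v.2) (MulA (AppD (AppT Base))))))
  | AppX j e => AppX j (expr_derive v e)
  | AppD e => AppD (expr_derive v e)
  | AppT e => AppT (expr_derive v e)
  | Add e1 e2 => Add (expr_derive v e1) (expr_derive v e2)
  | Sum F => Sum (fun j => expr_derive v (F j))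
  | Cst c e => Cst c (expr_derive v e)
  | MulU j e => Add (MulU j (expr_derive v e)) (MulW (expr_ucoord_derive v j e))
  | MulW e => Add (MulW (expr_derive v e)) (Sum (fun i => Cst (- v.1.1 0 i) (MulU i (MulW (MulW e)))))
  | MulA e => Add (MulA (expr_derive v e)) (Cst (- v.2) (MulA (MulA e)))
  end.

(* On the sphere [|w| = 1], so [MulW] disappears: [expr_sphere e] is the extension of
   [e] from the sphere, homogeneous of degree 0 in the first variable. *)
Fixpoint expr_sphere (e : expr) : expr :=
  match e with
  | Base => Base
  | AppX j e => AppX j (expr_sphere e)
  | AppD e => AppD (expr_sphere e)
  | AppT e => AppT (expr_sphere e)
  | Add e1 e2 => Add (expr_sphere e1) (expr_sphere e2)
  | Sum F => Sum (fun j => expr_sphere (F j))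
  | Cst c e => Cst c (expr_sphere e)
  | MulU j e => MulU j (expr_sphere e)
  | MulW e => expr_sphere e
  | MulA e => MulA (expr_sphere e)
  end.

Lemma eval_expr_expr_ucoord_derive v j e f g p :
  eval_expr (expr_ucoord_derive v j e) f g p = (v.1.1 0 j - ucoord p j * \sum_i ucoord p i * v.1.1 0 i) * eval_expr e f g p.
Proof.
rewrite /= mulrBl; congr (_ + _); rewrite -mulNr mulr_sumr -sumrN mulr_suml.
by apply: eq_bigr => i _; ring.
Qed.

Lemma enormE (x : 'rV[R]_n) : enorm x = Num.sqrt (\sum_i x 0 i ^+ 2).
Proof. by rewrite /enorm /edot; congr Num.sqrt; apply: eq_bigr => i _; rewrite expr2. Qed.

Lemma enorm_gt0 (x : 'rV[R]_n) : x != 0 -> 0 < enorm x.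
Proof.
move=> x0; rewrite enormE sqrtr_gt0 lt_neqAle sumr_ge0 ?andbT; last by move=> i _; exact: sqr_ge0.
rewrite eq_sym psumr_neq0; last by move=> i _; exact: sqr_ge0.
have [i xi] : exists i, x 0 i != 0.
  apply/not_existsP => H0; move/eqP: x0; apply; apply/rowP => i; rewrite mxE.
  by have /negP := H0 i; rewrite negbK => /eqP.
by apply/hasP; exists i; rewrite ?mem_index_enum//= exprn_even_gt0.
Qed.

Lemma enorm_sqr (x : 'rV[R]_n) : enorm x ^+ 2 = edot x x.
Proof. by rewrite /enorm sqr_sqrtr// sumr_ge0// => i _; rewrite -expr2 sqr_ge0. Qed.

Lemma edotZZ (c : R) (x : 'rV[R]_n) : edot (c *: x) (c *: x) = c ^+ 2 * edot x x.
Proof. by rewrite /edot mulr_sumr; apply: eq_bigr => i _; rewrite !mxE; ring. Qed.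

Lemma edot_unit (x : 'rV[R]_n) : x != 0 ->
  edot ((enorm x)^-1 *: x) ((enorm x)^-1 *: x) = 1.
Proof.
move=> x0; rewrite edotZZ -enorm_sqr -exprMn mulVf ?expr1n// gt_eqF//.
exact: enorm_gt0.
Qed.

Definition proj p : VY := ((enorm p.1.1)^-1 *: p.1.1, p.1.2, p.2).

Lemma enorm_proj p : Y_open R n p -> enorm (proj p).1.1 = 1.
Proof. by case=> p0 _; rewrite /enorm edot_unit// sqrtr1. Qed.

Lemma eval_expr_expr_sphere e f g p : Y_open R n p -> eval_expr (expr_sphere e) f g p = eval_expr e f g (proj p).
Proof.
move=> pY; elim: e f g => //=.
- by move=> f g; rewrite /ridge enorm_proj// invr1 scale1r.
- by move=> e1 IH1 e2 IH2 f g; rewrite IH1 IH2.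
- by move=> F IH f g; apply: eq_bigr => j _; rewrite IH.
- by move=> c e IH f g; rewrite IH.
- by move=> j e IH f g; rewrite IH /ucoord enorm_proj// invr1 mul1r mxE.
- by move=> e IH f g; rewrite IH enorm_proj// invr1 mul1r.
- by move=> e IH f g; rewrite IH.
Qed.

Lemma is_derive_comp1 (V : normedModType R) (F : V -> R) (h : R -> R) (p v : V) (d c : R) :
  is_derive p v F d -> is_derive (F p) 1 h c -> is_derive p v (h \o F) (c * d).
Proof.
move=> dF dh; apply/is_derive_lineP.
apply: (@is_derive1_comp _ h (fun t : R => F (t *: v + p))).
  by rewrite scale0r add0r.
exact/is_derive_lineP.
Qed.

Lemma is_derive_lin (V : normedModType R) (F : V -> R) (p v : V) :
  (forall (h : R), F (h *: v + p) = h * F v + F p) -> is_derive p v F (F v).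
Proof.
move=> hF; apply/is_deriveP; apply: cvg_near_cst; near=> h.
have h0 : h != 0 by near: h; exact: nbhs_dnbhs_neq.
by rewrite hF addrK mulKf.
Unshelve. all: by end_near.
Qed.

Lemma is_derive_p11 p v j : is_derive p v (fun q : VY => q.1.1 0 j) (v.1.1 0 j).
Proof. by apply: is_derive_lin => h; rewrite !mxE. Qed.
Lemma is_derive_p12 p v : is_derive p v (fun q : VY => q.1.2) v.1.2.
Proof. exact: is_derive_lin. Qed.
Lemma is_derive_p2 p v : is_derive p v (fun q : VY => q.2) v.2.
Proof. exact: is_derive_lin. Qed.

Lemma is_deriveM_mul (V : normedModType R) (F G : V -> R) (p v : V) (dF dG : R) :
  is_derive p v F dF -> is_derive p v G dG ->
  is_derive p v (fun z => F z * G z) (dF * G p + F p * dG).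
Proof.
move=> h1 h2; apply: (is_derive_eq (is_deriveM h1 h2)).
by rewrite /GRing.scale /= addrC mulrC.
Qed.

Lemma is_deriveV_inv (V : normedModType R) (F : V -> R) (p v : V) (d : R) :
  F p != 0 -> is_derive p v F d ->
  is_derive p v (fun z => (F z)^-1) (- (F p)^-1 ^+ 2 * d).
Proof.
move=> F0 [d1 <-]; split; first exact: derivableV.
by rewrite deriveV// exprVn.
Qed.

Lemma is_derive_enorm p v : p.1.1 != 0 ->
  is_derive p v (fun q : VY => enorm q.1.1) (\sum_i ucoord p i * v.1.1 0 i).
Proof.
move=> p0; have e0 := enorm_gt0 p0.
have d1 : is_derive p v (fun q : VY => edot q.1.1 q.1.1) (\sum_i 2 * (p.1.1 0 i * v.1.1 0 i)).
  have := @is_derive_sum R VY R^o n (fun i q => q.1.1 0 i * q.1.1 0 i) p v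
    (fun i => 2 * (p.1.1 0 i * v.1.1 0 i)).
  rewrite (_ : (\sum_(i < n) _) = (fun q : VY => edot q.1.1 q.1.1)); last first.
    by apply/funext => q; rewrite fct_sumE.
  apply=> i; have d := is_derive_p11 p v i.
  apply: (is_derive_eq (is_deriveM_mul d d)); ring.
have s0 : 0 < edot p.1.1 p.1.1 by rewrite -enorm_sqr exprn_gt0.
apply: (is_derive_eq (is_derive_comp1 d1 (is_derive1_sqrt s0))).
rewrite -/(enorm _) mulr_sumr; apply: eq_bigr => i _; rewrite /ucoord.
by field; rewrite gt_eqF.
Qed.

Lemma is_derive_enormV p v : p.1.1 != 0 ->
  is_derive p v (fun q : VY => (enorm q.1.1)^-1)
    (- ((enorm p.1.1)^-1 ^+ 2) * \sum_i ucoord p i * v.1.1 0 i).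
Proof.
move=> p0; apply: (@is_deriveV_inv _ (fun q : VY => enorm q.1.1)); last exact: is_derive_enorm.
by rewrite gt_eqF// enorm_gt0.
Qed.

Lemma is_derive_ucoord p v j : p.1.1 != 0 ->
  is_derive p v (ucoord ^~ j)
    ((enorm p.1.1)^-1 * (v.1.1 0 j - ucoord p j * \sum_i ucoord p i * v.1.1 0 i)).
Proof.
move=> p0; apply: (is_derive_eq (is_deriveM_mul (is_derive_enormV v p0) (is_derive_p11 p v j))).
rewrite /=; set S := \sum_i _; rewrite /ucoord; ring.
Qed.

Lemma is_derive_p2V p v : 0 < p.2 -> is_derive p v (fun q : VY => q.2^-1) (- v.2 * (p.2^-1 * p.2^-1)).
Proof.
move=> p0; have p20 : p.2 != 0 by rewrite gt_eqF.
apply: (is_derive_eq (@is_deriveV_inv _ (fun q : VY => q.2) p v _ p20 (is_derive_p2 p v))).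
by ring.
Qed.

(** The factor [t = x.w - b] is expanded under the integral. Read backwards with [g'] for [g], it
    collects the terms that differentiation in [a] produces through [w = u/a] and [b/a] into one
    term. *)
Lemma wave_int_mulT f g (w : 'rV[R]_n) b : rapid f -> schwartz_line g ->
  wave_int f (mulT g) w b = \sum_j w 0 j * wave_int (mulX j f) g w b - b * wave_int f g w b.
Proof.
move=> rf hg; have l1 j := L1Z (w 0 j) (L1_wave_int w b (rapid_mulX j rf) hg).
have l2 := L1_sum (index_enum 'I_n) l1; have l3 := L1_wave_int w b rf hg.
transitivity (rnint (fun x => \sum_j w 0 j * (mulX j f x * g (edot x w - b)) +
    (- b) * (f x * g (edot x w - b)))).
  congr rnint; apply/funext => x; rewrite /mulT /mulX.
  rewrite (eq_bigr (fun j => (x 0 j * w 0 j) * (f x * g (edot x w - b)))); last first.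
    by move=> j _; ring.
  by rewrite -mulr_suml -/(edot x w); ring.
rewrite (rnintD l2 (L1Z (- b) l3)) (rnintZ _ l3) (rnint_sum (index_enum 'I_n) l1) mulNr.
congr (_ - _); apply: eq_bigr => j _.
by rewrite (rnintZ _ (L1_wave_int w b (rapid_mulX j rf) hg)).
Qed.

Lemma is_derive_ridge f g p v : S0_real f -> S0_line g -> Y_open R n p ->
  is_derive p v (ridge f g) (eval_expr (expr_derive v Base) f g p).
Proof.
move=> [rf _ _] [hg _] [p0 a0].
have dA := is_derive_p2V v a0.
pose T j := v.1.1 0 j - ucoord p j * \sum_i ucoord p i * v.1.1 0 i.
pose w := p.2^-1 *: ((enorm p.1.1)^-1 *: p.1.1).
pose dw j := - v.2 * (p.2^-1 * p.2^-1) * ucoord p j + p.2^-1 * ((enorm p.1.1)^-1 * T j).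
pose db := v.1.2 * p.2^-1 + p.1.2 * (- v.2 * (p.2^-1 * p.2^-1)).
have dW j : is_derive p v (fun q : VY => (q.2^-1 *: ((enorm q.1.1)^-1 *: q.1.1)) 0 j) (dw j).
  under eq_fun do rewrite !mxE.
  exact: is_deriveM_mul dA (is_derive_ucoord v j p0).
have dB : is_derive p v (fun q : VY => q.1.2 / q.2) db.
  exact: is_deriveM_mul (is_derive_p12 p v) dA.
have dR := wave_int_is_derive rf hg dW dB.
apply: (is_derive_eq (is_deriveM_mul dA dR)).
have hg' := schwartz_line_deriv hg.
rewrite -/w /wave_int_diff [RHS]/= -/(expr_ucoord_derive _ _ _) /ridge -/w (wave_int_mulT _ _ rf hg').
pose h j := wave_int (mulX j f) (derive1 g) w (p.1.2 / p.2).
under [X in _ = _ + (X + _)]eq_bigr => j _ do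
  rewrite -[X in _ * (_ * X)]/(eval_expr (expr_ucoord_derive v j (AppX j (AppD Base))) f g p) eval_expr_expr_ucoord_derive /= /ridge -/w -/(T j) -/(h j).
rewrite (eq_bigr (fun j => - v.2 * p.2^-1 * (w 0 j * h j) +
    p.2^-1 * ((enorm p.1.1)^-1 * (T j * h j)))); last first.
  by move=> j _; rewrite /dw /w !mxE -/(ucoord p j) /h; ring.
rewrite [X in _ = _ + (X + _)](eq_bigr (fun j => p.2^-1 * (p.2^-1 * ((enorm p.1.1)^-1 * (T j * h j))))); last first.
  by move=> j _; ring.
rewrite big_split /= -!mulr_sumr /db.
(* After separating the radial part [S1], due to the scale, from the tangential part [S2], the two
   sides agree as polynomials. *)
set S1 := \sum_j w 0 j * h j; set S2 := \sum_j _; ring.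
Qed.

Lemma eval_expr_is_derive e f g p v : S0_real f -> S0_line g -> Y_open R n p ->
  is_derive p v (eval_expr e f g) (eval_expr (expr_derive v e) f g p).
Proof.
move=> + + pY; have [p0 a0] := pY.
elim: e f g => [|j e IH|e IH|e IH|e1 IH1 e2 IH2|F IH|c e IH|j e IH|e IH|e IH] f g hf hg.
- exact: is_derive_ridge.
- by apply: IH => //; exact: S0_real_mulX.
- by apply: IH => //; exact: S0_line_derive1.
- by apply: IH => //; exact: S0_line_mulT.
- exact: (is_deriveD (IH1 f g hf hg) (IH2 f g hf hg)).
- have := @is_derive_sum R VY R^o n (fun j => eval_expr (F j) f g) p v
    (fun j => eval_expr (expr_derive v (F j)) f g p) (fun j => IH j f g hf hg).
  rewrite (_ : (\sum_(i < n) _) = eval_expr (Sum F) f g)//.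
  by apply/funext => q; rewrite fct_sumE.
- exact: (is_deriveZ c (IH f g hf hg)).
- apply: (is_derive_eq (is_deriveM_mul (is_derive_ucoord v j p0) (IH f g hf hg))).
  rewrite [RHS]/= -[X in _ = _ + _ * X]/(eval_expr (expr_ucoord_derive v j e) f g p) eval_expr_expr_ucoord_derive addrC.
  by congr (_ + _); ring.
- apply: (is_derive_eq (is_deriveM_mul (is_derive_enormV v p0) (IH f g hf hg))).
  rewrite [RHS]/= addrC; congr (_ + _).
  rewrite mulrAC mulr_sumr; apply: eq_bigr => i _; ring.
- apply: (is_derive_eq (is_deriveM_mul (is_derive_p2V v a0) (IH f g hf hg))).
  by rewrite [RHS]/= addrC; congr (_ + _); ring.
Qed.

Lemma enorm_continuous p : {for p, continuous (fun q : VY => enorm q.1.1)}.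
Proof.
apply: (@continuous_comp _ _ _ (fun q : VY => edot q.1.1 q.1.1) Num.sqrt); last exact: sqrt_continuous.
have c i : {for p, continuous (fun q : VY => q.1.1 0 i)}.
  apply: (@continuous_comp _ _ _ (fun q : VY => q.1.1) (fun x : 'rV[R]_n => x 0 i)); last exact: coord_continuous.
  apply: (@continuous_comp _ _ _ (fun q : VY => q.1) fst); exact: cvg_fst.
apply: (@cvg_big R^o _ +%R 0 xpredT) => [|i _]; first exact: (@add_continuous R^o).
exact: (cvgM (c i) (c i)).
Qed.

End Expressions.

(** * Continuity and weighted bounds for expressions *)

Section ExpressionEstimates.
Context {R : realType} {n : nat}.
Implicit Types (f : 'rV[R]_n -> R) (g : R -> R) (a b : R) (i j : 'I_n).
Local Notation VY := ('rV[R]_n * R * R)%type.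
Implicit Types (p q v : VY) (e : @expr R n).

Lemma continuous_p2 p : {for p, continuous (fun q : VY => q.2)}.
Proof. exact: cvg_snd. Qed.

Lemma continuous_p12 p : {for p, continuous (fun q : VY => q.1.2)}.
Proof. apply: (@continuous_comp _ _ _ (fun q : VY => q.1) snd); [exact: cvg_fst|exact: cvg_snd]. Qed.

Lemma continuous_p11 p i : {for p, continuous (fun q : VY => q.1.1 0 i)}.
Proof.
apply: (@continuous_comp _ _ _ (fun q : VY => q.1.1) (fun x : 'rV[R]_n => x 0 i)); last exact: coord_continuous.
apply: (@continuous_comp _ _ _ (fun q : VY => q.1) fst); exact: cvg_fst.
Qed.

Lemma continuous_enormV p : p.1.1 != 0 -> {for p, continuous (fun q : VY => (enorm q.1.1)^-1)}.
Proof. by move=> p0; apply: cvgV; [rewrite gt_eqF// enorm_gt0|exact: enorm_continuous]. Qed.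

Lemma continuous_ucoord p j : p.1.1 != 0 -> {for p, continuous (ucoord ^~ j : VY -> R)}.
Proof.
by move=> p0; have h := cvgM (continuous_enormV p0) (@continuous_p11 p j); exact: h.
Qed.

Lemma continuous_p2V p : 0 < p.2 -> {for p, continuous (fun q : VY => q.2^-1)}.
Proof. by move=> a0; apply: cvgV; [rewrite gt_eqF|exact: continuous_p2]. Qed.

Lemma eval_expr_continuous e f g p : S0_real f -> S0_line g -> Y_open R n p -> {for p, continuous (eval_expr e f g)}.
Proof.
move=> + + pY; have [p0 a0] := pY.
elim: e f g => [|j e IH|e IH|e IH|e1 IH1 e2 IH2|F IH|c e IH|j e IH|e IH|e IH] f g hf hg.
- have [rf _ _] := hf; have [cg _] := hg.
  apply: (cvgM (continuous_p2V a0)).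
  apply: (@wave_int_continuous R n VY f g (fun q => q.2^-1 *: ((enorm q.1.1)^-1 *: q.1.1)) (fun q => q.1.2 / q.2) p) => //.
    move=> j; rewrite (_ : (fun q : VY => _ 0 j) = (fun q : VY => q.2^-1 * ucoord q j)).
      by have h := cvgM (continuous_p2V a0) (@continuous_ucoord p j p0); exact: h.
    by apply/funext => q; rewrite !mxE.
  by have h := cvgM (@continuous_p12 p) (continuous_p2V a0); exact: h.
- by apply: IH => //; exact: S0_real_mulX.
- by apply: IH => //; exact: S0_line_derive1.
- by apply: IH => //; exact: S0_line_mulT.
- exact: (cvgD (IH1 f g hf hg) (IH2 f g hf hg)).
- apply: (@cvg_big R^o _ +%R 0 xpredT) => [|i _]; first exact: (@add_continuous R^o).
  exact: IH.
- exact: (cvgM (cvg_cst c) (IH f g hf hg)).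
- exact: (cvgM (@continuous_ucoord p j p0) (IH f g hf hg)).
- exact: (cvgM (continuous_enormV p0) (IH f g hf hg)).
- exact: (cvgM (continuous_p2V a0) (IH f g hf hg)).
Qed.

(** The constants precede [f] and [g], and the bound is bilinear in [A] and [B]; continuity of the
    transform in the pair depends on both features. Points are restricted to the sphere, where
    [MulW] has no effect and [MulU] does not increase absolute values. *)
Definition eval_expr_bounded e (s r : nat) := exists C N K, 0 <= C /\
  forall f g A B, S0_real f -> S0_line g -> (forall i, bound_along i N K f A) -> bound_line N K g B ->
  forall p, edot p.1.1 p.1.1 = 1 -> 0 < p.2 ->
  (p.2 ^+ s + (p.2 ^+ s)^-1) * (1 + `|p.1.2|) ^+ r * `|eval_expr e f g p| <= C * A * B.

Lemma weight_ge0 p (s r : nat) : 0 < p.2 ->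
  0 <= (p.2 ^+ s + (p.2 ^+ s)^-1) * (1 + `|p.1.2|) ^+ r.
Proof.
move=> a0; rewrite mulr_ge0 ?exprn_ge0 ?addr_ge0 ?invr_ge0 ?exprn_ge0 ?(ltW a0)//.
Qed.

(** A factor [1/a] is paid for by passing from [s] to [s+1]: it raises the power of [1/a] in the
    second term, and in the first it is at most [a] when [a >= 1], while for [a <= 1] that term is
    dominated by the new second one. *)
Lemma weight_V a (s : nat) : 0 < a ->
  (a ^+ s + (a ^+ s)^-1) * a^-1 <= 2 * (a ^+ s.+1 + (a ^+ s.+1)^-1).
Proof.
move=> a0; have ai : 0 < a^-1 by rewrite invr_gt0.
have h0 : 0 < a ^+ s.+1 by rewrite exprn_gt0.
have h1 : 0 < (a ^+ s.+1)^-1 by rewrite invr_gt0.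
rewrite mulrDl (_ : (a ^+ s)^-1 * a^-1 = (a ^+ s.+1)^-1); last by rewrite exprSr invfM.
have [a1|a1] := leP a 1.
  suff : a ^+ s * a^-1 <= (a ^+ s.+1)^-1 by move=> h; lra.
  rewrite exprSr invfM ler_wpM2r ?(ltW ai)//.
  have h2 : 0 < a ^+ s by rewrite exprn_gt0.
  apply: (@le_trans _ _ 1); first by rewrite exprn_ile1// ltW.
  by rewrite invf_ge1// exprn_ile1// ltW.
suff : a ^+ s * a^-1 <= a ^+ s.+1 by move=> h; lra.
rewrite exprSr ler_wpM2l ?exprn_ge0 ?(ltW a0)//.
by rewrite (le_trans _ (ltW a1))// invf_le1// ltW.
Qed.

(** Induction on the expression with [s] free, because of [MulA]. Operations on the arguments change
    only the orders [N], [K] and, for multiplication by a variable, bring in the Leibniz factor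
    [K+1]. *)
Lemma eval_expr_estimate e (s r : nat) : eval_expr_bounded e s r.
Proof.
elim: e s r => [|j e IH|e IH|e IH|e1 IH1 e2 IH2|F IH|c e IH|j e IH|e IH|e IH] s r.
- have [C [N [K [C0 h]]]] := @wave_int_sphere_estimate R n s r.
  exists C, N, K; split=> // f g A B hf hg hA hB p p1 a0.
  have e1 : enorm p.1.1 = 1 by rewrite /enorm p1 sqrtr1.
  by rewrite /= /ridge e1 invr1 scale1r; exact: h hA hB _ _ _ p1 a0.
- have [C [N [K [C0 h]]]] := IH s r.
  exists (C * K.+1%:R), N.+1, K; split=> [|f g A B hf hg hA hB p p1 a0].
    by rewrite mulr_ge0.
  rewrite -[C * _ * A]mulrA; apply: h => //; first exact: S0_real_mulX.
    by move=> i; have [_ hc _] := hf; exact: bound_along_mulX.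
  exact: bound_lineW hB.
- have [C [N [K [C0 h]]]] := IH s r.
  exists C, N, K.+1; split=> // f g A B hf hg hA hB p p1 a0.
  apply: h => //; first exact: S0_line_derive1.
    by move=> i; apply: bound_alongW (hA i).
  exact: bound_line_deriv.
- have [C [N [K [C0 h]]]] := IH s r.
  exists (C * K.+1%:R), N.+1, K; split=> [|f g A B hf hg hA hB p p1 a0].
    by rewrite mulr_ge0.
  rewrite (_ : C * _ * A * B = C * A * (K.+1%:R * B)); last by ring.
  apply: h => //; first exact: S0_line_mulT.
    by move=> i; apply: bound_alongW (hA i).
  by apply: bound_line_mulT hB; case: hg.
- have [C1 [N1 [K1 [C10 h1]]]] := IH1 s r.
  have [C2 [N2 [K2 [C20 h2]]]] := IH2 s r.
  exists (C1 + C2), (maxn N1 N2), (maxn K1 K2); split=> [|f g A B hf hg hA hB p p1 a0].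
    by rewrite addr_ge0.
  have q1 := h1 f g A B hf hg (fun i => bound_alongW (leq_maxl _ _) (leq_maxl _ _) (hA i))
     (bound_lineW (leq_maxl _ _) (leq_maxl _ _) hB) p p1 a0.
  have q2 := h2 f g A B hf hg (fun i => bound_alongW (leq_maxr _ _) (leq_maxr _ _) (hA i))
     (bound_lineW (leq_maxr _ _) (leq_maxr _ _) hB) p p1 a0.
  rewrite [X in _ <= X](_ : _ = C1 * A * B + C2 * A * B); last by ring.
  apply: (le_trans _ (lerD q1 q2)); rewrite -mulrDr.
  by rewrite ler_wpM2l ?weight_ge0// ler_normD.
(* The summands come with their own constants, so these are chosen as functions of [j], then summed
   for [C] and maximised for [N] and [K]. *)
- have /choice[C hC] : forall j, exists C, exists N K, 0 <= C /\
  forall f g A B, S0_real f -> S0_line g -> (forall i, bound_along i N K f A) -> bound_line N K g B ->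
  forall p, edot p.1.1 p.1.1 = 1 -> 0 < p.2 ->
  (p.2 ^+ s + (p.2 ^+ s)^-1) * (1 + `|p.1.2|) ^+ r * `|eval_expr (F j) f g p| <= C * A * B.
    by move=> j; exact: IH.
  have /choice[N hN] := hC; have /choice[K hK] := hN.
  exists (\sum_j C j), (\max_j N j), (\max_j K j); split=> [|f g A B hf hg hA hB p p1 a0].
    by apply: sumr_ge0 => j _; have [] := hK j.
  rewrite -!mulrA !mulr_suml; apply: (@le_trans _ _ (\sum_j ((p.2 ^+ s + (p.2 ^+ s)^-1) * (1 + `|p.1.2|) ^+ r * `|eval_expr (F j) f g p|))).
    rewrite -mulr_sumr mulrA ler_wpM2l ?weight_ge0//; exact: ler_norm_sum.
  apply: ler_sum => j _; rewrite mulrA; have [_ h] := hK j; apply: h => //.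
    by move=> i; apply: bound_alongW (hA i); exact: leq_bigmax.
  by apply: bound_lineW hB; exact: leq_bigmax.
- have [C [N [K [C0 h]]]] := IH s r.
  exists (`|c| * C), N, K; split=> [|f g A B hf hg hA hB p p1 a0]; first by rewrite mulr_ge0.
  rewrite /= normrM mulrCA [X in _ <= X](_ : _ = `|c| * (C * A * B)); last by ring.
  by rewrite ler_wpM2l//; exact: h.
- have [C [N [K [C0 h]]]] := IH s r.
  exists C, N, K; split=> // f g A B hf hg hA hB p p1 a0.
  have e1 : enorm p.1.1 = 1 by rewrite /enorm p1 sqrtr1.
  apply: (le_trans _ (h f g A B hf hg hA hB p p1 a0)).
  rewrite ler_wpM2l ?weight_ge0// /= normrM /ucoord e1 invr1 mul1r ler_piMl//.
  exact: sphere_coord_le1.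
- have [C [N [K [C0 h]]]] := IH s r.
  exists C, N, K; split=> // f g A B hf hg hA hB p p1 a0.
  have e1 : enorm p.1.1 = 1 by rewrite /enorm p1 sqrtr1.
  by rewrite /= e1 invr1 mul1r; exact: h.
- have [C [N [K [C0 h]]]] := IH s.+1 r.
  exists (2 * C), N, K; split=> [|f g A B hf hg hA hB p p1 a0]; first by rewrite mulr_ge0.
  have q := h f g A B hf hg hA hB p p1 a0.
  rewrite /= normrM normfV (gtr0_norm a0).
  apply: (@le_trans _ _ (2 * ((p.2 ^+ s.+1 + (p.2 ^+ s.+1)^-1) * (1 + `|p.1.2|) ^+ r * `|eval_expr e f g p|))).
    rewrite (_ : _ * _ * (_ * _) = (p.2 ^+ s + (p.2 ^+ s)^-1) * p.2^-1 * ((1 + `|p.1.2|) ^+ r * `|eval_expr e f g p|)); last by ring.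
    rewrite -[X in 2 * X]mulrA [X in _ <= X]mulrA.
    by rewrite ler_wpM2r ?weight_V// mulr_ge0// exprn_ge0// addr_ge0.
  rewrite [X in _ <= X](_ : _ = 2 * (C * A * B)); last by ring.
  by rewrite ler_wpM2l.
Qed.

End ExpressionEstimates.

(** * Real and imaginary parts *)

Section Bridge.
Context {R : realType} {n : nat}.
Implicit Types (f : 'rV[R]_n -> R) (F : 'rV[R]_n -> R[i]) (x : 'rV[R]_n) (i j : 'I_n).

(** [wt x] is the sum of the [n+1] terms [1] and [|x_j|], one of which is at least the average. So
    powers of [wt] are controlled by the constant monomial and pure powers of single coordinates. *)
Lemma wt_cases x : wt x <= n.+1%:R \/ exists j, wt x <= n.+1%:R * `|x 0 j|.
Proof.
apply: contrapT => /not_orP[/negP h0 h1].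
have n0 : (0 : R) < n.+1%:R by rewrite ltr0n.
rewrite -ltNge in h0.
have hx j : `|x 0 j| <= wt x / n.+1%:R.
  rewrite ler_pdivlMr// mulrC; apply: ltW; rewrite ltNge; apply/negP => h.
  by apply: h1; exists j.
have : wt x < wt x; last by rewrite ltxx.
rewrite [X in X < _]/wt.
apply: (@lt_le_trans _ _ (wt x / n.+1%:R + \sum_(j < n) wt x / n.+1%:R)).
  apply: ltr_leD; first by rewrite ltr_pdivlMr// mul1r.
  by apply: ler_sum => j _; exact: hx.
by rewrite sumr_const card_ord -mulrS -[X in X <= _]mulr_natr mulfVK//.
Qed.

(** Multi-indices supported on at most one coordinate; [None] is the zero index. They form the
    finite family of weights supplied by [wt_cases]. *)
Definition pure (N : nat) (o : option 'I_n) : multi_index n :=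
  fun l => if o == Some l then N else 0%N.

Lemma monomial_pure_None N x : monomial (pure N None) x = 1.
Proof. by rewrite /monomial big1. Qed.

Lemma monomial_pure_Some N j x : monomial (pure N (Some j)) x = x 0 j ^+ N.
Proof.
rewrite /monomial (bigD1 j)//= /pure eqxx big1 ?mulr1// => l lj.
by rewrite (_ : (Some j == Some l) = false)// -[RHS](negbTE lj) eq_sym.
Qed.

Lemma multi_derive_pure k i F :
  multi_derive (pure k (Some i)) F = iter k (cderive (basis_row i : 'rV[R]_n)) F.
Proof.
rewrite /multi_derive.
have aux (s : seq 'I_n) : uniq s ->
  foldr (fun l G => iter (pure k (Some i) l) (cderive (delta_mx 0 l : 'rV[R]_n)) G) F s =
  if i \in s then iter k (cderive (basis_row i : 'rV[R]_n)) F else F.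
  elim: s => //= l s IH /andP[ls us]; rewrite IH// in_cons.
  have [il|il] := eqVneq i l.
    by subst l; rewrite /pure eqxx (negbTE ls).
  by rewrite /pure (_ : (Some i == Some l) = false)// -[RHS](negbTE il).
by rewrite aux ?enum_uniq// mem_enum.
Qed.

Lemma Re_iter_cderive k i F :
  (fun x => complex.Re (iter k (cderive (basis_row i : 'rV[R]_n)) F x)) =
  pure_derive i k (fun x => complex.Re (F x)).
Proof. by elim: k => //= k <-. Qed.

Lemma Im_iter_cderive k i F :
  (fun x => complex.Im (iter k (cderive (basis_row i : 'rV[R]_n)) F x)) =
  pure_derive i k (fun x => complex.Im (F x)).
Proof. by elim: k => //= k <-. Qed.

Lemma Re_le_normc (z : R[i]) : `|complex.Re z| <= Normc.normc z.
Proof.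
case: z => a b /=; rewrite -sqrtr_sqr ler_wsqrtr// lerDl sqr_ge0//.
Qed.

Lemma Im_le_normc (z : R[i]) : `|complex.Im z| <= Normc.normc z.
Proof.
case: z => a b /=; rewrite -sqrtr_sqr ler_wsqrtr// lerDr sqr_ge0//.
Qed.

Lemma normc_le (z : R[i]) : Normc.normc z <= `|complex.Re z| + `|complex.Im z|.
Proof.
case: z => a b /=; rewrite -[leRHS]ger0_norm ?addr_ge0// -sqrtr_sqr ler_wsqrtr//.
rewrite sqrrD !real_normK ?num_real// lerD2r lerDl mulrn_wge0// mulr_ge0//.
Qed.

Lemma seminorm_decay N k i F (s : R) :
  (forall o, (schwartz_seminorm (pure N o, pure k (Some i)) F <= s%:E)%E) ->
  decay N (pure_derive i k (fun x => complex.Re (F x))) (n.+1%:R ^+ N * s) /\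
  decay N (pure_derive i k (fun x => complex.Im (F x))) (n.+1%:R ^+ N * s).
Proof.
move=> hs.
have hx o x : `|monomial (pure N o) x| * Normc.normc (iter k (cderive (basis_row i : 'rV[R]_n)) F x) <= s.
  rewrite -lee_fin; apply: le_trans (hs o); rewrite /schwartz_seminorm/= multi_derive_pure.
  by apply: ereal_sup_ubound; exists x.
have n0 : (0 : R) <= n.+1%:R by rewrite ler0n.
have key (r : R) x : `|r| <= Normc.normc (iter k (cderive (basis_row i : 'rV[R]_n)) F x) ->
   wt x ^+ N * `|r| <= n.+1%:R ^+ N * s.
  move=> hr; have [hw|[j hw]] := wt_cases x.
    apply: (@le_trans _ _ (n.+1%:R ^+ N * `|r|)).
      by rewrite ler_wpM2r// lerXn2r ?nnegrE ?wt_ge0.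
    rewrite ler_wpM2l ?exprn_ge0//; apply: (le_trans hr).
    by have := hx None x; rewrite monomial_pure_None normr1 mul1r.
  apply: (@le_trans _ _ (n.+1%:R ^+ N * (`|x 0 j| ^+ N * `|r|))).
    rewrite mulrA -exprMn ler_wpM2r// lerXn2r ?nnegrE ?wt_ge0 ?mulr_ge0//.
  rewrite ler_wpM2l ?exprn_ge0//.
  apply: le_trans (hx (Some j) x); rewrite monomial_pure_Some normrX.
  by rewrite ler_wpM2l// exprn_ge0.
rewrite -Re_iter_cderive -Im_iter_cderive.
split=> x; apply: key; [exact: Re_le_normc|exact: Im_le_normc].
Qed.

Definition S0_prop F := schwartz R n F /\ forall m : multi_index n,
  rn_integral (fun x => (monomial m x)%:C%C * F x) = 0.

Lemma smooth_schwartz_along i f : smooth_on setT f -> (forall k N, exists C, decay N (pure_derive i k f) C) ->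
  schwartz_along i f.
Proof.
move=> sf hd k; have E : pure_derive i k f = iter_derive (nseq k (basis_row i)) f.
  by elim: k => //= k ->.
split=> //.
- by move=> x; rewrite E; have [] := sf (nseq k (basis_row i)) x I.
- by move=> x; rewrite E; have [_ ] := sf (nseq k (basis_row i)) x I; apply.
Qed.

Lemma S0_prop_decay F i k N : S0_prop F -> exists C,
  decay N (pure_derive i k (fun x => complex.Re (F x))) C /\
  decay N (pure_derive i k (fun x => complex.Im (F x))) C.
Proof.
move=> [[_ hs] _].
pose s (o : option 'I_n) : R := fine (schwartz_seminorm (pure N o, pure k (Some i)) F).
exists (n.+1%:R ^+ N * (\sum_o s o)).
have s0 o : (0 <= schwartz_seminorm (pure N o, pure k (Some i)) F)%E.
  apply: (@le_trans _ _ (`|monomial (pure N o) (0 : 'rV[R]_n)| *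
    Normc.normc (multi_derive (pure k (Some i)) F (0 : 'rV[R]_n)))%:E).
    rewrite lee_fin mulr_ge0//; exact: le_trans (Re_le_normc _).
  by apply: ereal_sup_ubound; exists 0.
apply: seminorm_decay => o.
rewrite -[X in (X <= _)%E]fineK; last by rewrite ge0_fin_numE.
rewrite lee_fin -/(s o) (bigD1 o)//= lerDl sumr_ge0// => o' _.
by rewrite fine_ge0.
Qed.

Lemma S0_prop_S0_real F : (0 < n)%N -> S0_prop F ->
  S0_real (fun x => complex.Re (F x)) /\ S0_real (fun x => complex.Im (F x)).
Proof.
move=> n0 hF; have [[[sRe sIm] _] hm] := hF.
have c1 i : schwartz_along i (fun x => complex.Re (F x)).
  by apply: smooth_schwartz_along => // k N; have [C []] := S0_prop_decay i k N hF; exists C.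
have c2 i : schwartz_along i (fun x => complex.Im (F x)).
  by apply: smooth_schwartz_along => // k N; have [C []] := S0_prop_decay i k N hF; exists C.
have E m : rnint (fun x => monomial m x * complex.Re (F x)) = 0 /\
           rnint (fun x => monomial m x * complex.Im (F x)) = 0.
  have := hm m; rewrite /rn_integral => -[e1 e2]; split.
    rewrite -[RHS]e1; congr Rintegral; apply/funext => t.
    by case: (F _) => a b /=; rewrite mul0r subr0.
  rewrite -[RHS]e2; congr Rintegral; apply/funext => t.
  by case: (F _) => a b /=; rewrite mul0r addr0.
split; split => //; try by [exact: (schwartz_along_rapid (c1 (Ordinal n0)))|exact: (schwartz_along_rapid (c2 (Ordinal n0)))].
  by move=> m; have [] := E m.
by move=> m; have [] := E m.
Qed.

End Bridge.

(** * From functions on one-dimensional row vectors to functions on the line *)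

Section Bridge1.
Context {R : realType}.
Implicit Types (f : 'rV[R]_1 -> R).

Definition on_line f : R -> R := fun t => f (const_mx t).

Lemma const_mx_line (t : R) : (const_mx t : 'rV[R]_1) = 0 + (t - 0) *: basis_row ord0.
Proof. by apply/rowP => j; rewrite !mxE ord1 eqxx subr0 add0r mulr1. Qed.

Lemma derive1n_on_line f k : schwartz_along ord0 f ->
  derive1n k (on_line f) = on_line (pure_derive ord0 k f).
Proof.
move=> hf; elim: k => // k IH; rewrite derive1nS IH; apply: derive1_eq => t.
rewrite /on_line; under eq_fun do rewrite const_mx_line.
rewrite const_mx_line; apply: is_derive_line; exact: schwartz_along_is_derive.
Qed.

Lemma is_derive_on_line f k (t : R) : schwartz_along ord0 f ->
  is_derive t 1 (on_line (pure_derive ord0 k f)) (on_line (pure_derive ord0 k.+1 f) t).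
Proof.
move=> hf; rewrite /on_line; under eq_fun do rewrite const_mx_line.
rewrite const_mx_line; apply: is_derive_line; exact: schwartz_along_is_derive.
Qed.

Lemma decay_on_line N f B : decay N f B -> decay1 N (on_line f) B.
Proof.
move=> hf t; have := hf (const_mx t).
by rewrite /wt big_ord_recl big_ord0 mxE addr0.
Qed.

Lemma bound_along_on_line N K f B : schwartz_along ord0 f -> bound_along ord0 N K f B -> bound_line N K (on_line f) B.
Proof.
by move=> hf hB k kK; rewrite derive1n_on_line//; apply: decay_on_line; exact: hB.
Qed.

Lemma S0_real_on_line f : S0_real f -> S0_line (on_line f).
Proof.
move=> [_ hf hm]; have {}hf := hf ord0.
have hg : schwartz_line (on_line f).
  move=> k; rewrite derive1n_on_line//; split=> [t|N].
    by have [] := is_derive_on_line k t hf.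
  by have [_ _ /(_ N)[B hB]] := hf k; exists B; exact: decay_on_line.
split=> // k.
have [B hB] := (hg 0%N).2 (2 + k)%N.
have ch : continuous (fun t : R => t ^+ k * on_line f t).
  move=> t; apply: (@cvgM _ _ (nbhs t) _ (fun t => t ^+ k)); first exact: exprn_continuous.
  exact: (schwartz_line_continuous0 hg).
have ih := decay1_integrable ch (decay1_mulX hB).
have [_ E] := integral_rn1 ih.
rewrite /Rintegral -E.
have := hm (fun=> k); rewrite /rnint /Rintegral => <-; congr fine.
apply: eq_integral => t _; congr EFin; rewrite /monomial big_ord_recl big_ord0 mulr1 mxE.
by rewrite /on_line; congr (_ * f _); apply/rowP => j; rewrite !mxE (ord1 j).
Qed.

End Bridge1.

(** * Finite combinations of expressions, and the operators on the half-space bundle *)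

Section Combinations.
Context {R : realType} {n : nat}.
Implicit Types (f : 'rV[R]_n -> R) (g : R -> R).
Local Notation VY := ('rV[R]_n * R * R)%type.
Local Notation term := (R * ('rV[R]_n -> R) * (R -> R))%type.
Implicit Types (p q v : VY) (e : @expr R n) (L : seq term) (z : term).

(** One expression [e] applied to a list of weighted pairs [(f, g)]. A complex transform, or a
    difference of two, involves several real pairs, and differentiation changes only [e]. *)
Fixpoint eval_comb e L p : R :=
  if L is z :: L' then z.1.1 * eval_expr e z.1.2 z.2 p + eval_comb e L' p else 0.

Fixpoint comb_S0 L : Prop :=
  if L is z :: L' then [/\ S0_real z.1.2, S0_line z.2 & comb_S0 L'] else True.

Lemma comb_S0_cat L1 L2 : comb_S0 L1 -> comb_S0 L2 -> comb_S0 (L1 ++ L2).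
Proof. by elim: L1 => //= z L1 IH [h1 h2 h3] h; split => //; exact: IH. Qed.

Lemma eval_comb_cat e L1 L2 p : eval_comb e (L1 ++ L2) p = eval_comb e L1 p + eval_comb e L2 p.
Proof. by elim: L1 => [|z L1 IH] /=; rewrite ?add0r// IH addrA. Qed.

Lemma eval_comb_is_derive e L p v : comb_S0 L -> Y_open R n p ->
  is_derive p v (eval_comb e L) (eval_comb (expr_derive v e) L p).
Proof.
move=> + pY; elim: L => [|z L IH] /=; first by move=> _; exact: is_derive_cst.
move=> [h1 h2 h3]; have d := eval_expr_is_derive e v h1 h2 pY.
exact: (is_deriveD (is_deriveZ z.1.1 d) (IH h3)).
Qed.

Lemma eval_comb_continuous e L p : comb_S0 L -> Y_open R n p -> {for p, continuous (eval_comb e L)}.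
Proof.
move=> + pY; elim: L => [|z L IH] /=; first by move=> _; exact: cvg_cst.
move=> [h1 h2 h3]; have d := @eval_expr_continuous R n e _ _ _ h1 h2 pY.
by have h := cvgD (cvgM (cvg_cst z.1.1) d) (IH h3); exact: h.
Qed.

Lemma eval_comb_expr_sphere e L p : Y_open R n p -> eval_comb (expr_sphere e) L p = eval_comb e L (proj p).
Proof. by move=> pY; elim: L => //= z L IH; rewrite eval_expr_expr_sphere// IH. Qed.

Lemma eval_comb_Sum (F : 'I_n -> expr) L p : eval_comb (Sum F) L p = \sum_j eval_comb (F j) L p.
Proof.
elim: L => [|z L IH] /=; first by rewrite big1.
by rewrite big_split /= IH mulr_sumr.
Qed.

Lemma open_Y : open (Y_open R n).
Proof.
have -> : Y_open R n = (fun q : VY => `|q.1.1|) @^-1` [set x | 0 < x] `&` (fun q : VY => q.2) @^-1` [set x | 0 < x].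
  by apply/seteqP; split=> q [] /= h1 h2; split=> //; rewrite ?normr_gt0// -normr_gt0.
apply: openI; apply: open_comp.
- move=> q _; apply: (@continuous_comp _ _ _ (fun q : VY => q.1.1) (fun x : 'rV[R]_n => `|x|)); last exact: norm_continuous.
  apply: (@continuous_comp _ _ _ (fun q : VY => q.1) fst); exact: cvg_fst.
- exact: open_gt.
- by move=> q _; exact: cvg_snd.
- exact: open_gt.
Qed.

Lemma near_Y_open p : Y_open R n p -> \forall q \near p, Y_open R n q.
Proof. by move=> pY; apply: open_nbhs_nbhs; split => //; exact: open_Y. Qed.

Lemma is_derive_Y_eq (h h' : VY -> R) p v d : Y_open R n p ->
  (forall q, Y_open R n q -> h q = h' q) -> is_derive p v h' d -> is_derive p v h d.
Proof.
move=> pY hh; apply: near_eq_is_derive.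
by move: (near_Y_open pY); apply: filterS => q /hh.
Qed.

Lemma Y_predP p : edot p.1.1 p.1.1 = 1 -> 0 < p.2 -> @Y_pred R n p.
Proof. by move=> h1 h2; rewrite /Y_pred /enorm h1 sqrtr1 eqxx. Qed.

Lemma Y_edot (y : Y R n) : edot (sval y).1.1 (sval y).1.1 = 1.
Proof. by case: y => p /= /andP[/eqP h _]; rewrite -enorm_sqr h expr1n. Qed.

Lemma Y_a_gt0 (y : Y R n) : 0 < (sval y).2.
Proof. by case: y => p /= /andP[]. Qed.

Lemma sval_Y_open (y : Y R n) : Y_open R n (sval y).
Proof.
split; last exact: Y_a_gt0.
apply/eqP => h; have := Y_edot y; rewrite h /edot big1; last by move=> i _; rewrite mxE mul0r.
by move/eqP; rewrite eq_sym oner_eq0.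
Qed.

Lemma proj_in_Y p : Y_open R n p -> @Y_pred R n (proj p).
Proof. by move=> [p0 a0]; apply: Y_predP => //; exact: edot_unit. Qed.

Lemma Y_extE (F : Y R n -> R[i]) p (pY : Y_open R n p) :
  Y_ext F p = F (exist _ (proj p) (proj_in_Y pY)).
Proof.
rewrite /Y_ext; case: insubP => [y _ hy|]; last by rewrite -/(proj p) proj_in_Y.
congr F; exact: val_inj.
Qed.

Definition represented (re_comb im_comb : seq term) e (F : Y R n -> R[i]) := forall y,
  F y = Complex (eval_comb e re_comb (sval y)) (eval_comb e im_comb (sval y)).

Lemma represented_ext re_comb im_comb e F p : represented re_comb im_comb e F -> Y_open R n p ->
  Y_ext F p = Complex (eval_comb (expr_sphere e) re_comb p) (eval_comb (expr_sphere e) im_comb p).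
Proof. by move=> hF pY; rewrite (Y_extE _ pY) hF !eval_comb_expr_sphere. Qed.

Lemma cderive_rep (G : VY -> R[i]) re_comb im_comb e v p : comb_S0 re_comb -> comb_S0 im_comb ->
  (forall q, Y_open R n q -> G q = Complex (eval_comb e re_comb q) (eval_comb e im_comb q)) ->
  Y_open R n p -> cderive v G p = Complex (eval_comb (expr_derive v e) re_comb p) (eval_comb (expr_derive v e) im_comb p).
Proof.
move=> gR gI hG pY; rewrite /cderive; congr Complex.
  have [] // := @is_derive_Y_eq (fun q => complex.Re (G q)) (eval_comb e re_comb) p v _ pY _ (eval_comb_is_derive e v gR pY).
  by move=> q qY; rewrite hG.
have [] // := @is_derive_Y_eq (fun q => complex.Im (G q)) (eval_comb e im_comb) p v _ pY _ (eval_comb_is_derive e v gI pY).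
by move=> q qY; rewrite hG.
Qed.

Definition dir_a : VY := (0, 0, 1).
Definition dir_b : VY := (0, 1, 0).
Definition dir_u (i : 'I_n) : VY := (delta_mx 0 i, 0, 0).

(** [Y_derive_a] extends its argument by homogeneity before differentiating; on expressions the
    extension is [expr_sphere], applied under [expr_derive]. *)
Lemma represented_derive_a re_comb im_comb e F : comb_S0 re_comb -> comb_S0 im_comb -> represented re_comb im_comb e F ->
  represented re_comb im_comb (expr_derive dir_a (expr_sphere e)) (Y_derive_a F).
Proof.
move=> gR gI hF y; apply: cderive_rep => //; last exact: sval_Y_open.
by move=> q qY; exact: represented_ext.
Qed.

Lemma represented_derive_b re_comb im_comb e F : comb_S0 re_comb -> comb_S0 im_comb -> represented re_comb im_comb e F ->
  represented re_comb im_comb (expr_derive dir_b (expr_sphere e)) (Y_derive_b F).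
Proof.
move=> gR gI hF y; apply: cderive_rep => //; last exact: sval_Y_open.
by move=> q qY; exact: represented_ext.
Qed.

Lemma sum_Complex (I : Type) (s : seq I) (A B : I -> R) :
  \sum_(i <- s) Complex (A i) (B i) = Complex (\sum_(i <- s) A i) (\sum_(i <- s) B i).
Proof. by elim: s => [|i s IH]; rewrite ?big_nil// !big_cons IH. Qed.

(** Here the extension is made once and then differentiated twice, so [expr_sphere] occurs only
    innermost. *)
Lemma represented_laplace re_comb im_comb e F : comb_S0 re_comb -> comb_S0 im_comb -> represented re_comb im_comb e F ->
  represented re_comb im_comb (Sum (fun i => expr_derive (dir_u i) (expr_derive (dir_u i) (expr_sphere e)))) (Y_laplace_u F).
Proof.
move=> gR gI hF y; rewrite !eval_comb_Sum -sum_Complex; apply: eq_bigr => i _.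
apply: cderive_rep => //; last exact: sval_Y_open.
move=> q qY; apply: cderive_rep => // q' q'Y; exact: represented_ext.
Qed.

Definition opY (l m k : nat) (F : Y R n -> R[i]) : Y R n -> R[i] :=
  iter l (@Y_derive_a R n) (iter m (@Y_derive_b R n) (iter k (@Y_laplace_u R n) F)).

Definition opE (l m k : nat) (e : expr) : expr :=
  iter l (fun e => expr_derive dir_a (expr_sphere e)) (iter m (fun e => expr_derive dir_b (expr_sphere e))
    (iter k (fun e => Sum (fun i => expr_derive (dir_u i) (expr_derive (dir_u i) (expr_sphere e)))) e)).

Lemma represented_op re_comb im_comb e F l m k : comb_S0 re_comb -> comb_S0 im_comb -> represented re_comb im_comb e F ->
  represented re_comb im_comb (opE l m k e) (opY l m k F).
Proof.
move=> gR gI hF.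
elim: l => [|l IH]; last exact: represented_derive_a.
elim: m => [|m IH]; last exact: represented_derive_b.
by elim: k => [|k IH] //; exact: represented_laplace.
Qed.

Definition expr_iter_derive (vs : seq VY) e := foldr expr_derive e vs.

(** Every iterated derivative agrees on the open set [Y_open] with a combination of the same kind,
    which is continuous and differentiable; openness is what lets derivatives be compared. *)
Lemma smooth_rep (h : VY -> R) e L : comb_S0 L ->
  (forall q, Y_open R n q -> h q = eval_comb e L q) -> smooth_on (Y_open R n) h.
Proof.
move=> gL hh vs.
have E : forall q, Y_open R n q -> iter_derive vs h q = eval_comb (expr_iter_derive vs e) L q.
  elim: vs => //= v vs IH q qY.
  by have [] := is_derive_Y_eq qY IH (eval_comb_is_derive (expr_iter_derive vs e) v gL qY).
move=> x xY; split.
  have c := @eval_comb_continuous (expr_iter_derive vs e) _ _ gL xY.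
  rewrite /prop_for /continuous_at E//; apply: cvg_trans c.
  apply: near_eq_cvg; near=> q; rewrite E//.
  by near: q; exact: near_Y_open.
move=> v; by have [] := is_derive_Y_eq xY E (eval_comb_is_derive (expr_iter_derive vs e) v gL xY).
Unshelve. all: by end_near.
Qed.

Lemma represented_smooth re_comb im_comb e F : comb_S0 re_comb -> comb_S0 im_comb -> represented re_comb im_comb e F -> Y_smooth F.
Proof.
move=> gR gI hF; split.
  by apply: (smooth_rep gR) => q qY; rewrite (represented_ext hF qY).
by apply: (smooth_rep gI) => q qY; rewrite (represented_ext hF qY).
Qed.

(** Only the product [A * B] is controlled: in a term of an increment one factor may be small and
    the other merely bounded. *)
Fixpoint comb_bound (N K : nat) (M : R) L : Prop :=
  if L is z :: L' then [/\ `|z.1.1| <= 1,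
    exists A B, [/\ forall i, bound_along i N K z.1.2 A, bound_line N K z.2 B & A * B <= M] & comb_bound N K M L']
  else True.

Lemma comb_bound_cat N K M L1 L2 : comb_bound N K M L1 -> comb_bound N K M L2 -> comb_bound N K M (L1 ++ L2).
Proof. by elim: L1 => //= z L1 IH [h1 h2 h3] h; split => //; exact: IH. Qed.

Lemma eval_comb_estimate e (s r : nat) : exists C N K, 0 <= C /\
  forall L M, comb_S0 L -> comb_bound N K M L ->
  forall p, edot p.1.1 p.1.1 = 1 -> 0 < p.2 ->
  (p.2 ^+ s + (p.2 ^+ s)^-1) * (1 + `|p.1.2|) ^+ r * `|eval_comb e L p| <= C * M *+ size L.
Proof.
have [C [N [K [C0 h]]]] := eval_expr_estimate e s r.
exists C, N, K; split=> // + M + + p p1 a0.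
elim=> [|z L IH] /=; first by rewrite normr0 mulr0 mulr0n.
move=> [sf sg gL] [c1 [A [B [hA hB hM]]] bL].
rewrite mulrS; apply: (@le_trans _ _ ((p.2 ^+ s + (p.2 ^+ s)^-1) * (1 + `|p.1.2|) ^+ r *
   (`|eval_expr e z.1.2 z.2 p| + `|eval_comb e L p|))).
  rewrite ler_wpM2l ?weight_ge0//; apply: (le_trans (ler_normD _ _)).
  by rewrite lerD2r normrM ler_piMl.
rewrite mulrDr; apply: lerD; last exact: IH.
apply: (le_trans (h _ _ _ _ sf sg hA hB p p1 a0)).
by rewrite -mulrA ler_wpM2l.
Qed.

Lemma represented_seminorm (l m k s r : nat) :
  exists C N K, 0 <= C /\ forall re_comb im_comb (F : Y R n -> R[i]) M, comb_S0 re_comb -> comb_S0 im_comb -> represented re_comb im_comb Base F ->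
  comb_bound N K M re_comb -> comb_bound N K M im_comb ->
  (Y_seminorm (l, m, k, s, r) F <= (C * M *+ (size re_comb + size im_comb))%:E)%E.
Proof.
have [C [N [K [C0 h]]]] := eval_comb_estimate (opE l m k Base) s r.
exists C, N, K; split=> // re_comb im_comb F M gR gI hF bR bI.
apply: ge_ereal_sup => _ [y _ <-]; rewrite lee_fin.
have := represented_op l m k gR gI hF y; rewrite /opY => ->.
have p1 := Y_edot y; have a0 := Y_a_gt0 y.
have hR := h re_comb M gR bR (sval y) p1 a0.
have hI := h im_comb M gI bI (sval y) p1 a0.
rewrite mulrnDr; apply: (le_trans _ (lerD hR hI)); rewrite -mulrDr.
rewrite /Y_a /Y_b.
apply: ler_pM => //.
- by rewrite mulr_ge0 ?powR_ge0 ?addr_ge0 ?invr_ge0 ?exprn_ge0 ?(ltW a0).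
- exact: le_trans (normr_ge0 _) (Re_le_normc _).
- rewrite ler_wpM2l ?powR_weight// addr_ge0 ?invr_ge0 ?exprn_ge0 ?(ltW a0)//.
- exact: normc_le.
Qed.

End Combinations.

(** * Additivity of the operators on [Y] *)

Section SmoothY.
Context {R : realType} {n : nat}.
Local Notation VY := ('rV[R]_n * R * R)%type.
Local Notation U := (Y_open R n).
Implicit Types (p q v : VY) (h : VY -> R).

(** Differentiability to finite order in a form suited to induction. Continuity of the derivatives
    is left aside, since additivity of the operators uses only their existence. *)
Fixpoint diffN (N : nat) h : Prop :=
  if N is N'.+1 then (forall x, U x -> forall v, derivable h x v) /\
    forall v, diffN N' ('D_v h) else True.

Definition diffall h := forall N, diffN N h.

Lemma smooth_diffall h : smooth_on U h -> diffall h.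
Proof.
move=> sh N.
suff H0 : forall vs, diffN N (iter_derive vs h) by exact: (H0 [::]).
elim: N => // N IH vs /=; split; last by move=> v; exact: (IH (v :: vs)).
by move=> x xU; have [] := sh vs x xU.
Qed.

Lemma diffN_pred N h : diffN N.+1 h -> diffN N h.
Proof.
elim: N h => // N IH h [h1 h2]; split => // v; apply: IH; exact: h2.
Qed.

Lemma derive_eq_on h h' p v : U p -> (forall q, U q -> h q = h' q) -> 'D_v h p = 'D_v h' p.
Proof.
move=> pU hh; apply: near_eq_derive.
by move: (near_Y_open pU); apply: filterS => q /hh.
Qed.

Lemma derivable_eq_on h h' p v : U p -> (forall q, U q -> h q = h' q) ->
  derivable h' p v -> derivable h p v.
Proof.
move=> pU hh d; have [] // := is_derive_Y_eq pU hh (derivableP d).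
Qed.

Lemma diffN_eq N h h' : (forall q, U q -> h q = h' q) -> diffN N h' -> diffN N h.
Proof.
elim: N h h' => // N IH h h' hh [h1 h2]; split.
  by move=> x xU v; apply: (derivable_eq_on xU hh); exact: h1.
move=> v; apply: (IH _ ('D_v h')); last exact: h2.
by move=> q qU; exact: derive_eq_on.
Qed.

Lemma diffN_add N h h' : diffN N h -> diffN N h' -> diffN N (fun q => h q + h' q).
Proof.
elim: N h h' => // N IH h h' [h1 h2] [h1' h2']; split.
  by move=> x xU v; exact: (derivableD (h1 x xU v) (h1' x xU v)).
move=> v; apply: (@diffN_eq _ _ (fun q => 'D_v h q + 'D_v h' q)); last exact: (IH _ _ (h2 v) (h2' v)).
by move=> q qU; exact: (deriveD (h1 q qU v) (h1' q qU v)).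
Qed.

Lemma diffN_scale N c h : diffN N h -> diffN N (fun q => c * h q).
Proof.
elim: N h => // N IH h [h1 h2]; split.
  by move=> x xU v; have [] := is_deriveZ c (derivableP (h1 x xU v)).
move=> v; apply: (@diffN_eq _ _ (fun q => c * 'D_v h q)); last exact: (IH _ (h2 v)).
by move=> q qU; have [_ d] := is_deriveZ c (derivableP (h1 q qU v)); exact: d.
Qed.

Lemma diffN_coordM N j h : diffN N h -> diffN N (fun q => q.1.1 0 j * h q).
Proof.
elim: N h => // N IH h hh; have [h1 h2] := hh.
have d q v : U q -> is_derive q v (fun q => q.1.1 0 j * h q)
    (v.1.1 0 j * h q + q.1.1 0 j * 'D_v h q).
  by move=> qU; exact: (is_deriveM_mul (is_derive_p11 q v j) (derivableP (h1 q qU v))).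
split; first by move=> x xU v; have [] := d x v xU.
move=> v; apply: (@diffN_eq _ _ (fun q => v.1.1 0 j * h q + q.1.1 0 j * 'D_v h q)).
  by move=> q qU; have [_ ->] := d q v qU.
apply: diffN_add; last by apply: IH; exact: h2.
by apply: diffN_scale; exact: diffN_pred.
Qed.

Lemma diffN0 N : diffN N (fun=> 0).
Proof.
elim: N => //= N IH; split; first by move=> x _ v; exact: derivable_cst.
by move=> v; apply: (@diffN_eq _ _ (fun=> 0)) => // q _; exact: derive_cst.
Qed.

Lemma diffN_sum N (F : 'I_n -> VY -> R) : (forall i, diffN N (F i)) ->
  diffN N (fun q => \sum_i F i q).
Proof.
move=> hF.
suff H0 (s : seq 'I_n) : diffN N (fun q => \sum_(i <- s) F i q) by exact: H0.
elim: s => [|i s IH].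
  by under eq_fun do rewrite big_nil; exact: diffN0.
by under eq_fun do rewrite big_cons; exact: diffN_add.
Qed.

Lemma diffall_derive v h : diffall h -> diffall ('D_v h).
Proof. by move=> hh N; have [_] := hh N.+1; apply. Qed.

Lemma diffall_derivable h x v : diffall h -> U x -> derivable h x v.
Proof. by move=> hh xU; have [h1 _] := hh 1%N; exact: h1. Qed.

Definition scaleu (c : R) q : VY := (c *: q.1.1, q.1.2, q.2).

Definition homog0 h := forall c q, 0 < c -> h (scaleu c q) = h q.

Lemma is_derive_rescale h p v (c d : R) : c != 0 ->
  is_derive p (c *: v) h d -> is_derive p v h (c^-1 * d).
Proof.
move=> c0 dh; apply/is_derive_lineP.
have E : (fun t : R => h (t *: v + p)) = (fun t : R => h (t *: (c *: v) + p)) \o (fun t : R => t * c^-1).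
  by apply/funext => t /=; rewrite scalerA mulfVK.
have dl : is_derive (0 : R) 1 (fun t : R => t * c^-1) c^-1.
  apply/is_deriveP; apply: cvg_near_cst; near=> t.
  have t0 : t != 0 by near: t; exact: nbhs_dnbhs_neq.
  by rewrite [t *: (1 : R)]mulr1 addr0 mul0r subr0 mulKf.
rewrite E mulrC; apply: is_derive1_comp.
by rewrite mul0r; apply/is_derive_lineP.
Unshelve. all: by end_near.
Qed.

(* Homogeneity of degree [-k], where [K = c^-k], becomes degree [-k-1]. *)
Lemma derive_homog h i (c K : R) p : 0 < c -> U p ->
  (forall q, U q -> h (scaleu c q) = K * h q) -> derivable h p (dir_u i) ->
  'D_(dir_u i) h (scaleu c p) = c^-1 * (K * 'D_(dir_u i) h p).
Proof.
move=> c0 pU hh dh; have cn0 : c != 0 by rewrite gt_eqF.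
have d1 : is_derive p (dir_u i) (fun q => h (scaleu c q)) (K * 'D_(dir_u i) h p).
  apply: (is_derive_Y_eq pU hh); exact: (is_deriveZ K (derivableP dh)).
have d2 : is_derive (scaleu c p) (c *: dir_u i) h (K * 'D_(dir_u i) h p).
  apply/is_derive_lineP.
  have -> : (fun t : R => h (t *: (c *: dir_u i) + scaleu c p)) =
            (fun t : R => h (scaleu c (t *: dir_u i + p))).
    apply/funext => t; congr h; rewrite /scaleu /dir_u /=.
    by congr (_, _, _); rewrite /= ?scaler0 ?add0r ?scalerDr// !scalerA mulrC.
  exact/is_derive_lineP.
by have [_ ->] := is_derive_rescale cn0 d2.
Qed.

Lemma derive_homog_ab h (v : VY) (c : R) p : 0 < c -> v.1.1 = 0 -> homog0 h ->
  'D_v h (scaleu c p) = 'D_v h p.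
Proof.
move=> c0 v0 hh; rewrite /derive.
have -> // : (fun t : R => t^-1 *: ((h \o shift (scaleu c p)) (t *: v) - h (scaleu c p))) =
  (fun t : R => t^-1 *: ((h \o shift p) (t *: v) - h p)).
apply/funext => t; rewrite hh//; congr (_ *: (_ - _)); rewrite /= -[RHS](hh c)//; congr h.
by rewrite /scaleu /=; congr (_, _, _); rewrite /= v0 scaler0 !add0r.
Qed.

Lemma proj_scaleu p : proj p = scaleu (enorm p.1.1)^-1 p.
Proof. by []. Qed.

Lemma enorm_scale (c : R) (x : 'rV[R]_n) : 0 < c -> enorm (c *: x) = c * enorm x.
Proof. by move=> c0; rewrite /enorm edotZZ sqrtrM ?sqr_ge0// sqrtr_sqr gtr0_norm. Qed.

Lemma Y_ext_homog (F : Y R n -> R[i]) c q : 0 < c -> Y_ext F (scaleu c q) = Y_ext F q.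
Proof.
move=> c0; rewrite /Y_ext /scaleu /= enorm_scale// scalerA.
rewrite (_ : (c * enorm q.1.1)^-1 * c = (enorm q.1.1)^-1)//.
by rewrite invfM mulrAC mulVf ?mul1r// gt_eqF.
Qed.

Definition Ysm (F : Y R n -> R[i]) :=
  diffall (fun q => complex.Re (Y_ext F q)) /\ diffall (fun q => complex.Im (Y_ext F q)).

Lemma Y_smooth_Ysm F : Y_smooth F -> Ysm F.
Proof. by case=> h1 h2; split; exact: smooth_diffall. Qed.

Lemma homog0_Re F : homog0 (fun q => complex.Re (Y_ext F q)).
Proof. by move=> c q c0; rewrite Y_ext_homog. Qed.
Lemma homog0_Im F : homog0 (fun q => complex.Im (Y_ext F q)).
Proof. by move=> c q c0; rewrite Y_ext_homog. Qed.

(** A derivative in [b] or [a] of a function homogeneous of degree 0 is again so; extending its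
    restriction to the sphere therefore gives it back. *)
Lemma Ysm_dir (v : VY) (F : Y R n -> R[i]) : v.1.1 = 0 -> Ysm F ->
  Ysm (fun y => cderive v (Y_ext F) (sval y)).
Proof.
move=> v0 [h1 h2]; split => N.
  apply: (@diffN_eq _ _ ('D_v (fun q => complex.Re (Y_ext F q)))); last exact: diffall_derive.
  move=> q qU; rewrite (Y_extE _ qU) /= proj_scaleu derive_homog_ab//.
    by rewrite invr_gt0; case: qU => ? _; exact: enorm_gt0.
  exact: homog0_Re.
apply: (@diffN_eq _ _ ('D_v (fun q => complex.Im (Y_ext F q)))); last exact: diffall_derive.
move=> q qU; rewrite (Y_extE _ qU) /= proj_scaleu derive_homog_ab//.
  by rewrite invr_gt0; case: qU => ? _; exact: enorm_gt0.
exact: homog0_Im.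
Qed.

(** Two derivatives in the first variable lower the degree of homogeneity to -2. Extending the
    Laplacian from the sphere thus multiplies it by [|w|^2], a polynomial, which preserves
    differentiability. *)
Lemma derive2_homog h i p : U p -> diffall h -> homog0 h ->
  'D_(dir_u i) ('D_(dir_u i) h) (proj p) =
  (\sum_j p.1.1 0 j * p.1.1 0 j) * 'D_(dir_u i) ('D_(dir_u i) h) p.
Proof.
move=> pU hd hh; have e0 : 0 < enorm p.1.1 by case: pU => ? _; exact: enorm_gt0.
have c0 : 0 < (enorm p.1.1)^-1 by rewrite invr_gt0.
rewrite proj_scaleu (@derive_homog _ i _ (enorm p.1.1)) => //.
- by rewrite invrK mulrA -expr2 enorm_sqr.
- move=> q qU; rewrite (@derive_homog h i _ 1) => //.
  + by rewrite invrK mul1r.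
  + by move=> q' _; rewrite hh ?mul1r.
  + exact: diffall_derivable.
- by apply: diffall_derivable => //; exact: diffall_derive.
Qed.

Lemma Re_sum (I : Type) (s : seq I) (A : I -> R[i]) :
  complex.Re (\sum_(i <- s) A i) = \sum_(i <- s) complex.Re (A i).
Proof.
elim: s => [|i s IH]; rewrite ?big_nil// !big_cons -IH.
by case: (A i); case: (\sum_(i <- s) A i).
Qed.

Lemma Im_sum (I : Type) (s : seq I) (A : I -> R[i]) :
  complex.Im (\sum_(i <- s) A i) = \sum_(i <- s) complex.Im (A i).
Proof.
elim: s => [|i s IH]; rewrite ?big_nil// !big_cons -IH.
by case: (A i); case: (\sum_(i <- s) A i).
Qed.

Lemma diffN_lap N h : diffall h -> diffN N (fun q =>
  \sum_i (\sum_j q.1.1 0 j * q.1.1 0 j) * 'D_(dir_u i) ('D_(dir_u i) h) q).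
Proof.
move=> hd; apply: diffN_sum => i.
under eq_fun do rewrite mulr_suml; apply: diffN_sum => j.
under eq_fun do rewrite -mulrA; do 2 apply: diffN_coordM.
have H0 : diffall ('D_(dir_u i) ('D_(dir_u i) h)) by do 2 apply: diffall_derive.
exact: H0.
Qed.

Lemma Ysm_laplace F : Ysm F -> Ysm (Y_laplace_u F).
Proof.
move=> [h1 h2]; split => N.
  apply: diffN_eq (diffN_lap N h1) => q qU.
  rewrite (Y_extE _ qU) /Y_laplace_u Re_sum; apply: eq_bigr => i _.
  by rewrite -(derive2_homog i qU h1 (@homog0_Re F)).
apply: diffN_eq (diffN_lap N h2) => q qU.
rewrite (Y_extE _ qU) /Y_laplace_u Im_sum; apply: eq_bigr => i _.
by rewrite -(derive2_homog i qU h2 (@homog0_Im F)).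
Qed.

Lemma Y_ext_add (F G : Y R n -> R[i]) q :
  Y_ext (fun y => F y + G y) q = Y_ext F q + Y_ext G q.
Proof. by rewrite /Y_ext; case: insub => [y|] //; rewrite addr0. Qed.

Lemma ReD (a b : R[i]) : complex.Re (a + b) = complex.Re a + complex.Re b.
Proof. by case: a; case: b. Qed.
Lemma ImD (a b : R[i]) : complex.Im (a + b) = complex.Im a + complex.Im b.
Proof. by case: a; case: b. Qed.

Definition cdiffall (G : VY -> R[i]) :=
  diffall (fun q => complex.Re (G q)) /\ diffall (fun q => complex.Im (G q)).

Lemma cderive_add (G1 G2 G : VY -> R[i]) v p : cdiffall G1 -> cdiffall G2 -> U p ->
  (forall q, U q -> G q = G1 q + G2 q) ->
  cderive v G p = cderive v G1 p + cderive v G2 p.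
Proof.
move=> [r1 i1] [r2 i2] pU hG; rewrite /cderive.
have -> : 'D_v (fun q => complex.Re (G q)) p =
   'D_v (fun q => complex.Re (G1 q)) p + 'D_v (fun q => complex.Re (G2 q)) p.
  rewrite -deriveD; [|exact: diffall_derivable..].
  by apply: derive_eq_on => // q qU; rewrite hG// ReD.
have -> // : 'D_v (fun q => complex.Im (G q)) p =
   'D_v (fun q => complex.Im (G1 q)) p + 'D_v (fun q => complex.Im (G2 q)) p.
rewrite -deriveD; [|exact: diffall_derivable..].
by apply: derive_eq_on => // q qU; rewrite hG// ImD.
Qed.

Lemma cdiffall_cderive v G : cdiffall G -> cdiffall (cderive v G).
Proof. by case=> h1 h2; split; apply: diffall_derive. Qed.

(** The derivative of a sum splits only where both summands are differentiable, so additivity has to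
    be proved together with the persistence of [Ysm] under the operators. *)
Lemma opY_add l m k (F G : Y R n -> R[i]) : Ysm F -> Ysm G ->
  [/\ Ysm (opY l m k F), Ysm (opY l m k G) &
   opY l m k (fun y => F y + G y) = (fun y => opY l m k F y + opY l m k G y)].
Proof.
move=> sF sG.
have dirP v F' G' : v.1.1 = 0 -> Ysm F' -> Ysm G' ->
   (fun y => cderive v (Y_ext (fun y : Y R n => F' y + G' y)) (sval y)) =
   (fun y : Y R n => cderive v (Y_ext F') (sval y) + cderive v (Y_ext G') (sval y)).
  move=> v0 s1 s2; apply/funext => y; apply: cderive_add => //; first exact: sval_Y_open.
  by move=> q _; exact: Y_ext_add.
elim: l => [|l [s1 s2 E]]; last first.
  by split; rewrite /opY /=; [exact: Ysm_dir|exact: Ysm_dir|rewrite -/(opY l m k _) E; exact: dirP].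
elim: m => [|m [s1 s2 E]]; last first.
  split; rewrite /opY /=; [exact: Ysm_dir|exact: Ysm_dir|].
  by rewrite -[iter m _ _]/(opY 0 m k _) E; exact: dirP.
elim: k => [|k [s1 s2 E]] //; split; rewrite /opY /=; [exact: Ysm_laplace|exact: Ysm_laplace|].
rewrite -[iter k _ _]/(opY 0 0 k _) E; apply/funext => y.
rewrite /Y_laplace_u -big_split /=; apply: eq_bigr => i _.
apply: cderive_add; [exact: cdiffall_cderive|exact: cdiffall_cderive|exact: sval_Y_open|].
move=> q qU; apply: cderive_add => // q' _; exact: Y_ext_add.
Qed.

Lemma Y_seminorm_add j (F G : Y R n -> R[i]) : Ysm F -> Ysm G ->
  (Y_seminorm j (fun y => F y + G y)%R <= Y_seminorm j F + Y_seminorm j G)%E.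
Proof.
move=> sF sG; case: j => [[[[l m] k] s] r].
apply: ge_ereal_sup => _ [y _ <-].
have [_ _ E] := opY_add l m k sF sG.
rewrite -/(opY l m k _) E.
pose W := (Y_a y ^+ s + (Y_a y ^+ s)^-1) * (1 + Y_b y ^+ 2) `^ (r%:R / 2).
have W0 : 0 <= W.
  have a0 : 0 < Y_a y := Y_a_gt0 y.
  by rewrite mulr_ge0 ?powR_ge0 ?addr_ge0 ?invr_ge0 ?exprn_ge0 ?(ltW a0).
apply: (@le_trans _ _ ((W * Normc.normc (opY l m k F y))%:E + (W * Normc.normc (opY l m k G y))%:E)%E).
  by rewrite -EFinD lee_fin -mulrDr ler_wpM2l// le_normcD.
apply: leeD; apply: ereal_sup_ubound; exists y => //.
Qed.

End SmoothY.

(** * Closure properties of the real-valued function class *)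

Section SfClosure.
Context {R : realType} {n : nat}.
Implicit Types (f : 'rV[R]_n -> R) (i : 'I_n).

Lemma rapid_monomial (m : multi_index n) f : rapid f -> rapid (fun x => monomial m x * f x).
Proof.
move=> rf; rewrite /monomial.
suff H0 (s : seq 'I_n) : rapid (fun x => (\prod_(i <- s) x 0 i ^+ m i) * f x) by exact: H0.
elim: s => [|i s IH].
  by under eq_fun do rewrite big_nil mul1r.
under eq_fun do rewrite big_cons -mulrA.
elim: (m i) => [|k IHk]; first by under eq_fun do rewrite expr0 mul1r.
under eq_fun do rewrite exprS -mulrA.
exact: (rapid_mulX i IHk).
Qed.

Lemma rapid_L1 f : rapid f -> L1 f.
Proof. by case=> cf /(_ (2 * n)%N). Qed.

Lemma rapid_sub f f' : rapid f -> rapid f' -> rapid (fun x => f x - f' x).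
Proof.
move=> [c1 h1] [c2 h2]; split; first by move=> x; exact: (cvgB (c1 x) (c2 x)).
move=> N; have [C hC] := h1 N; have [D hD] := h2 N.
exists (C + `|-1| * D); have := decayD hC (decayZ (-1) hD).
by under [in X in X -> _]eq_fun do rewrite mulN1r.
Qed.

Lemma schwartz_along_sub i f f' : schwartz_along i f -> schwartz_along i f' -> schwartz_along i (fun x => f x - f' x).
Proof.
move=> h1 h2.
have dE k x : is_derive x (basis_row i) (fun x => pure_derive i k f x - pure_derive i k f' x)
    (pure_derive i k.+1 f x - pure_derive i k.+1 f' x).
  exact: (is_deriveB (schwartz_along_is_derive k x h1) (schwartz_along_is_derive k x h2)).
have E k : pure_derive i k (fun x => f x - f' x) = (fun x => pure_derive i k f x - pure_derive i k f' x).
  elim: k => // k IH; rewrite [LHS]/= -/(pure_derive i k _) IH.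
  by apply: derive_eq => x; exact: dE.
move=> k; rewrite E; have [c1 d1 b1] := h1 k; have [c2 d2 b2] := h2 k.
have [c3 b3] := rapid_sub (conj c1 b1) (conj c2 b2).
by split => // x; have [] := dE k x.
Qed.

Lemma S0_real_sub f f' : S0_real f -> S0_real f' -> S0_real (fun x => f x - f' x).
Proof.
move=> [r1 h1 m1] [r2 h2 m2]; split.
- exact: rapid_sub.
- by move=> i; exact: schwartz_along_sub.
move=> m; under eq_fun do rewrite mulrBr.
rewrite rnintB ?m1 ?m2 ?subrr//; apply: rapid_L1; exact: rapid_monomial.
Qed.

Lemma S0_real_bound f N K : S0_real f -> exists2 A, 0 <= A & forall i, bound_along i N K f A.
Proof.
move=> [_ hf _].
have /choice[C hC] : forall z : 'I_n * 'I_K.+1, exists C, decay N (pure_derive z.1 z.2 f) C.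
  by move=> z; have [_ _] := hf z.1 z.2; exact.
exists (\sum_z C z) => [|i k kK].
  by apply: sumr_ge0 => z _; exact: decay_ge0 (hC z).
have kK' : (k < K.+1)%N by [].
apply: decay_le (hC (i, Ordinal kK')).
rewrite (bigD1 (i, Ordinal kK'))//= lerDl sumr_ge0// => z _.
exact: decay_ge0 (hC z).
Qed.

End SfClosure.

(** * Real and imaginary parts and sesquilinearity of the transform *)

Section ComplexRidgelet.
Context {R : realType} {n : nat}.
Implicit Types (F : 'rV[R]_n -> R[i]) (G : 'rV[R]_1 -> R[i]) (y : Y R n).

Definition reF (m : nat) (F : 'rV[R]_m -> R[i]) : 'rV[R]_m -> R := fun x => complex.Re (F x).
Definition imF (m : nat) (F : 'rV[R]_m -> R[i]) : 'rV[R]_m -> R := fun x => complex.Im (F x).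
Definition S0_parts (m : nat) (F : 'rV[R]_m -> R[i]) := S0_real (reF F) /\ S0_real (imF F).
Definition L1_parts F := L1 (reF F) /\ L1 (imF F).

Lemma S0_parts_sub (m : nat) (F F' : 'rV[R]_m -> R[i]) : S0_parts F -> S0_parts F' -> S0_parts (fun x => F x - F' x).
Proof.
move=> [h1 h2] [h1' h2']; split.
  rewrite (_ : reF _ = fun x => reF F x - reF F' x); first exact: S0_real_sub.
  by apply/funext => x; rewrite /reF; case: (F x); case: (F' x).
rewrite (_ : imF _ = fun x => imF F x - imF F' x); first exact: S0_real_sub.
by apply/funext => x; rewrite /imF; case: (F x); case: (F' x).
Qed.

(** Real part of [F] times the conjugate of [G]; the conjugation accounts for the plus sign here and
    for the minus sign in [im_comb]. *)
Definition re_comb F G : seq (R * ('rV[R]_n -> R) * (R -> R)) :=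
  [:: (1, reF F, on_line (reF G)); (1, imF F, on_line (imF G))].
Definition im_comb F G : seq (R * ('rV[R]_n -> R) * (R -> R)) :=
  [:: (1, imF F, on_line (reF G)); (-1, reF F, on_line (imF G))].

Lemma comb_S0_re_comb F G : S0_parts F -> S0_parts G -> comb_S0 (re_comb F G).
Proof. by move=> [? ?] [? ?]; split => //; [|split]; rewrite //=; exact: S0_real_on_line. Qed.

Lemma comb_S0_im_comb F G : S0_parts F -> S0_parts G -> comb_S0 (im_comb F G).
Proof. by move=> [? ?] [? ?]; split => //; [|split]; rewrite //=; exact: S0_real_on_line. Qed.

Lemma phaseE y (x : 'rV[R]_n) :
  (edot x (Y_u y) - Y_b y) / Y_a y = edot x ((Y_a y)^-1 *: Y_u y) - Y_b y / Y_a y.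
Proof.
rewrite mulrBl; congr (_ - _); rewrite /edot mulr_suml; apply: eq_bigr => j _.
by rewrite mxE; ring.
Qed.

Definition hterm (f : 'rV[R]_n -> R) (g : R -> R) y : 'rV[R]_n -> R := fun x =>
  (Y_a y)^-1 * (f x * g (edot x ((Y_a y)^-1 *: Y_u y) - Y_b y / Y_a y)).

Lemma L1_hterm f g y : S0_real f -> S0_line g -> L1 (hterm f g y).
Proof. by move=> [rf _ _] [hg _]; apply: L1Z; exact: L1_wave_int. Qed.

Lemma rnint_hterm f g y : S0_real f -> S0_line g -> rnint (hterm f g y) = eval_expr Base f g (sval y).
Proof.
move=> [rf _ _] [hg _]; rewrite rnintZ; last exact: L1_wave_int.
rewrite /= /ridge -/(Y_a y) -/(Y_u y) -/(Y_b y).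
have -> : enorm (Y_u y) = 1 by rewrite /enorm Y_edot sqrtr1.
by rewrite invr1 scale1r.
Qed.

Lemma reF_integrand F G y : reF (ridgelet_integrand F G y) =
  fun x => hterm (reF F) (on_line (reF G)) y x + hterm (imF F) (on_line (imF G)) y x.
Proof.
apply/funext => x; rewrite /reF /imF /hterm /on_line /ridgelet_integrand phaseE.
by case: (F x) => a b; case: (G _) => c d /=; ring.
Qed.

Lemma imF_integrand F G y : imF (ridgelet_integrand F G y) =
  fun x => hterm (imF F) (on_line (reF G)) y x - hterm (reF F) (on_line (imF G)) y x.
Proof.
apply/funext => x; rewrite /reF /imF /hterm /on_line /ridgelet_integrand phaseE.
by case: (F x) => a b; case: (G _) => c d /=; ring.
Qed.

Lemma L1B (f g : 'rV[R]_n -> R) : L1 f -> L1 g -> L1 (fun x => f x - g x).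
Proof.
by move=> hf hg; have := L1D hf (L1Z (-1) hg); under [in X in X -> _]eq_fun do rewrite mulN1r.
Qed.

Lemma L1_parts_integrand F G y : S0_parts F -> S0_parts G -> L1_parts (ridgelet_integrand F G y).
Proof.
move=> [h1 h2] [h3 h4]; split.
  by rewrite reF_integrand; apply: L1D; apply: L1_hterm => //; exact: S0_real_on_line.
by rewrite imF_integrand; apply: L1B; apply: L1_hterm => //; exact: S0_real_on_line.
Qed.

Lemma ridgelet_rep F G : S0_parts F -> S0_parts G -> represented (re_comb F G) (im_comb F G) Base (ridgelet F G).
Proof.
move=> [h1 h2] [h3 h4] y; rewrite /ridgelet /rn_integral.
have g3 := S0_real_on_line h3; have g4 := S0_real_on_line h4.
congr Complex.
  rewrite -[LHS]/(rnint (reF (ridgelet_integrand F G y))) reF_integrand.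
  rewrite rnintD; [|exact: L1_hterm..].
  by rewrite !rnint_hterm// [RHS]/= addr0 !mul1r.
rewrite -[LHS]/(rnint (imF (ridgelet_integrand F G y))) imF_integrand.
rewrite rnintB; [|exact: L1_hterm..].
by rewrite !rnint_hterm// [RHS]/= addr0 mul1r mulN1r.
Qed.

Lemma rn_integral_lin (c : R[i]) F F' : L1_parts F -> L1_parts F' ->
  rn_integral (fun x => c * F x + F' x) = c * rn_integral F + rn_integral F'.
Proof.
case: c => c1 c2 [h1 h2] [h3 h4].
have E1 : reF (fun x => (Complex c1 c2) * F x + F' x) =
   fun x => (c1 * reF F x + (- c2) * imF F x) + reF F' x.
  by apply/funext => x; rewrite /reF /imF; case: (F x); case: (F' x) => a b d e /=; ring.
have E2 : imF (fun x => (Complex c1 c2) * F x + F' x) =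
   fun x => (c1 * imF F x + c2 * reF F x) + imF F' x.
  by apply/funext => x; rewrite /reF /imF; case: (F x); case: (F' x) => a b d e /=; ring.
rewrite -[LHS]/(Complex (rnint (reF (fun x => (Complex c1 c2) * F x + F' x)))
  (rnint (imF (fun x => (Complex c1 c2) * F x + F' x)))) E1 E2.
rewrite (rnintD (L1D (L1Z c1 h1) (L1Z (- c2) h2)) h3) (rnintD (L1Z c1 h1) (L1Z (- c2) h2)) !rnintZ//.
rewrite (rnintD (L1D (L1Z c1 h2) (L1Z c2 h1)) h4) (rnintD (L1Z c1 h2) (L1Z c2 h1)) !rnintZ//.
rewrite -[rn_integral F]/(Complex (rnint (reF F)) (rnint (imF F))).
rewrite -[rn_integral F']/(Complex (rnint (reF F')) (rnint (imF F'))).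
by congr Complex; rewrite /=; ring.
Qed.

Lemma ridgelet_linl (c : R[i]) F1 F2 G y : S0_parts F1 -> S0_parts F2 -> S0_parts G ->
  ridgelet (fun x => c * F1 x + F2 x) G y = c * ridgelet F1 G y + ridgelet F2 G y.
Proof.
move=> h1 h2 h3; rewrite /ridgelet -rn_integral_lin; [|exact: L1_parts_integrand..].
by congr rn_integral; apply/funext => x; rewrite /ridgelet_integrand; ring.
Qed.

Lemma ridgelet_linr (c : R[i]) F G1 G2 y : S0_parts F -> S0_parts G1 -> S0_parts G2 ->
  ridgelet F (fun x => c * G1 x + G2 x) y = (c^*)%C * ridgelet F G1 y + ridgelet F G2 y.
Proof.
move=> h1 h2 h3; rewrite /ridgelet -rn_integral_lin; [|exact: L1_parts_integrand..].
congr rn_integral; apply/funext => x; rewrite /ridgelet_integrand rmorphD rmorphM /=; ring.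
Qed.

(** The usual splitting for a sesquilinear map: every term on the right contains at least one
    increment, which is what joint continuity exploits. *)
Lemma ridgelet_sub F F0 G G0 y : S0_parts F -> S0_parts F0 -> S0_parts G -> S0_parts G0 ->
  ridgelet F G y - ridgelet F0 G0 y =
  ridgelet (fun x => F x - F0 x) (fun x => G x - G0 x) y +
  (ridgelet (fun x => F x - F0 x) G0 y + ridgelet F0 (fun x => G x - G0 x) y).
Proof.
move=> h1 h2 h3 h4; have h5 := S0_parts_sub h1 h2; have h6 := S0_parts_sub h3 h4.
have EF : F = (fun x => 1 * (F x - F0 x) + F0 x) by apply/funext => x; ring.
have EG : G = (fun x => 1 * (G x - G0 x) + G0 x) by apply/funext => x; ring.
have -> : ridgelet F G y = ridgelet (fun x => 1 * (F x - F0 x) + F0 x) G y by rewrite -EF.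
rewrite ridgelet_linl//.
have E F' : ridgelet F' G y = ridgelet F' (fun x => 1 * (G x - G0 x) + G0 x) y by rewrite -EG.
rewrite !E !ridgelet_linr// rmorph1; ring.
Qed.

Lemma represented_add L1 L2 L3 L4 e (H1 H2 : Y R n -> R[i]) : represented L1 L2 e H1 -> represented L3 L4 e H2 ->
  represented (L1 ++ L3) (L2 ++ L4) e (fun y => H1 y + H2 y).
Proof. by move=> h1 h2 y; rewrite h1 h2 !eval_comb_cat. Qed.

End ComplexRidgelet.

(** * Continuity *)

Section Continuity.
Context {R : realType} {n : nat}.

(** Convergence is tested on the subbase, whose balls containing [G] need not be centred at [G];
    hence the arbitrary [G0]. *)
Lemma cvg_SY (T : Type) (F : set_system T) {FF : Filter F} (h : T -> SY R n) (G : SY R n) :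
  (forall j (G0 : SY R n) (e : R), (SY_dist j G0 G < e%:E)%E ->
     \forall x \near F, (SY_dist j G0 (h x) < e%:E)%E) ->
  h x @[x --> F] --> G.
Proof.
move=> hyp A; rewrite /= nbhsE => -[B [oB BG] BA].
move: oB BG => [D' D'I BE]; rewrite -BE => -[C D'C CG].
have [s sD CE] := D'I _ D'C.
have : F (h @^-1` C).
  rewrite -CE preimage_bigcap; apply: filter_bigI => i si.
  have iG : i G by move: CG; rewrite -CE => /(_ i si).
  have /set_mem Di := sD i si.
  have [j [G0 [e [e0 iE]]]] : seminorm_subbase (@SY_dist R n) i := Di.
  by move: iG; rewrite iE => /hyp.
by apply: filterS => x Cx; apply: BA; rewrite -BE; exists C.
Qed.

Lemma multi_derive0 (m : nat) (b : multi_index m) :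
  multi_derive b (fun=> 0 : R[i]) = fun=> 0 : R[i].
Proof.
have c0 (v : 'rV[R]_m) : cderive v (fun=> 0 : R[i]) = fun=> 0.
  by apply/funext => x; rewrite /cderive /= derive_cst.
rewrite /multi_derive; elim: (enum 'I_m) => //= i s ->.
by elim: (b i) => //= k ->.
Qed.

Lemma schwartz_dist0 (m : nat) (phi : schwartz_space R m) ab : schwartz_dist ab phi phi = 0%E.
Proof.
rewrite /schwartz_dist /schwartz_seminorm.
have -> : (fun x => schwartz_fun phi x - schwartz_fun phi x) = fun=> 0.
  by apply/funext => x; rewrite subrr.
rewrite multi_derive0 (_ : [set _ | _ in _] = [set 0%E]) ?ereal_sup1//.
apply/seteqP; split => [_ [x _ <-]|_ ->] ; first by rewrite /= expr0n/= addr0 sqrtr0 mulr0.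
by exists 0 => //; rewrite /= expr0n/= addr0 sqrtr0 mulr0.
Qed.

Lemma near_schwartz_dist (m : nat) (phi0 : S0 R m) ab (d : R) : 0 < d ->
  \forall phi \near phi0, (schwartz_dist ab (\val phi0) (\val phi) < d%:E)%E.
Proof.
move=> d0.
pose B : set (schwartz_space R m) := [set g | (schwartz_dist ab (\val phi0) g < d%:E)%E].
have oB : open B.
  exists [set B]; last by rewrite bigcup_set1.
  move=> _ ->; apply: (@finI_from1 _ _ (seminorm_subbase (@schwartz_dist R m)) id B).
  by exists ab, (\val phi0), d.
have Bphi : B (\val phi0) by rewrite /B /= schwartz_dist0 lte_fin.
have nB : nbhs (\val phi0) B by exact: open_nbhs_nbhs.
exact: (@initial_continuous _ _ (\val : S0 R m -> schwartz_space R m) phi0 B nB).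
Qed.

Lemma S0_S0_prop (m : nat) (phi : S0 R m) : S0_prop (S0_fun phi).
Proof. by split; [exact: (set_valP (\val phi))|exact: (set_valP phi)]. Qed.

Lemma S0_S0_parts (m : nat) (phi : S0 R m) : (0 < m)%N -> S0_parts (S0_fun phi).
Proof. by move=> m0; exact: (S0_prop_S0_real m0 (S0_S0_prop phi)). Qed.

Definition bound_parts (m N K : nat) (F : 'rV[R]_m -> R[i]) (A : R) :=
  (forall i, bound_along i N K (reF F) A) /\ (forall i, bound_along i N K (imF F) A).

(** Finitely many seminorm balls are intersected, indexed by weight, direction and order. Dividing
    [d] by [(m+1)^N] undoes the constant lost in [seminorm_decay]. *)
Lemma near_bound_parts (m : nat) (phi0 : S0 R m) (N K : nat) (d : R) : 0 < d ->
  \forall phi \near phi0, bound_parts N K (fun x => S0_fun phi x - S0_fun phi0 x) d.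
Proof.
move=> d0; have m0 : (0 : R) < m.+1%:R ^+ N by rewrite exprn_gt0.
pose d' := d / m.+1%:R ^+ N.
have d'0 : 0 < d' by rewrite divr_gt0.
have : \forall phi \near phi0, forall z : option 'I_m * 'I_m * 'I_K.+1,
    (schwartz_dist (pure N z.1.1, pure z.2 (Some z.1.2)) (\val phi0) (\val phi) < d'%:E)%E.
  have FF : Filter (nbhs phi0) by exact: nbhs_filter.
  apply: (@filter_forall _ (option 'I_m * 'I_m * 'I_K.+1)%type (fun z phi =>
    (schwartz_dist (pure N z.1.1, pure z.2 (Some z.1.2)) (\val phi0) (\val phi) < d'%:E)%E)
    (nbhs phi0) FF) => z.
  exact: near_schwartz_dist.
apply: filterS => phi hphi.
have E : d = m.+1%:R ^+ N * d' by rewrite /d' mulrCA divff ?mulr1// gt_eqF.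
have key i k : (k <= K)%N ->
   decay N (pure_derive i k (reF (fun x => S0_fun phi x - S0_fun phi0 x))) d /\
   decay N (pure_derive i k (imF (fun x => S0_fun phi x - S0_fun phi0 x))) d.
  move=> kK; rewrite E; apply: seminorm_decay => o; apply: ltW.
  have kK' : (k < K.+1)%N by [].
  exact: (hphi (o, i, Ordinal kK')).
by split=> i k kK; have [] := key i k kK.
Qed.

Lemma S0_parts_bound (m N K : nat) (F : 'rV[R]_m -> R[i]) : S0_parts F -> exists2 A, 0 <= A & bound_parts N K F A.
Proof.
move=> [h1 h2]; have [A A0 hA] := S0_real_bound N K h1; have [B B0 hB] := S0_real_bound N K h2.
exists (A + B); first exact: addr_ge0.
split=> i k kK; first by apply: decay_le (hA i k kK); rewrite lerDl.
by apply: decay_le (hB i k kK); rewrite lerDr.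
Qed.

Lemma comb_bound_L (N K : nat) (F : 'rV[R]_n -> R[i]) (G : 'rV[R]_1 -> R[i]) (A B M : R) :
  S0_parts G -> bound_parts N K F A -> bound_parts N K G B -> A * B <= M ->
  comb_bound N K M (re_comb F G) /\ comb_bound N K M (im_comb F G).
Proof.
move=> [[_ c1 _] [_ c2 _]] [f1 f2] [g1 g2] AB.
have h1 := bound_along_on_line (c1 ord0) (g1 ord0).
have h2 := bound_along_on_line (c2 ord0) (g2 ord0).
by split; split; rewrite /= ?normr1//; [exists A, B|split; rewrite ?normr1//; exists A, B
  |exists A, B|split; rewrite ?normrN1//; exists A, B].
Qed.

Lemma ridgelet_schwartz_Y (F : 'rV[R]_n -> R[i]) (G : 'rV[R]_1 -> R[i]) : S0_parts F -> S0_parts G ->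
  schwartz_Y R n (ridgelet F G).
Proof.
move=> hF hG; have gR := comb_S0_re_comb hF hG; have gI := comb_S0_im_comb hF hG.
have rep := ridgelet_rep hF hG; split; first exact: (represented_smooth gR gI rep).
move=> [[[[l m] k] s] r].
have [C [N [K [C0 h]]]] := @represented_seminorm R n l m k s r.
have [A A0 hA] := S0_parts_bound N K hF; have [B B0 hB] := S0_parts_bound N K hG.
have [b1 b2] := comb_bound_L hG hA hB (lexx _).
by apply: (le_lt_trans (h _ _ _ _ gR gI rep b1 b2)); rewrite ltry.
Qed.

Lemma Ysm_sub (F G : Y R n -> R[i]) : Ysm F -> Ysm G -> Ysm (fun y => F y - G y).
Proof.
move=> [h1 h2] [h3 h4]; split=> N.
  apply: diffN_eq (diffN_add (h1 N) (diffN_scale (-1) (h3 N))) => q _.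
  rewrite /Y_ext mulN1r; case: insub => [y|] /=; last by rewrite subrr.
  by case: (F y); case: (G y).
apply: diffN_eq (diffN_add (h2 N) (diffN_scale (-1) (h4 N))) => q _.
rewrite /Y_ext mulN1r; case: insub => [y|] /=; last by rewrite subrr.
by case: (F y); case: (G y).
Qed.

Definition ridgelet_SY (hn : (0 < n)%N) (z : S0 R n * S0 R 1) : SY R n :=
  SigSub (mem_set (ridgelet_schwartz_Y (S0_S0_parts z.1 hn) (S0_S0_parts z.2 isT))).

Lemma ridgelet_SYE (hn : (0 < n)%N) z :
  SY_fun (ridgelet_SY hn z) = ridgelet (S0_fun z.1) (S0_fun z.2).
Proof. by []. Qed.

(** Besides the smallness of the increment, its representation is recorded: it supplies the
    smoothness that the triangle inequality for [Y_seminorm] demands. *)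
Lemma near_ridgelet_seminorm (phi0 : S0 R n) (psi0 : S0 R 1) j (e : R) : (0 < n)%N -> 0 < e ->
  \forall z \near (phi0, psi0),
   (exists L1 L2, [/\ comb_S0 L1, comb_S0 L2 & represented L1 L2 Base (fun y =>
      ridgelet (S0_fun z.1) (S0_fun z.2) y - ridgelet (S0_fun phi0) (S0_fun psi0) y)]) /\
   (Y_seminorm j (fun y => ridgelet (S0_fun z.1) (S0_fun z.2) y -
      ridgelet (S0_fun phi0) (S0_fun psi0) y)%R < e%:E)%E.
Proof.
move=> n0 e0; case: j => [[[[l m] k] s] r].
have [C [N [K [C0 h]]]] := @represented_seminorm R n l m k s r.
have hF0 := S0_S0_parts phi0 n0; have hG0 := S0_S0_parts psi0 isT.
have [A A0 hA] := S0_parts_bound N K hF0; have [B B0 hB] := S0_parts_bound N K hG0.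
(* [d * S] dominates the three products [d * d], [d * B] and [A * d], as [d <= 1]. Each of the three
   transforms contributes two real and two imaginary terms, twelve in all; [c + 1] below avoids
   dividing by zero. *)
pose S := 1 + A + B; pose c := 12%:R * C * S.
have S1 : 1 <= S by rewrite /S; lra.
have c0 : 0 <= c by rewrite !mulr_ge0// (le_trans ler01).
pose d := Num.min 1 (e / (c + 1)).
have d0 : 0 < d by rewrite lt_min ltr01 divr_gt0// ltr_wpDl.
have d1 : d <= 1 by rewrite ge_min lexx.
have dc : d * c < e.
  apply: (@le_lt_trans _ _ (e / (c + 1) * c)); first by rewrite ler_wpM2r// ge_min lexx orbT.
  by rewrite mulrAC ltr_pdivrMr ?ltr_wpDl// ltr_pM2l// ltrDl.
have near1 : \forall z \near (phi0, psi0), bound_parts N K (fun x => S0_fun z.1 x - S0_fun phi0 x) d.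
  exact: (@cvg_fst _ _ (nbhs phi0) (nbhs psi0) _ _ (near_bound_parts phi0 N K d0)).
have near2 : \forall z \near (phi0, psi0), bound_parts N K (fun x => S0_fun z.2 x - S0_fun psi0 x) d.
  exact: (@cvg_snd _ _ (nbhs phi0) (nbhs psi0) _ _ (near_bound_parts psi0 N K d0)).
near=> z.
have b1 : bound_parts N K (fun x => S0_fun z.1 x - S0_fun phi0 x) d by near: z.
have b2 : bound_parts N K (fun x => S0_fun z.2 x - S0_fun psi0 x) d by near: z.
set D1 := fun x => S0_fun z.1 x - S0_fun phi0 x in b1 *.
set D2 := fun x => S0_fun z.2 x - S0_fun psi0 x in b2 *.
have hF := S0_S0_parts z.1 n0; have hG := S0_S0_parts z.2 isT.
have hD1 : S0_parts D1 := S0_parts_sub hF hF0.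
have hD2 : S0_parts D2 := S0_parts_sub hG hG0.
have rep : represented (re_comb D1 D2 ++ (re_comb D1 (S0_fun psi0) ++ re_comb (S0_fun phi0) D2))
   (im_comb D1 D2 ++ (im_comb D1 (S0_fun psi0) ++ im_comb (S0_fun phi0) D2)) Base
   (fun y => ridgelet (S0_fun z.1) (S0_fun z.2) y - ridgelet (S0_fun phi0) (S0_fun psi0) y).
  move=> y; rewrite ridgelet_sub//.
  have := represented_add (ridgelet_rep hD1 hD2) (represented_add (ridgelet_rep hD1 hG0) (ridgelet_rep hF0 hD2)).
  exact.
have gR : comb_S0 (re_comb D1 D2 ++ (re_comb D1 (S0_fun psi0) ++ re_comb (S0_fun phi0) D2)).
  by apply: comb_S0_cat; [|apply: comb_S0_cat]; exact: comb_S0_re_comb.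
have gI : comb_S0 (im_comb D1 D2 ++ (im_comb D1 (S0_fun psi0) ++ im_comb (S0_fun phi0) D2)).
  by apply: comb_S0_cat; [|apply: comb_S0_cat]; exact: comb_S0_im_comb.
have [m1 m1'] : comb_bound N K (d * S) (re_comb D1 D2) /\ comb_bound N K (d * S) (im_comb D1 D2).
  by apply: (comb_bound_L hD2 b1 b2); rewrite ler_wpM2l ?(ltW d0)// (le_trans d1).
have [m2 m2'] : comb_bound N K (d * S) (re_comb D1 (S0_fun psi0)) /\ comb_bound N K (d * S) (im_comb D1 (S0_fun psi0)).
  by apply: (comb_bound_L hG0 b1 hB); rewrite ler_wpM2l ?(ltW d0)// /S; lra.
have [m3 m3'] : comb_bound N K (d * S) (re_comb (S0_fun phi0) D2) /\ comb_bound N K (d * S) (im_comb (S0_fun phi0) D2).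
  by apply: (comb_bound_L hD2 hA b2); rewrite mulrC ler_wpM2l ?(ltW d0)// /S; lra.
split; first by eexists; eexists; split; [exact: gR|exact: gI|exact: rep].
apply: (le_lt_trans (h _ _ _ _ gR gI rep (comb_bound_cat m1 (comb_bound_cat m2 m3)) (comb_bound_cat m1' (comb_bound_cat m2' m3')))).
rewrite lte_fin /=; apply: le_lt_trans dc.
by rewrite /c -mulr_natl le_eqVlt; apply/orP; left; apply/eqP; ring.
Unshelve. all: by end_near.
Qed.

Lemma ridgelet_SY_continuous (hn : (0 < n)%N) : continuous (ridgelet_SY hn).
Proof.
move=> [phi0 psi0]; apply: cvg_SY => j G0 e hG0.
(* [e - r] is the room left in the ball for the increment. The distance is an extended real, so the
   formal value [-oo] is treated as well, with [r = e - 1]. *)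
have [r hr re] : exists2 r : R, (SY_dist j G0 (ridgelet_SY hn (phi0, psi0)) <= r%:E)%E & r < e.
  move: hG0; case: (SY_dist _ _ _) => [r|//|_].
    by rewrite lte_fin => re; exists r.
  by exists (e - 1); rewrite ?leNye// ltrBlDr ltrDl.
have er : 0 < e - r by rewrite subr_gt0.
have := near_ridgelet_seminorm phi0 psi0 j hn er.
apply: filterS => z [[L1 [L2 [g1 g2 rep]]] hz].
have s1 := Y_smooth_Ysm (represented_smooth g1 g2 rep).
have s2 : Ysm (fun y => SY_fun (ridgelet_SY hn (phi0, psi0)) y - SY_fun G0 y).
  apply: Ysm_sub; apply: Y_smooth_Ysm.
    by have [] := set_valP (ridgelet_SY hn (phi0, psi0)).
  by have [] := set_valP G0.
rewrite /SY_dist.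
have -> : (fun y => SY_fun (ridgelet_SY hn z) y - SY_fun G0 y) =
  (fun y => (ridgelet (S0_fun z.1) (S0_fun z.2) y - ridgelet (S0_fun phi0) (S0_fun psi0) y) +
     (SY_fun (ridgelet_SY hn (phi0, psi0)) y - SY_fun G0 y)).
  by apply/funext => y; rewrite !ridgelet_SYE; ring.
apply: (le_lt_trans (Y_seminorm_add j s1 s2)); apply: (le_lt_trans (leeD (lexx _) hr)).
rewrite -(subrK r e) EFinD; exact: lte_leD.
Qed.

End Continuity.

Theorem theorem4p1 (R : realType) (n : nat) (hn : (2 <= n)%N) :
  (forall (phi : S0 R n) (psi : S0 R 1) (y : Y R n),
     rn_integrable (ridgelet_integrand (S0_fun phi) (S0_fun psi) y)) /\
  (forall (c : R[i]) (phi1 phi2 : S0 R n) (psi : S0 R 1) (y : Y R n),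
     ridgelet (fun x => c * S0_fun phi1 x + S0_fun phi2 x) (S0_fun psi) y =
     c * ridgelet (S0_fun phi1) (S0_fun psi) y
       + ridgelet (S0_fun phi2) (S0_fun psi) y) /\
  (forall (c : R[i]) (phi : S0 R n) (psi1 psi2 : S0 R 1) (y : Y R n),
     ridgelet (S0_fun phi) (fun x => c * S0_fun psi1 x + S0_fun psi2 x) y =
     (c^*)%C * ridgelet (S0_fun phi) (S0_fun psi1) y
       + ridgelet (S0_fun phi) (S0_fun psi2) y) /\
  exists T : S0 R n * S0 R 1 -> SY R n,
    (forall (phi : S0 R n) (psi : S0 R 1) (y : Y R n),
       SY_fun (T (phi, psi)) y = ridgelet (S0_fun phi) (S0_fun psi) y) /\
    continuous T.
Proof.
have n0 : (0 < n)%N by exact: ltnW.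
split; last split; last split.
- move=> phi psi y.
  have [h1 h2] := L1_parts_integrand y (S0_S0_parts phi n0) (S0_S0_parts psi isT).
  by split; [exact: (L1_integrable h1)|exact: (L1_integrable h2)].
- by move=> c phi1 phi2 psi y; apply: ridgelet_linl; exact: S0_S0_parts.
- by move=> c phi psi1 psi2 y; apply: ridgelet_linr; exact: S0_S0_parts.
- exists (ridgelet_SY n0); split => //; exact: ridgelet_SY_continuous.
Qed.
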